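(* Let $R$ be the reversible Brownian motion on $\mathbb{R}^n$, and let $\mu_0,\mu_1$ be probability measures on $\mathbb{R}^n$ whose densities with respect to Lebesgue measure $\mathcal{L}$ belong to $C_c^\infty(\mathbb{R}^n)$. Let $(\mu_s)_{s\in[0,1]}$ be the ($R$-)entropic interpolation between $\mu_0$ and $\mu_1$. Then the function $$\Psi:[0,1]\ni s\longmapsto e^{-H(\mu_s|\mathcal{L})/n}$$ is concave.
   Context: $\mathcal{L}$ is Lebesgue measure on $\mathbb{R}^n$. Probability measures that are absolutely continuous with respect to $\mathcal{L}$ are identified with their densities. Heat semigroup: for $t>0$, $T_tf(x)=\int f(y)\,\frac{e^{-|x-y|^2/2t}}{(2\pi t)^{n/2}}\,dy$, and $T_0f=f$ (generator $L=\Delta/2$). Relative entropy: for a probability measure $p$ and a $\sigma$-finite positive measure $r$ on the same space, $H(p|r)=\int\log\frac{dp}{dr}\,dp$ if $p\ll r$ and $+\infty$ otherwise. When $r$ is unbounded this is understood as follows: choose a measurable $W\ge0$ with $z_W=\int e^{-W}dr<\infty$ and $\int W\,dp<\infty$, set $dr^W=e^{-W}dr/z_W$, and put $H(p|r)=H(p|r^W)-\int W\,dp-\log z_W$. For $r=\mathcal{L}$ one can take $W=|x|^2$. Reversible Brownian motion: $R$ is the positive (unbounded) measure on $\Omega=C([0,1],\mathbb{R}^n)$ which is the law of Brownian motion with generator $\Delta/2$ and initial measure $\mathcal{L}$. $(X_t)_{t\in[0,1]}$ is the canonical process on $\Omega$, and $P_t=(X_t)_\#P$. Entropic interpolation: for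 $\mu_0,\mu_1$ as in the claim, the problem $\inf\{H(P|R): P\text{ a probability measure on }\Omega,\ P_0=\mu_0,\ P_1=\mu_1\}$ has a unique minimizer $\hat P$, of the form $\hat P=f(X_0)g(X_1)R$, where $f,g\ge 0$ solve the Schrödinger system $\mu_0=f\,T_1g$, $\mu_1=g\,T_1f$. The ($R$-)entropic interpolation between $\mu_0$ and $\mu_1$ is the marginal flow $\mu_s=\hat P_s$; equivalently $d\mu_s=T_sf\,T_{1-s}g\,d\mathcal{L}$, $0\le s\le1$. *)

(* Defs.v *)
From HB Require Import structures.
From mathcomp Require Import all_boot all_order all_algebra.
From mathcomp Require Import all_classical all_reals all_analysis.
From mathcomp Require Import measurable_realfun.

Set Implicit Arguments.
Unset Strict Implicit.
Unset Printing Implicit Defensive.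

Import Order.TTheory GRing.Theory Num.Theory.
Import numFieldNormedType.Exports.

Local Open Scope classical_set_scope.
Local Open Scope ring_scope.

(* The sigma-algebra generated by the n coordinates, i.e. the Borel
   sigma-algebra of 'rV[R]_n. *)
Section rV_measurable.
Context (R : realType) (n : nat).

Let coord : 'I_n -> 'rV[R]_n -> measurableTypeR R := fun i v => v ord0 i.

Let rV_set0 : g_sigma_preimage coord set0.
Proof. exact: sigma_algebra0. Qed.

Let rV_setC A : g_sigma_preimage coord A -> g_sigma_preimage coord (~` A).
Proof. exact: sigma_algebraC. Qed.

Let rV_bigcup (F : (set 'rV[R]_n)^nat) :
  (forall i, g_sigma_preimage coord (F i)) ->
  g_sigma_preimage coord (\bigcup_i F i).
Proof. exact: sigma_algebra_bigcup. Qed.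

HB.instance Definition _ := @isMeasurable.Build default_measure_display 'rV[R]_n
  (g_sigma_preimage coord) rV_set0 rV_setC rV_bigcup.

Lemma measurable_rV_coord (i : 'I_n) :
  measurable_fun [set: 'rV[R]_n] (fun v => v ord0 i : measurableTypeR R).
Proof.
move=> _ Y mY; rewrite setTI; apply: sub_sigma_algebra => /=.
rewrite -bigcup_seq/=; exists i => /=; first by rewrite mem_index_enum.
by exists Y => //; rewrite setTI.
Qed.

Lemma measurable_fun_rVP d (T : measurableType d) (f : T -> 'rV[R]_n) :
  (forall i, measurable_fun [set: T] (fun x => f x ord0 i : measurableTypeR R)) ->
  measurable_fun [set: T] f.
Proof.
move=> mf; apply: (@measurability _ _ _ _ _ _
  (\big[setU/set0]_(i < n) preimage_set_system setT (coord i) measurable)) => //.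
move=> _ [B + <-]; rewrite -bigcup_seq/= => -[i _ [C mC <-]].
by rewrite setTI; exact: mf.
Qed.

End rV_measurable.

(* Lebesgue measure on R^n is defined as the n-fold product of the
   one-dimensional one. *)
Section lebesgue_rV.
Context (R : realType).

Definition rV_cons (n : nat) (p : measurableTypeR R * 'rV[R]_n) : 'rV[R]_n.+1 :=
  \row_i if unlift ord0 i is Some j then p.2 ord0 j else p.1.

Lemma rV_cons0 n p : @rV_cons n p ord0 ord0 = p.1.
Proof. by rewrite mxE unlift_none. Qed.

Lemma rV_consS n p (i : 'I_n) : @rV_cons n p ord0 (lift ord0 i) = p.2 ord0 i.
Proof. by rewrite mxE liftK. Qed.

Lemma measurable_rV_cons n : measurable_fun setT (@rV_cons n).
Proof.
apply: measurable_fun_rVP => i; case: (unliftP ord0 i) => [j|] ->.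
- rewrite (_ : (fun _ => _) = (fun v : 'rV[R]_n => v ord0 j) \o snd).
    exact: (measurableT_comp (measurable_rV_coord j) measurable_snd).
  by apply/funext => p; rewrite /= rV_consS.
- rewrite (_ : (fun _ => _) = fst); first exact: measurable_fst.
  by apply/funext => p; rewrite rV_cons0.
Qed.

HB.instance Definition _ n := isMeasurableFun.Build _ _ _ _ (@rV_cons n)
  (@measurable_rV_cons n).

Definition rV_uncons n (v : 'rV[R]_n.+1) : measurableTypeR R * 'rV[R]_n :=
  (v ord0 ord0, \row_i v ord0 (lift ord0 i)).

Lemma rV_consK n : cancel (@rV_cons n) (@rV_uncons n).
Proof.
move=> [x v]; rewrite /rV_uncons rV_cons0; congr pair.
by apply/rowP => i; rewrite mxE rV_consS.
Qed.

Lemma measurable_rV_uncons n : measurable_fun setT (@rV_uncons n).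
Proof.
apply: measurable_fun_pair; first exact: measurable_rV_coord.
apply: measurable_fun_rVP => i; rewrite (_ : (fun _ => _) =
  (fun v : 'rV[R]_n.+1 => v ord0 (lift ord0 i) : measurableTypeR R)).
  exact: measurable_rV_coord.
by apply/funext => v; rewrite mxE.
Qed.

Section step.
Context (n : nat) (m : {sigma_finite_measure set 'rV[R]_n -> \bar R}).

Definition lebesgue_rV_step : set 'rV[R]_n.+1 -> \bar R :=
  pushforward (@lebesgue_measure R \x m)%E (@rV_cons n).

HB.instance Definition _ := Measure.copy lebesgue_rV_step
  (measure_function_pushforward__canonical__measure_function_Measure
    (@lebesgue_measure R \x m)%E (@measurable_rV_cons n)).

Let step_sigma_finite : sigma_finite setT lebesgue_rV_step.
Proof.
have /sigma_finiteP[F [TF ndF Foo]] := sigma_finiteT (@lebesgue_measure R).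
have /sigma_finiteP[G [TG ndG Goo]] := sigma_finiteT m.
exists (fun i => (@rV_uncons n) @^-1` (F i `*` G i)).
  rewrite -preimage_bigcup -(preimage_setT (@rV_uncons n)) -setXTT TF TG.
  congr (_ @^-1` _); rewrite predeqE => -[x y]; split.
    move=> [/= [i _ Fix] [k _ Gky]]; exists (maxn i k) => //; split.
    - by move: x Fix; exact/subsetPset/ndF/leq_maxl.
    - by move: y Gky; exact/subsetPset/ndG/leq_maxr.
  by move=> [i _ []/= ? ?]; split; exists i.
move=> i; have [mF Fi] := Foo i; have [mG Gi] := Goo i; split.
  rewrite -[X in measurable X]setTI; apply: measurable_rV_uncons => //.
  exact: measurableX.
rewrite /lebesgue_rV_step /pushforward -comp_preimage.
rewrite (_ : _ \o _ = id) ?preimage_id; last exact/funext/rV_consK.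
by rewrite product_measure1E// lte_mul_pinfty// ge0_fin_numE.
Qed.

HB.instance Definition _ :=
  Measure_isSigmaFinite.Build _ _ _ lebesgue_rV_step step_sigma_finite.

End step.

Fixpoint lebesgue_rV (n : nat) : {sigma_finite_measure set 'rV[R]_n -> \bar R} :=
  if n is m.+1 then lebesgue_rV_step (lebesgue_rV m) else \d_(0 : 'rV[R]_0).

Lemma lebesgue_rV_box n (A : 'I_n -> set R) :
  (forall i, measurable (A i)) ->
  lebesgue_rV n [set v | forall i, A i (v ord0 i)] =
  (\prod_(i < n) lebesgue_measure (A i))%E.
Proof.
elim: n A => [|n IH] A mA.
  by rewrite big_ord0 /= diracE mem_set// => -[].
rewrite big_ord_recl -IH; last by move=> i; exact: mA.
rewrite /= /lebesgue_rV_step /pushforward.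
rewrite -product_measure1E//; last first.
  rewrite [X in measurable X](_ : _ = \big[setI/setT]_(i < n)
     ((fun v : 'rV[R]_n => v ord0 i : measurableTypeR R) @^-1`
      A (lift ord0 i))); last first.
    rewrite -bigcap_seq; apply/seteqP; split => [v Av i _|v Av i]; first exact: Av.
    by apply: Av; rewrite /= mem_index_enum.
  apply: bigsetI_measurable => i _.
  by rewrite -[X in measurable X]setTI; apply: measurable_rV_coord; last exact: mA.
  exact: mA.
congr (_ _); apply/seteqP; split => [p /= Ap|p [/= A0 AS] i].
- split=> [|i]; first by have := Ap ord0; rewrite rV_cons0.
  by have := Ap (lift ord0 i); rewrite rV_consS.
- case: (unliftP ord0 i) => [j|] ->; last by rewrite rV_cons0.
  by rewrite rV_consS.
Qed.

End lebesgue_rV.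

Section entropy.
Context d (T : measurableType d) (R : realType).
Local Open Scope charge_scope.
Local Open Scope ereal_scope.

Definition entropy_prob (p q : probability T R) : \bar R :=
  if pselect (p `<< q)
  then \int[p]_x lne ('d (charge_of_finite_measure p) '/d q x)
  else +oo.

Definition exp_weight (r : {measure set T -> \bar R}) (W : {mfun T >-> R})
  (A : set T) : \bar R := \int[r]_(x in A) (expR (- W x))%:E.

Section exp_weight_measure.
Context (r : {measure set T -> \bar R}) (W : {mfun T >-> R}).

Let weight0 : exp_weight r W set0 = 0.
Proof. exact: integral_set0. Qed.

Let weight_ge0 A : 0 <= exp_weight r W A.
Proof. by apply: integral_ge0 => x _; rewrite lee_fin expR_ge0. Qed.

Let weight_sigma_additive : semi_sigma_additive (exp_weight r W).
Proof.
apply: semi_sigma_additive_nng_induced => [|x]; last by rewrite lee_fin expR_ge0.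
apply/measurable_EFinP; apply: measurableT_comp => //.
exact: measurable_funN.
Qed.

HB.instance Definition _ := isMeasure.Build _ _ _ (exp_weight r W)
  weight0 weight_ge0 weight_sigma_additive.

End exp_weight_measure.

Definition admissible_weight (p : probability T R)
    (r : {measure set T -> \bar R}) (W : {mfun T >-> R}) : Prop :=
  [/\ forall x, (0 <= W x)%R, exp_weight r W setT < +oo &
      \int[p]_x (W x)%:E < +oo].

(* [mnormalize (exp_weight r W) p] is e^{-W} r / z_W; its second argument is
   only used when z_W is 0 or +oo. *)
Definition entropy_weight (p : probability T R)
    (r : {measure set T -> \bar R}) (W : {mfun T >-> R}) : \bar R :=
  entropy_prob p (mnormalize (exp_weight r W) p)
  - \int[p]_x (W x)%:E - lne (exp_weight r W setT).

(* The value does not depend on the admissible weight W; without an admissible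
   weight the relative entropy is undefined, and +oo is a dummy value. *)
Definition entropy (p : probability T R) (r : {measure set T -> \bar R})
    : \bar R :=
  match pselect (exists W, admissible_weight p r W) with
  | left W_ex => entropy_weight p r (sval (cid W_ex))
  | right _ => +oo
  end.

End entropy.

Section heat.
Context (R : realType) (n : nat).

(* The norm `|x| of 'rV[R]_n is the sup norm, hence the explicit Euclidean norm. *)
Definition sqr_norm2 (x : 'rV[R]_n) : R := \sum_i x ord0 i ^+ 2.

Definition heat_kernel (t : R) (x y : 'rV[R]_n) : R :=
  expR (- sqr_norm2 (x - y) / (2 * t)) / (2 * pi * t) `^ (n%:R / 2).

Definition heat (t : R) (f : 'rV[R]_n -> \bar R) (x : 'rV[R]_n) : \bar R :=
  if t == 0 then f x
  else (\int[lebesgue_rV R n]_y (f y * (heat_kernel t x y)%:E))%E.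

End heat.

Section paths.
Context (R : realType) (n : nat).

Definition time : Type := set_type `[0%R : R, 1%R]%classic.

HB.instance Definition _ := Topological.on time.

Fact time0_subproof : (0 : R) \in `[0%R, 1%R]%classic.
Proof. by rewrite inE /= in_itv /= lexx ler01. Qed.

Fact time1_subproof : (1 : R) \in `[0%R, 1%R]%classic.
Proof. by rewrite inE /= in_itv /= lexx ler01. Qed.

Definition time0 : time := exist _ 0 time0_subproof.
Definition time1 : time := exist _ 1 time1_subproof.

Definition path_space : Type := continuousType time 'rV[R]_n.

HB.instance Definition _ := Choice.on path_space.
HB.instance Definition _ :=
  isPointed.Build path_space (mkcts (@cst_continuous time 'rV[R]_n 0)).

Definition canonical_process (t : time) (w : path_space) : 'rV[R]_n :=
  (w : continuousType time 'rV[R]_n) t.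

Let cylinders : set (set path_space) :=
  \bigcup_t preimage_set_system setT (canonical_process t) measurable.

HB.instance Definition _ := @isMeasurable.Build default_measure_display path_space
  <<s cylinders >> (@sigma_algebra0 _ setT cylinders) (@sigma_algebraC _ cylinders)
  (@sigma_algebra_bigcup _ setT cylinders).

Lemma measurable_canonical_process t : measurable_fun setT (canonical_process t).
Proof.
move=> _ Y mY; rewrite setTI; apply: sub_sigma_algebra.
by exists t => //; exists Y => //; rewrite setTI.
Qed.

Definition marginal (P : {measure set path_space -> \bar R}) (t : time)
    (mu : {measure set 'rV[R]_n -> \bar R}) : Prop :=
  forall A, measurable A -> pushforward P (canonical_process t) A = mu A.

Fixpoint cylinder (l : seq (time * set 'rV[R]_n)) : set path_space :=
  if l is (t, A) :: l' then canonical_process t @^-1` A `&` cylinder l' else setT.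

(* For s <= t_1 <= ... <= t_k,
   cylinder_prob s [:: (t_1, A_1); ...; (t_k, A_k)] x is
   T_(t_1 - s) (1_(A_1) T_(t_2 - t_1) (1_(A_2) ... T_(t_k - t_(k-1)) 1_(A_k))) x,
   the probability that a Brownian motion located at x at time s is
   in A_i at time t_i for all i. *)
Fixpoint cylinder_prob (s : R) (l : seq (time * set 'rV[R]_n)) :
    'rV[R]_n -> \bar R :=
  if l is (t, A) :: l' then
    heat (val t - s) (fun y => (\1_A y)%:E * cylinder_prob (val t) l' y)%E
  else cst 1%E.

(* The law of the Brownian motion with generator Delta/2 and initial measure
   Lebesgue, given by its finite-dimensional distributions. *)
Definition reversible_brownian_motion (Rm : {measure set path_space -> \bar R})
    : Prop :=
  forall (A0 : set 'rV[R]_n) (l : seq (time * set 'rV[R]_n)),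
    measurable A0 -> (forall p, p \in l -> measurable p.2) ->
    sorted <=%R [seq val p.1 | p <- l] ->
    Rm (canonical_process time0 @^-1` A0 `&` cylinder l) =
    (\int[lebesgue_rV R n]_(x in A0) cylinder_prob 0 l x)%E.

End paths.

Section interpolation.
Context (R : realType) (n : nat).
Local Notation V := 'rV[R]_n.
Local Notation leb := (lebesgue_rV R n).

(* The density may be +oo-valued because heat is; as usual 0 * +oo = 0. *)
Definition has_density (mu : {measure set V -> \bar R}) (rho : V -> \bar R) : Prop :=
  forall A, measurable A -> mu A = (\int[leb]_(x in A) rho x)%E.

Definition iter_partial (s : seq 'I_n) (f : V -> R) : V -> R :=
  foldr (fun i g x => 'D_(delta_mx ord0 i) g x) f s.

(* All partial derivatives of all orders exist and are continuous. *)
Definition smooth (f : V -> R) : Prop :=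
  forall s : seq 'I_n, continuous (iter_partial s f) /\
    forall (i : 'I_n) (x : V), derivable (iter_partial s f) x (delta_mx ord0 i).

Definition compactly_supported (f : V -> R) : Prop :=
  compact (closure [set x | f x != 0]).

Definition Ccinfty_density (mu : probability V R) : Prop :=
  exists rho : V -> R,
    [/\ smooth rho, compactly_supported rho & has_density mu (EFin \o rho)].

Definition schroedinger_system (mu0 mu1 : probability V R) (f g : V -> R) : Prop :=
  has_density mu0 (fun x => (f x)%:E * heat 1 (EFin \o g) x)%E /\
  has_density mu1 (fun x => (g x)%:E * heat 1 (EFin \o f) x)%E.

Definition coupling (mu0 mu1 : probability V R)
    (P : probability (path_space R n) R) : Prop :=
  marginal P (time0 R) mu0 /\ marginal P (time1 R) mu1.

Definition schroedinger_minimizer (Rm : {measure set (path_space R n) -> \bar R})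
    (mu0 mu1 : probability V R) (Phat : probability (path_space R n) R) : Prop :=
  coupling mu0 mu1 Phat /\
  forall P, coupling mu0 mu1 P -> (entropy Phat Rm <= entropy P Rm)%E.

Definition fg_transform (Rm : {measure set (path_space R n) -> \bar R})
    (f g : V -> R) (Phat : probability (path_space R n) R) : Prop :=
  forall B, measurable B -> Phat B =
    (\int[Rm]_(w in B) (f (canonical_process (time0 R) w) *
                        g (canonical_process (time1 R) w))%:E)%E.

(* Phat is the unique minimizer; its factorization f(X_0) g(X_1) R, with (f, g)
   a solution of the Schroedinger system, is recorded along with minimality.
   Only the restriction of mu to [0, 1] is constrained. *)
Definition entropic_interpolation (Rm : {measure set (path_space R n) -> \bar R})
    (mu0 mu1 : probability V R) (mu : R -> probability V R) : Prop :=
  exists (Phat : probability (path_space R n) R) (f g : V -> R),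
    [/\ schroedinger_minimizer Rm mu0 mu1 Phat,
        [/\ measurable_fun setT f, measurable_fun setT g,
            forall x, 0 <= f x & forall x, 0 <= g x],
        schroedinger_system mu0 mu1 f g,
        fg_transform Rm f g Phat &
        forall t : time R, marginal Phat t (mu (val t))].

End interpolation.

Definition concave_function (R : realType) (D : set R) (f : R -> R) : Prop :=
  @convex_function R R^o D (fun s => - f s).

(* Main.v *)
(** Write the interpolation as rho_s = exp (phi_s + psi_s), where phi_s = ln (T_s f)
    and psi_s = ln (T_(1-s) g) satisfy the forward and the backward
    Hamilton-Jacobi-Bellman equations. Integration by parts gives, for
    H(s) = \int rho_s ln rho_s,
      H'  = 1/2 \int rho_s (|grad psi_s|^2 - |grad phi_s|^2)
          = 1/2 \int rho_s Delta (phi_s - psi_s),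
      H'' = 1/2 \int rho_s (|D^2 phi_s|^2 + |D^2 psi_s|^2),
    whence (H')^2 <= n H'' by Cauchy-Schwarz, i.e. exp (- H / n) is concave on ]0, 1[.
    The Schroedinger system f T_1 g = mu_0, g T_1 f = mu_1 shows that f and g agree
    almost everywhere with continuous compactly supported functions. Hence T_s f is an
    explicit Gaussian times the Laplace transform of a compactly supported function,
    so that all the integrals converge, and H is continuous at 0 and 1 by dominated
    convergence. *)
Require Import Defs.
From HB Require Import structures.
From mathcomp Require Import all_boot all_order all_algebra.
From mathcomp Require Import all_classical all_reals all_analysis.
From mathcomp Require Import measurable_realfun.
From mathcomp Require Import ring lra.

Set Implicit Arguments.
Unset Strict Implicit.
Unset Printing Implicit Defensive.

Import Order.TTheory GRing.Theory Num.Theory.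
Import numFieldNormedType.Exports.

Local Open Scope classical_set_scope.
Local Open Scope ring_scope.

(** * Integration on R^n *)

(** The singularities at the two ends shape the proof: 1/s and the Gaussian prefactors blow up as s
    tends to 0. The differential identities are therefore proved on intervals ]a, b[ with 0 < a < b
    < 1, and the endpoints are reached by one-sided continuity of H only. On such an interval two
    growth classes replace explicit estimates: [tame] families (phi, psi, their derivatives,
    polynomials in these) and [gaussian] families (rho times a tame family). For the latter,
    differentiation under the integral and integration by parts need no further justification. H is
    split into \int rho phi and \int rho psi; exchanging phi and psi changes the sign of the time
    direction, so a parameter kappa equal to 1 or -1 lets one computation serve both halves. Near an
    endpoint one heat flow loses its Gaussian decay and is only bounded by the supremum of its
    source, while the other one, run for a time close to 1, supplies the decay; this is why bounded
    versions of f and g are needed, and not just integrable ones. *)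

Section lebesgue_rV_integral.
Context (R : realType).
Local Open Scope ereal_scope.

(** [lebesgue_rV] is an iterated pushforward of products, so Tonelli peels off one coordinate; this
    is the inductive step of the integral computations on R^n below. *)
Lemma ge0_integral_rV_cons (n : nat) (F : 'rV[R]_n.+1 -> \bar R) :
  measurable_fun setT F -> (forall x, 0 <= F x) ->
  \int[lebesgue_rV R n.+1]_x F x =
  \int[@lebesgue_measure R]_a \int[lebesgue_rV R n]_v F (rV_cons (a, v)).
Proof.
move=> mF F0.
rewrite [LHS](@ge0_integral_pushforward _ _ _ _ _ _ (@measurable_rV_cons R n))//.
rewrite preimage_setT (fubini_tonelli1 (F \o @rV_cons R n))//.
- by apply: measurableT_comp => //; exact: measurable_rV_cons.
- by move=> x; exact: F0.
Qed.

Lemma integral_rV_prod (n : nat) (g : 'I_n -> R -> R) (c : R) :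
  (forall i, measurable_fun setT (g i)) -> (forall i x, (0 <= g i x)%R) ->
  (forall i, \int[@lebesgue_measure R]_x (g i x)%:E = c%:E) ->
  \int[lebesgue_rV R n]_x (\prod_(i < n) g i (x ord0 i))%:E = (c ^+ n)%:E.
Proof.
elim: n g => [|n IH] g mg g0 gc.
  rewrite /= integral_dirac//; last by apply/measurable_EFinP; under eq_fun do rewrite big_ord0; exact: measurable_cst.
  by rewrite big_ord0 expr0 diracT mul1e.
have mp (m : nat) (h : 'I_m -> R -> R) (mh : forall i, measurable_fun setT (h i)) :
    measurable_fun setT (fun x : 'rV[R]_m => (\prod_(i < m) h i (x ord0 i))%R).
  apply: measurable_prod => i _.
  exact: (measurableT_comp (mh i) (measurable_rV_coord i)).
rewrite ge0_integral_rV_cons//; last 2 first.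
- by apply/measurable_EFinP; exact: (mp _ g mg).
- by move=> x; rewrite lee_fin; apply: prodr_ge0 => i _; exact: g0.
have c0 : (0 <= c)%R.
  by rewrite -lee_fin -(gc ord0); apply: integral_ge0 => x _; rewrite lee_fin.
under eq_integral => a _.
  under eq_integral => v _.
    rewrite big_ord_recl rV_cons0/=.
    under eq_bigr do rewrite rV_consS/=.
    rewrite EFinM.
    over.
  rewrite ge0_integralZl//; last 3 first.
  - by apply/measurable_EFinP; exact: (mp _ (fun i => g (lift ord0 i)) (fun i => mg _)).
  - by move=> x _; rewrite lee_fin; apply: prodr_ge0 => i _; exact: g0.
  - by rewrite lee_fin.
  rewrite (IH (fun i => g (lift ord0 i)))//.
  over.
rewrite ge0_integralZr//; last 3 first.
- by apply/measurable_EFinP; exact: mg.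
- by move=> x _; rewrite lee_fin.
- by rewrite lee_fin exprn_ge0.
by rewrite gc -EFinM exprS.
Qed.

(** By uniqueness of Lebesgue measure: its translate gives half-open intervals the same length. *)
Lemma ge0_integral_shift1 (F : R -> \bar R) (c : R) :
  measurable_fun setT F -> (forall x, 0 <= F x) ->
  \int[@lebesgue_measure R]_x F (x + c)%R = \int[@lebesgue_measure R]_x F x.
Proof.
move=> mF F0.
have ms : measurable_fun setT (fun x : measurableTypeR R => (x + c)%R : measurableTypeR R).
  exact: measurable_funD.
transitivity (\int[pushforward (@lebesgue_measure R) (fun x : measurableTypeR R => (x + c)%R : measurableTypeR R)]_x F x).
  by rewrite ge0_integral_pushforward.
apply: eq_measure_integral => A mA _.
apply/esym; apply: (@lebesgue_measure_unique R
  (measure_function_pushforward__canonical__measure_function_Measure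
    (@lebesgue_measure R) ms)) => //= _ [[a b]] _ <-.
rewrite /pushforward (_ : _ @^-1` _ = `](a - c)%R, (b - c)%R]%classic); last first.
  by apply/seteqP; split => x /=; rewrite !in_itv/= ltrBlDr lerBrDr.
rewrite /= !lebesgue_measure_itv/= !lte_fin ltrD2r; case: ifPn => // _.
by rewrite -!EFinB opprB addrA subrK.
Qed.

Lemma measurable_rV_shift (n : nat) (c : 'rV[R]_n) :
  measurable_fun setT (fun x : 'rV[R]_n => (x + c)%R).
Proof.
apply: measurable_fun_rVP => i; under eq_fun do rewrite mxE.
by apply: measurable_funD => //; exact: measurable_rV_coord.
Qed.

Lemma ge0_integral_rV_shift (n : nat) (F : 'rV[R]_n -> \bar R) (c : 'rV[R]_n) :
  measurable_fun setT F -> (forall x, 0 <= F x) ->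
  \int[lebesgue_rV R n]_x F (x + c)%R = \int[lebesgue_rV R n]_x F x.
Proof.
elim: n F c => [|n IH] F c mF F0.
  by apply: eq_integral => x _; congr F; apply/rowP => -[].
have mFc : measurable_fun setT (fun x : 'rV[R]_n.+1 => F (x + c)%R).
  by apply: (measurableT_comp mF); exact: measurable_rV_shift.
rewrite !ge0_integral_rV_cons//.
pose c' := (\row_i c ord0 (lift ord0 i) : 'rV[R]_n)%R.
transitivity (\int[@lebesgue_measure R]_a \int[lebesgue_rV R n]_v F (rV_cons (a + c ord0 ord0, v))%R).
  apply: eq_integral => a _.
  rewrite -[RHS](IH (fun v => F (rV_cons (a + c ord0 ord0, v))%R) c')//.
    apply: eq_integral => v _; congr F; apply/rowP => i; rewrite !mxE.
    by case: unliftP => [j|] ->; rewrite /= ?mxE.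
  apply: measurableT_comp => //; apply: measurableT_comp; first exact: measurable_rV_cons.
  exact: measurable_pair1.
pose G a := \int[lebesgue_rV R n]_v F (rV_cons (a, v))%R.
rewrite (ge0_integral_shift1 (F := G))//.
- have := @measurable_fun_fubini_tonelli_F _ _ _ _ _ (lebesgue_rV R n) (F \o @rV_cons R n).
  apply => //; last by move=> x; exact: F0.
  by apply: measurableT_comp => //; exact: measurable_rV_cons.
- by move=> x; exact: integral_ge0.
Qed.

Lemma integral_rV_shift (n : nat) (F : 'rV[R]_n -> \bar R) (c : 'rV[R]_n) :
  measurable_fun setT F ->
  \int[lebesgue_rV R n]_x F (x + c)%R = \int[lebesgue_rV R n]_x F x.
Proof.
move=> mF; rewrite integralE [RHS]integralE; congr (_ - _).
- rewrite -(ge0_integral_rV_shift c (measurable_funepos mF))//.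
  by apply: eq_integral => x _; rewrite !funeposE.
- rewrite -(ge0_integral_rV_shift c (measurable_funeneg mF))//.
  by apply: eq_integral => x _; rewrite !funenegE.
Qed.

End lebesgue_rV_integral.

(** * Change of measure by a density *)

Section density.
Context d (T : measurableType d) (R : realType).
Local Open Scope ereal_scope.
Import HBNNSimple.

(** Neither measure is assumed finite and [k] may be infinite: the lemma is applied to the unbounded
    path measure and to densities built from [heat]. *)
Lemma ge0_integral_density (m1 m2 : {measure set T -> \bar R}) (k : T -> \bar R) :
  measurable_fun setT k -> (forall x, 0 <= k x) ->
  (forall A, measurable A -> m1 A = \int[m2]_(x in A) k x) ->
  forall f : T -> \bar R, measurable_fun setT f -> (forall x, 0 <= f x) ->
  \int[m1]_x f x = \int[m2]_x (f x * k x).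
Proof.
move=> mk k0 m12 f mf f0.
pose h := nnsfun_approx measurableT mf.
have -> : \int[m1]_x f x = limn (fun n => \int[m1]_x (h n x)%:E).
  rewrite -monotone_convergence//.
  - apply: eq_integral => x _; apply/esym/cvg_lim => //.
    exact: cvg_nnsfun_approx.
  - by move=> n; exact/measurable_EFinP.
  - by move=> n x _; rewrite lee_fin.
  - by move=> x _ a b ab; rewrite lee_fin; exact/lefP/nd_nnsfun_approx.
have -> : \int[m2]_x (f x * k x) = limn (fun n => \int[m2]_x ((h n x)%:E * k x)).
  rewrite -monotone_convergence//.
  - apply: eq_integral => x _; apply/esym/cvg_lim => //.
    have := @cvg_nnsfun_approx _ _ _ _ measurableT f mf (fun x _ => f0 x) x I.
    rewrite -/h => hf.
    have [kfin|] := boolP (k x \is a fin_num).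
      by apply: cvgeZr.
    (* Where the density is infinite the product is not continuous at 0: either [f x] and all its
       approximations vanish, or the approximations are eventually positive and the product is
       eventually [+oo]. *)
    rewrite ge0_fin_numE// -leNgt leye_eq => /eqP kx.
    rewrite kx.
    have [fx0|fx0] := eqVneq (f x) 0.
      rewrite fx0 mul0e.
      have hn0 n : (h n x)%:E = 0.
        apply/eqP; rewrite eq_le; apply/andP; split; last by rewrite lee_fin.
        by rewrite -fx0 nnsfun_approxE; exact: le_approx.
      rewrite [X in X @ _ --> _](_ : _ = cst 0); first exact: cvg_cst.
      by apply/funext => n; rewrite hn0 mul0e.
    rewrite gt0_muley; last by rewrite lt0e fx0 f0.
    have f1 : 0 < f x by rewrite lt0e fx0 f0.
    apply: cvg_near_cst.
    have : \forall n \near \oo, 0 < (h n x)%:E := hf _ (open_ereal_gt' f1).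
    by apply: filterS => n /= hn; rewrite gt0_muley.
  - by move=> n; apply: emeasurable_funM => //; exact/measurable_EFinP.
  - by move=> n x _; rewrite mule_ge0// lee_fin.
  - by move=> x _ a b ab; rewrite lee_wpmul2r// lee_fin; exact/lefP/nd_nnsfun_approx.
congr (limn _); apply/funext => n.
transitivity (\sum_(r \in range (h n)) \int[m1]_x (r * \1_(h n @^-1` [set r]) x)%:E).
  under eq_integral do rewrite fimfunE -fsumEFin//.
  rewrite ge0_integral_fsum//.
  - by move=> r; exact/measurable_EFinP/measurable_funM.
  - by move=> m y _; exact: nnfun_muleindic_ge0.
transitivity (\sum_(r \in range (h n)) \int[m2]_x ((r * \1_(h n @^-1` [set r]) x)%:E * k x)); last first.
  rewrite -ge0_integral_fsum//.
  - apply: eq_integral => x _.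
    rewrite [in RHS]fimfunE -fsumEFin// ge0_mule_fsuml// => y.
    exact: nnfun_muleindic_ge0.
  - move=> r; apply: emeasurable_funM => //.
    exact/measurable_EFinP/measurable_funM.
  - by move=> m y _; rewrite mule_ge0//; exact: nnfun_muleindic_ge0.
apply: eq_fsbigr => r; rewrite inE => -[t _ <-].
have r0 : (0 <= h n t)%R by [].
under eq_integral do rewrite EFinM.
rewrite ge0_integralZl//; last first.
  exact/measurable_EFinP.
under [RHS]eq_integral do rewrite EFinM -muleA.
rewrite ge0_integralZl//; last 2 first.
- by apply: emeasurable_funM => //; exact/measurable_EFinP.
- by move=> x _; rewrite mule_ge0// lee_fin.
congr (_ * _); rewrite integral_indic// setIT m12//.
rewrite integral_mkcond; apply: eq_integral => x _.
by rewrite epatch_indic muleC.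
Qed.

End density.

(** * Measurability of continuous functions on R^n *)

Section continuous_rV.
Context (R : realType) (n : nat).

(* A continuous function is the pointwise limit of its discretizations on the
   countable grid of mesh 1/(k+1). *)
Let grid (k : nat) (x : 'rV[R]_n) : 'rV[int]_n :=
  \row_i Num.floor (k.+1%:R * x ord0 i).

Let ungrid (k : nat) (z : 'rV[int]_n) : 'rV[R]_n :=
  \row_i ((z ord0 i)%:~R / k.+1%:R).

Let measurable_grid k z : measurable [set x | grid k x = z].
Proof.
rewrite (_ : [set _ | _] = \big[setI/setT]_(i < n)
   ((fun v : 'rV[R]_n => v ord0 i : measurableTypeR R) @^-1`
      [set a | k.+1%:R * a \in `[(z ord0 i)%:~R, (z ord0 i + 1)%:~R[ ])); last first.
  rewrite -bigcap_seq; apply/seteqP; split => [v <- i _|v zv] /=.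
    by rewrite mxE in_itv/=; exact: floor_itv.
  apply/rowP => i; rewrite mxE; apply/eqP.
  have := zv i; rewrite /= mem_index_enum in_itv/= => /(_ isT).
  by rewrite floor_eq.
apply: bigsetI_measurable => i _.
rewrite -[X in measurable X]setTI; apply: measurable_rV_coord => //.
have mk : measurable_fun setT (fun a : R => k.+1%:R * a) by exact: measurable_funM.
have := mk measurableT _ (measurable_itv `[(z ord0 i)%:~R, (z ord0 i + 1)%:~R[).
by rewrite setTI.
Qed.

(** Nothing is asked of [f]: the discretization takes countably many values, enumerated by
    [unpickle], so each preimage is a countable union of grid cells. *)
Let measurable_fun_grid (f : 'rV[R]_n -> R) k :
  measurable_fun setT (fun x => f (ungrid k (grid k x))).
Proof.
move=> _ Y mY; rewrite setTI.
rewrite (_ : _ @^-1` _ = \bigcup_m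
    (if unpickle m is Some z then
       if (f (ungrid k z)) \in Y then [set x | grid k x = z] else set0
     else set0)).
  apply: bigcupT_measurable => m; case: unpickle => [z|//].
  by case: ifP => _ //; exact: measurable_grid.
apply/seteqP; split => [x /= Yx|x [m _] /=].
  exists (pickle (grid k x)) => //.
  by rewrite pickleK mem_set.
case: unpickle => [z|//]; case: ifPn => //.
by rewrite inE => Yz /= ->.
Qed.

(** The sigma-algebra is generated by the coordinates and not by the open sets, hence the detour
    through discretizations. *)
Lemma continuous_rV_measurable (f : 'rV[R]_n -> R) :
  continuous f -> measurable_fun setT f.
Proof.
move=> cf; apply/measurable_EFinP.
apply: (emeasurable_fun_cvg (fun k x => (f (ungrid k (grid k x)))%:E)) => [k|x _].
  by apply/measurable_EFinP; exact: measurable_fun_grid.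
apply: cvg_EFin; first exact: nearW.
apply: (@cvg_comp _ _ _ (fun k => ungrid k (grid k x)) f \oo (nbhs x)); last exact: cf.
apply/cvg_ballP => e e0; near=> k; split=> // i j.
rewrite !ord1 !mxE /ball/=.
have k0 : (0 : R) < k.+1%:R by [].
have := floor_itv (k.+1%:R * x ord0 j).
set z : R := (Num.floor _)%:~R; rewrite intrD -/z => /andP[z1 z2].
have ke : k.+1%:R^-1 < e by near: k; exact: near_infty_natSinv_lt (PosNum e0).
rewrite ger0_norm; last by rewrite subr_ge0 ler_pdivrMr// mulrC.
apply: le_lt_trans ke.
by rewrite lerBlDr -[X in _ <= X + _]mul1r -mulrDl ler_pdivlMr// mulrC addrC ltW.
Unshelve. all: by end_near. Qed.

End continuous_rV.

(** * The heat kernel as a product of normal densities *)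

Section gaussian_kernel.
Context (R : realType) (n : nat).
Local Notation V := 'rV[R]_n.
Local Notation leb := (lebesgue_rV R n).
Implicit Types (x y : V) (t : R).

Lemma sqr_norm2_ge0 x : 0 <= sqr_norm2 x.
Proof. by apply: sumr_ge0 => i _; exact: sqr_ge0. Qed.

Lemma sqr_norm2N x : sqr_norm2 (- x) = sqr_norm2 x.
Proof. by apply: eq_bigr => i _; rewrite mxE sqrrN. Qed.

(** The difference of the two sides is 2 |x/2 + y|^2. A Gaussian bound thus survives a bounded
    translation with half its exponent. *)
Lemma sqr_norm2D_ge x y : sqr_norm2 x / 2 - sqr_norm2 y <= sqr_norm2 (x + y).
Proof.
rewrite /sqr_norm2 mulr_suml -sumrB; apply: ler_sum => i _; rewrite mxE.
by have := sqr_ge0 (x ord0 i / 2 + y ord0 i); nra.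
Qed.

Lemma ler_sqr_coord x i : x ord0 i ^+ 2 <= sqr_norm2 x.
Proof.
rewrite /sqr_norm2 (bigD1 i)//= lerDl.
by apply: sumr_ge0 => j _; exact: sqr_ge0.
Qed.

Lemma measurable_coord i : measurable_fun setT (fun x : V => x ord0 i).
Proof. exact: measurable_rV_coord. Qed.

Lemma measurable_sqr_norm2 : measurable_fun setT (@sqr_norm2 R n).
Proof.
apply: measurable_sum => i; apply: measurable_funX; exact: measurable_coord.
Qed.

Lemma heat_kernel_ge0 t x y : 0 <= heat_kernel t x y.
Proof. by rewrite mulr_ge0 ?expR_ge0// invr_ge0 powR_ge0. Qed.

Lemma heat_kernel_gt0 t x y : 0 < t -> 0 < heat_kernel t x y.
Proof.
move=> t0; rewrite mulr_gt0 ?expR_gt0// invr_gt0 powR_gt0//.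
by rewrite !mulr_gt0// pi_gt0.
Qed.

Lemma heat_kernelC t x y : heat_kernel t x y = heat_kernel t y x.
Proof. by rewrite /heat_kernel -(sqr_norm2N (x - y)) opprB. Qed.

(** With generator Delta/2 each coordinate has variance t, hence the standard deviation sqrt t. *)
Lemma heat_kernel_prod t x y : 0 < t ->
  heat_kernel t x y = \prod_(i < n) normal_pdf (x ord0 i) (Num.sqrt t) (y ord0 i).
Proof.
move=> t0.
have s0 : Num.sqrt t != 0 by rewrite sqrtr_eq0 -ltNge.
under eq_bigr do rewrite normal_pdfE// /normal_peak /normal_fun sqr_sqrtr ?ltW//.
rewrite big_split/= big_const iter_mulr_1 card_ord /heat_kernel [RHS]mulrC; congr (_ * _); last first.
  rewrite exprVn; congr (_^-1).
  have pt0 : 0 <= 2 * pi * t :> R by rewrite !mulr_ge0// ?pi_ge0// ltW.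
  rewrite (_ : t * pi *+ 2 = 2 * pi * t); last by rewrite -mulr_natr; ring.
  by rewrite -powR12_sqrt// -powR_mulrn ?powR_ge0// -powRrM (mulrC 2^-1).
rewrite -expR_sum; congr expR.
rewrite /sqr_norm2 mulNr mulr_suml -sumrN; apply: eq_bigr => i _.
by rewrite !mxE -[in RHS]sqrrN opprB -(mulr_natl t 2) mulNr.
Qed.

Lemma measurable_heat_kernel t x : measurable_fun setT (heat_kernel t x).
Proof.
apply: measurable_funM => //; apply: measurableT_comp => //.
apply: measurable_funM => //; apply: measurableT_comp => //.
apply: (measurableT_comp measurable_sqr_norm2).
apply: measurable_fun_rVP => i; under eq_fun do rewrite !mxE.
by apply: measurable_funB => //; exact: measurable_coord.
Qed.

Lemma measurable_heat_kernel2 t :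
  measurable_fun setT (fun p : V * V => heat_kernel t p.1 p.2).
Proof.
apply: measurable_funM => //; apply: measurableT_comp => //.
apply: measurable_funM => //; apply: measurableT_comp => //.
apply: (measurableT_comp measurable_sqr_norm2).
apply: measurable_fun_rVP => i; under eq_fun do rewrite !mxE.
apply: measurable_funB.
- exact: (measurableT_comp (measurable_coord i) measurable_fst).
- exact: (measurableT_comp (measurable_coord i) measurable_snd).
Qed.

Lemma integral_heat_kernel t x : 0 < t ->
  (\int[leb]_y (heat_kernel t x y)%:E = 1)%E.
Proof.
move=> t0; under eq_integral do rewrite heat_kernel_prod//.
rewrite (integral_rV_prod (g := fun i => normal_pdf (x ord0 i) (Num.sqrt t)) (c := 1)) ?expr1n//.
- by move=> i; exact: measurable_normal_pdf.
- by move=> i a; exact: normal_pdf_ge0.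
- by move=> i; exact: integral_normal_pdf.
Qed.

Lemma integrable_expR_sqr_norm2 (c : R) : 0 < c ->
  leb.-integrable setT (EFin \o (fun x => expR (- c * sqr_norm2 x))).
Proof.
move=> c0.
have mf : measurable_fun setT (EFin \o (fun x : V => expR (- c * sqr_norm2 x))).
  apply/measurable_EFinP; apply: measurableT_comp => //.
  by apply: measurable_funM => //; exact: measurable_sqr_norm2.
(* The time t for which the exponent |x|^2 / 2t of the heat kernel equals c |x|^2. *)
have t0 : 0 < (2 * c)^-1 by rewrite invr_gt0 mulr_gt0.
apply/integrableP; split => //.
under eq_integral do rewrite gee0_abs ?lee_fin ?expR_ge0//.
rewrite (eq_integral (fun x => ((2 * pi * (2 * c)^-1) `^ (n%:R / 2))%:E *
  (heat_kernel (2 * c)^-1 0 x)%:E)%E) => [|x _].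
  rewrite ge0_integralZl//; last 3 first.
  - by apply/measurable_EFinP; exact: measurable_heat_kernel.
  - by move=> x _; rewrite lee_fin heat_kernel_ge0.
  - by rewrite lee_fin powR_ge0.
  by rewrite integral_heat_kernel// mule1 ltry.
rewrite -EFinM /heat_kernel mulrC divfK; last first.
  by rewrite gt_eqF// powR_gt0// !mulr_gt0 ?pi_gt0.
rewrite sub0r sqr_norm2N; congr (expR _)%:E.
by field; rewrite gt_eqF.
Qed.

End gaussian_kernel.

(** * Partial derivatives and Gaussian integrals *)

Section real_derivatives.
Context (R : realType).
Implicit Types (f g : R -> R) (x a b : R).

Lemma is_deriveR_add f g x a b : is_derive x 1 f a -> is_derive x 1 g b ->
  is_derive x 1 (fun t => f t + g t) (a + b).
Proof. by move=> fa gb; exact: is_deriveD. Qed.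

Lemma is_deriveR_opp f x a : is_derive x 1 f a -> is_derive x 1 (fun t => - f t) (- a).
Proof. by move=> fa; exact: is_deriveN. Qed.

Lemma is_deriveR_sub f g x a b : is_derive x 1 f a -> is_derive x 1 g b ->
  is_derive x 1 (fun t => f t - g t) (a - b).
Proof. by move=> fa gb; exact: is_deriveB. Qed.

Lemma is_deriveR_mul f g x a b : is_derive x 1 f a -> is_derive x 1 g b ->
  is_derive x 1 (fun t => f t * g t) (a * g x + f x * b).
Proof.
move=> fa gb; apply: (@is_derive_eq _ _ _ _ _ _ _ _ (is_deriveM fa gb)).
by rewrite /GRing.scale/= addrC (mulrC a).
Qed.

Lemma is_deriveR_const x a : is_derive x 1 (fun=> a) 0.
Proof. exact: is_derive_cst. Qed.

Lemma is_deriveR_id x : is_derive x 1 (fun t : R => t) 1.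
Proof. exact: is_derive_id. Qed.

Lemma is_deriveR_chain f g x a b : is_derive (g x) 1 f a -> is_derive x 1 g b ->
  is_derive x 1 (fun t => f (g t)) (a * b).
Proof. by move=> fa gb; exact: is_derive1_comp. Qed.

Lemma is_deriveR_inv f x a : f x != 0 -> is_derive x 1 f a ->
  is_derive x 1 (fun t => (f t)^-1) (- a / f x ^+ 2).
Proof.
move=> f0 fa; apply: (@is_derive_eq _ _ _ _ _ _ _ _ (is_deriveV f0 fa)).
by rewrite /GRing.scale/= !mulNr mulrC.
Qed.

Lemma is_deriveR_sumr (I : Type) (r : seq I) (P : pred I) (f : I -> R -> R) x (a : I -> R) :
  (forall i, is_derive x 1 (f i) (a i)) ->
  is_derive x 1 (fun t => \sum_(i <- r | P i) f i t) (\sum_(i <- r | P i) a i).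
Proof.
move=> fa; elim: r => [|i r IH].
  rewrite (_ : (fun _ => _) = fun=> 0); last by apply/funext => t; rewrite big_nil.
  by rewrite big_nil; exact: is_deriveR_const.
rewrite big_cons (_ : (fun _ => _) = fun t =>
  if P i then f i t + \sum_(j <- r | P j) f j t else \sum_(j <- r | P j) f j t); last first.
  by apply/funext => t; rewrite big_cons.
by case: (P i) => //; exact: is_deriveR_add.
Qed.

(** The usual last step of a differentiation: the rules build a function and a derivative of some
    shape, which are then matched with the desired ones by [ring] or [field]. *)
Lemma is_deriveR_eq f g x a b : f =1 g -> a = b -> is_derive x 1 f a -> is_derive x 1 g b.
Proof. by move=> /funext <- <-. Qed.

End real_derivatives.

Section partial.
Context (R : realType) (n : nat).
Local Notation V := 'rV[R]_n.
Local Notation e_ i := (delta_mx ord0 i : V).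

(** The partial derivative is a one-variable derivative at 0 along the axis, with its value given
    explicitly, so that only real calculus is involved. *)
Definition partial (i : 'I_n) (F dF : V -> R) :=
  forall x, is_derive (0 : R) 1 (fun h => F (x + h *: e_ i)) (dF x).

(** [partial] speaks of h = 0 at every base point; moving the base point along the axis gives every
    h. *)
Lemma is_derive_partial i F dF : partial i F dF ->
  forall x (h : R), is_derive h 1 (fun h => F (x + h *: e_ i)) (dF (x + h *: e_ i)).
Proof.
move=> pF x h.
have H : is_derive h 1 (fun k => k - h) (1 : R).
  by apply: is_deriveR_eq (is_deriveR_sub (is_deriveR_id h) (is_deriveR_const h h)); rewrite ?subr0.
have := @is_deriveR_chain _ (fun k => F (x + h *: e_ i + k *: e_ i)) (fun k => k - h) h (dF (x + h *: e_ i)) 1.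
rewrite subrr => /(_ (pF _) H).
apply: is_deriveR_eq; last by rewrite mulr1.
by move=> k /=; rewrite -addrA -scalerDl subrKC.
Qed.

Lemma partial_ext i F dF G dG : F =1 G -> dF =1 dG -> partial i F dF -> partial i G dG.
Proof. by move=> /funext <- /funext <-. Qed.

Lemma partialD i F dF G dG : partial i F dF -> partial i G dG ->
  partial i (fun x => F x + G x) (fun x => dF x + dG x).
Proof. by move=> pF pG x; exact: is_deriveR_add. Qed.

Lemma partialB i F dF G dG : partial i F dF -> partial i G dG ->
  partial i (fun x => F x - G x) (fun x => dF x - dG x).
Proof. by move=> pF pG x; exact: is_deriveR_sub. Qed.

Lemma partialM i F dF G dG : partial i F dF -> partial i G dG ->
  partial i (fun x => F x * G x) (fun x => dF x * G x + F x * dG x).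
Proof.
move=> pF pG x; apply: is_deriveR_eq (is_deriveR_mul (pF x) (pG x)) => //=.
by rewrite scale0r addr0.
Qed.

Lemma partial_cst i c : partial i (fun=> c) (fun=> 0).
Proof. by move=> x; exact: is_deriveR_const. Qed.

Lemma partial_coord i j : partial i (fun x => x ord0 j) (fun=> (i == j)%:R).
Proof.
move=> x; apply: is_deriveR_eq (is_deriveR_add (is_deriveR_const 0 (x ord0 j))
  (is_deriveR_mul (is_deriveR_id 0) (is_deriveR_const 0 ((i == j)%:R : R)))).
  by move=> h /=; rewrite !mxE eqxx/= eq_sym.
by rewrite mul1r mulr0 addr0 add0r.
Qed.

Lemma partial_sum i (I : Type) (r : seq I) (P : pred I) (F dF : I -> V -> R) :
  (forall j, partial i (F j) (dF j)) ->
  partial i (fun x => \sum_(j <- r | P j) F j x) (fun x => \sum_(j <- r | P j) dF j x).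
Proof. by move=> pF x; apply: is_deriveR_sumr => j; exact: pF. Qed.

Lemma partialV i F dF : (forall x, F x != 0) -> partial i F dF ->
  partial i (fun x => (F x)^-1) (fun x => - dF x / F x ^+ 2).
Proof.
move=> F0 pF x; apply: is_deriveR_eq (is_deriveR_inv _ (pF x)) => //=.
by rewrite scale0r addr0.
Qed.

Lemma partial_comp i (f df : R -> R) (F dF : V -> R) :
  (forall x, is_derive (F x) 1 f (df (F x))) -> partial i F dF ->
  partial i (fun x => f (F x)) (fun x => df (F x) * dF x).
Proof.
move=> pf pF x; apply: is_deriveR_chain; last exact: pF.
by rewrite scale0r addr0.
Qed.

End partial.

Section growth.
Context (R : realType) (n : nat) (a b : R).
Local Notation V := 'rV[R]_n.
Local Notation leb := (lebesgue_rV R n).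
Local Notation e_ i := (delta_mx ord0 i : V).
Implicit Types F G : R -> V -> R.

(* A family of subexponential-Gaussian growth, uniformly in the time s; its product
   with a Gaussian family is Gaussian, hence integrable with an s-independent bound. *)
Definition tame F :=
  (forall s, a < s < b -> measurable_fun setT (F s)) /\
  forall e : R, 0 < e -> exists2 C : R, 0 <= C &
    forall s x, a < s < b -> `|F s x| <= C * expR (e * sqr_norm2 x).

Definition gaussian F :=
  (forall s, a < s < b -> measurable_fun setT (F s)) /\
  exists2 c : R, 0 < c & exists2 C : R, 0 <= C &
    forall s x, a < s < b -> `|F s x| <= C * expR (- c * sqr_norm2 x).

Lemma tame_le F G : tame G -> (forall s, a < s < b -> measurable_fun setT (F s)) ->
  (forall s x, a < s < b -> `|F s x| <= G s x) -> tame F.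
Proof.
move=> [_ tG] mF FG; split=> // e e0; have [C C0 GC] := tG _ e0.
exists C => // s x sab; apply: le_trans (FG _ _ sab) _.
by apply: le_trans (GC _ _ sab); exact: ler_norm.
Qed.

Lemma tame_bounded F (C : R) : (forall s, a < s < b -> measurable_fun setT (F s)) ->
  (forall s x, a < s < b -> `|F s x| <= C) -> tame F.
Proof.
move=> mF FC; split=> // e e0; exists (Num.max C 0).
  by rewrite le_max lexx orbT.
move=> s x sab; apply: le_trans (FC _ _ sab) _.
rewrite (@le_trans _ _ (Num.max C 0))// ?le_max ?lexx// ler_peMr// ?le_max ?lexx ?orbT//.
by rewrite -expR0 ler_expR mulr_ge0 ?sqr_norm2_ge0// ltW.
Qed.

Lemma tame_cst c : tame (fun _ _ => c).
Proof. by apply: (@tame_bounded _ `|c|). Qed.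

Lemma tameD F G : tame F -> tame G -> tame (fun s x => F s x + G s x).
Proof.
move=> [mF tF] [mG tG]; split=> [s sab|e e0].
  by apply: measurable_funD; [exact: mF|exact: mG].
have [C C0 FC] := tF _ e0; have [D D0 GD] := tG _ e0.
exists (C + D); first exact: addr_ge0.
move=> s x sab; rewrite mulrDl; apply: le_trans (ler_normD _ _) _.
by apply: lerD; [exact: FC|exact: GD].
Qed.

Lemma tameN F : tame F -> tame (fun s x => - F s x).
Proof.
move=> [mF tF]; split=> [s sab|e e0].
  by apply: measurableT_comp => //; exact: mF.
by have [C C0 FC] := tF _ e0; exists C => // s x; rewrite normrN; exact: FC.
Qed.

Lemma tameB F G : tame F -> tame G -> tame (fun s x => F s x - G s x).
Proof. by move=> tF tG; apply: tameD => //; exact: tameN. Qed.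

Lemma tameM F G : tame F -> tame G -> tame (fun s x => F s x * G s x).
Proof.
move=> [mF tF] [mG tG]; split=> [s sab|e e0].
  by apply: measurable_funM; [exact: mF|exact: mG].
have e20 : 0 < e / 2 by rewrite divr_gt0.
have [C C0 FC] := tF _ e20; have [D D0 GD] := tG _ e20.
exists (C * D); first exact: mulr_ge0.
move=> s x sab; rewrite [e in expR (e * _)](splitr e) (mulrDl (e / 2)) expRD mulrACA normrM.
by apply: ler_pM => //; [exact: FC|exact: GD].
Qed.

Lemma tameX F k : tame F -> tame (fun s x => F s x ^+ k).
Proof.
move=> tF; elim: k => [|k IH]; first exact: tame_cst.
under [X in tame X]eq_fun do under eq_fun do rewrite exprS.
exact: tameM.
Qed.

Lemma tame_sum (I : Type) (r : seq I) (P : pred I) (F : I -> R -> V -> R) :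
  (forall i, tame (F i)) -> tame (fun s x => \sum_(i <- r | P i) F i s x).
Proof.
move=> tF; elim: r => [|i r IH].
  under [X in tame X]eq_fun do under eq_fun do rewrite big_nil.
  exact: tame_cst.
under [X in tame X]eq_fun do under eq_fun do rewrite big_cons.
by case: (P i) => //; exact: tameD.
Qed.

Lemma tame_coord i : tame (fun _ x => x ord0 i).
Proof.
split=> [s _|e e0]; first exact: measurable_coord.
(* From |t| <= 1 + t^2 <= max(1, 1/e) (1 + e t^2) and 1 + u <= exp u. *)
exists (Num.max 1 e^-1); first by rewrite le_max ler01.
move=> s x _.
have h1 : e * x ord0 i ^+ 2 <= e * sqr_norm2 x by rewrite ler_pM2l// ler_sqr_coord.
have h2 := expR_ge1Dx (e * sqr_norm2 x).
set q := sqr_norm2 x in h1 h2 *; set t := x ord0 i in h1 *.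
have h3 : `|t| <= 1 + t ^+ 2.
  rewrite -real_normK ?num_real//; have := sqr_ge0 (`|t| - 2^-1); nra.
have [e1|e1] := leP 1 e.
  apply: le_trans h3 _; apply: (@le_trans _ _ (1 + e * t ^+ 2)).
    by rewrite lerD2l ler_peMl// sqr_ge0.
  apply: (@le_trans _ _ (1 * expR (e * q))).
    by rewrite mul1r; apply: le_trans h2; rewrite lerD2l.
  by rewrite ler_wpM2r ?expR_ge0// le_max lexx.
apply: (@le_trans _ _ (e^-1 * expR (e * q))); last first.
  by rewrite ler_wpM2r ?expR_ge0// le_max lexx orbT.
rewrite mulrC ler_pdivlMr//; apply: le_trans h2.
apply: le_trans (_ : 1 + e * t ^+ 2 <= _); last by rewrite lerD2l.
rewrite mulrC; apply: le_trans (_ : e * (1 + t ^+ 2) <= _); first by rewrite ler_pM2l.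
by rewrite mulrDr mulr1 lerD2r ltW.
Qed.

Lemma gaussianM F G : gaussian F -> tame G -> gaussian (fun s x => F s x * G s x).
Proof.
move=> [mF [c c0 [C C0 FC]]] [mG tG]; split=> [s sab|].
  by apply: measurable_funM; [exact: mF|exact: mG].
have c20 : 0 < c / 2 by rewrite divr_gt0.
exists (c / 2) => //; have [D D0 GD] := tG _ c20.
exists (C * D); first exact: mulr_ge0.
move=> s x sab.
rewrite (_ : - (c / 2) = - c + c / 2); last by field.
rewrite mulrDl expRD mulrACA normrM.
by apply: ler_pM => //; [exact: FC|exact: GD].
Qed.

Lemma gaussianD F G : gaussian F -> gaussian G -> gaussian (fun s x => F s x + G s x).
Proof.
move=> [mF [c c0 [C C0 FC]]] [mG [d d0 [D D0 GD]]]; split=> [s sab|].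
  by apply: measurable_funD; [exact: mF|exact: mG].
have m0 : 0 < Num.min c d by rewrite lt_min c0 d0.
exists (Num.min c d) => //; exists (C + D); first exact: addr_ge0.
move=> s x sab; rewrite mulrDl; apply: le_trans (ler_normD _ _) _.
apply: lerD; [apply: le_trans (FC _ _ sab) _|apply: le_trans (GD _ _ sab) _].
- by rewrite ler_wpM2l// ler_expR !mulNr lerN2 ler_wpM2r ?sqr_norm2_ge0// ge_min lexx.
- by rewrite ler_wpM2l// ler_expR !mulNr lerN2 ler_wpM2r ?sqr_norm2_ge0// ge_min lexx orbT.
Qed.

Lemma integrable_gauss_bound (C c : R) : 0 < c ->
  leb.-integrable setT (EFin \o (fun x => C * expR (- c * sqr_norm2 x))).
Proof.
move=> c0; rewrite (_ : _ \o _ = fun x => (C%:E * (EFin \o (fun x => expR (- c * sqr_norm2 x))) x)%E).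
  by apply: integrableZl => //; exact: integrable_expR_sqr_norm2.
by apply/funext => x /=; rewrite EFinM.
Qed.

Lemma gaussian_integrable F s : gaussian F -> a < s < b ->
  leb.-integrable setT (EFin \o F s).
Proof.
move=> [mF [c c0 [C C0 FC]]] sab.
apply: le_integrable (integrable_gauss_bound C c0) => //.
  by apply/measurable_EFinP; exact: mF.
move=> x _ /=; rewrite lee_fin; apply: le_trans (FC _ _ sab) _.
exact: ler_norm.
Qed.

(* The integral of [x |-> F s (x + h e_i)] does not depend on h; differentiate it at 0. *)
Lemma integral_partial F dF s i : gaussian F -> gaussian dF -> a < s < b ->
  partial i (F s) (dF s) -> \int[leb]_x dF s x = 0.
Proof.
move=> gF gdF sab pF.
have shiftI G : gaussian G -> forall h, leb.-integrable setT (EFin \o (fun x => G s (x + h *: e_ i))).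
  move=> gG h; have /integrableP[mG iG] := gaussian_integrable gG sab.
  apply/integrableP; split.
    have mG' : measurable_fun setT (G s) by exact/measurable_EFinP.
    apply/measurable_EFinP; apply: (measurableT_comp mG').
    exact: measurable_rV_shift.
  rewrite (ge0_integral_rV_shift (F := fun x => `|(G s x)%:E|)%E)//.
  exact: measurableT_comp.
have [mdF [c c0 [C C0 dFC]]] := gdF.
(* Bounds C exp(- c |y + h e_i|^2) for |h| < 1: by [sqr_norm2D_ge] the exponent is at most - c |y|^2
   / 2 + c h^2. *)
pose B (y : V) : R := C * expR c * expR (- (c / 2) * sqr_norm2 y).
have e1 : sqr_norm2 (e_ i) = 1.
  rewrite /sqr_norm2 (bigD1 i)//= mxE !eqxx expr1n big1 ?addr0// => j ji.
  by rewrite mxE (negPf ji) andbF expr0n.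
pose G (h : R) (x : V) := F s (x + h *: e_ i).
have d1 x h : derive1 (G ^~ x) h = dF s (x + h *: e_ i).
  by rewrite derive1E; apply: derive_val; exact: is_derive_partial.
have I0 : [set` `](-1 : R), 1[] 0 by rewrite /= in_itv/= ltrN10 ltr01.
have intG h : [set` `](-1 : R), 1[] h -> leb.-integrable setT (EFin \o G h).
  by move=> _; exact: shiftI.
have derG h (y : V) : [set` `](-1 : R), 1[] h -> setT y -> derivable (G ^~ y) h 1.
  by move=> _ _; have [] := is_derive_partial pF y h.
have B0 y : 0 <= B y by rewrite /B !mulr_ge0 ?expR_ge0.
have iB : leb.-integrable setT (EFin \o B).
  by apply: integrable_gauss_bound; rewrite divr_gt0.
have ub h y : [set` `](-1 : R), 1[] h -> setT y -> `|partial1of2 G h y| <= B y.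
  rewrite /= in_itv/= => /andP[h1 h2] _.
  rewrite /partial1of2 d1; apply: le_trans (dFC _ _ sab) _.
  rewrite /B -mulrA ler_wpM2l// -expRD ler_expR.
  have := sqr_norm2D_ge y (h *: e_ i).
  have -> : sqr_norm2 (h *: e_ i) = h ^+ 2.
    rewrite -[RHS]mulr1 -e1 /sqr_norm2 mulr_sumr; apply: eq_bigr => j _.
    by rewrite !mxE exprMn.
  have hh : h ^+ 2 <= 1 by nra.
  by nra.
have H := differentiation_under_integral measurableT I0 intG derG B0 iB ub.
transitivity (\int[leb]_x partial1of2 G 0 x).
  by apply: eq_Rintegral => x _; rewrite /partial1of2 d1 scale0r addr0.
rewrite -H (_ : (fun h => _) = cst (\int[leb]_x F s x)) ?derive1_cst//.
apply/funext => h /=; rewrite /Rintegral (integral_rV_shift (F := EFin \o F s))//.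
by apply/measurable_EFinP; apply gF.
Qed.

Lemma derive1_integral F dF s : gaussian F -> gaussian dF -> a < s < b ->
  (forall s x, a < s < b -> is_derive s 1 (F ^~ x) (dF s x)) ->
  is_derive s 1 (fun s => \int[leb]_x F s x) (\int[leb]_x dF s x).
Proof.
move=> gF gdF sab pF.
have [mdF [c c0 [C C0 dFC]]] := gdF.
pose B (y : V) : R := C * expR (- c * sqr_norm2 y).
have d1 x t : a < t < b -> derive1 (F ^~ x) t = dF t x.
  by move=> tab; rewrite derive1E; apply: derive_val; exact: pF.
have B0 y : 0 <= B y by rewrite /B mulr_ge0 ?expR_ge0.
have Is : [set` `]a, b[] s by rewrite /= in_itv.
have intF t : [set` `]a, b[] t -> leb.-integrable setT (EFin \o F t).
  by rewrite /= in_itv/=; exact: gaussian_integrable.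
have derF t (y : V) : [set` `]a, b[] t -> setT y -> derivable (F ^~ y) t 1.
  by rewrite /= in_itv/= => tab _; have [] := pF t y tab.
have ub t y : [set` `]a, b[] t -> setT y -> `|partial1of2 F t y| <= B y.
  by rewrite /= in_itv/= => tab _; rewrite /partial1of2 d1//; exact: dFC.
have iB := integrable_gauss_bound C c0.
have H := differentiation_under_integral measurableT Is intF derF B0 iB ub.
have D := derivable_under_integral measurableT Is intF derF B0 iB ub.
apply: DeriveDef => //; rewrite -derive1E H.
by apply: eq_Rintegral => x _; rewrite /partial1of2 d1.
Qed.

End growth.

(** * Convexity of the entropy along logarithmic heat flows *)

Section gaussian_integral_algebra.
Context (R : realType) (n : nat) (a b : R).
Local Notation V := 'rV[R]_n.
Local Notation leb := (lebesgue_rV R n).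

Lemma gaussian_ext (F G : R -> V -> R) : (forall s x, F s x = G s x) ->
  gaussian a b F -> gaussian a b G.
Proof.
by move=> FG; rewrite (_ : G = F)//; apply/funext => s; apply/funext => x.
Qed.

Lemma tame_ext (F G : R -> V -> R) : (forall s x, F s x = G s x) ->
  tame a b F -> tame a b G.
Proof.
by move=> FG; rewrite (_ : G = F)//; apply/funext => s; apply/funext => x.
Qed.

Lemma gaussian0 : gaussian a b (fun _ (_ : V) => 0).
Proof.
split=> [s _|]; first exact: measurable_cst.
by exists 1 => //; exists 0 => // s x _; rewrite normr0 mul0r.
Qed.

Lemma gaussian_sum (I : Type) (r : seq I) (P : pred I) (F : I -> R -> V -> R) :
  (forall i, gaussian a b (F i)) -> gaussian a b (fun s x => \sum_(i <- r | P i) F i s x).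
Proof.
move=> tF; elim: r => [|i r IH].
  under [X in gaussian _ _ X]eq_fun do under eq_fun do rewrite big_nil.
  exact: gaussian0.
under [X in gaussian _ _ X]eq_fun do under eq_fun do rewrite big_cons.
by case: (P i) => //; exact: gaussianD.
Qed.

Lemma integral_gaussianD (F G : R -> V -> R) s : a < s < b -> gaussian a b F -> gaussian a b G ->
  \int[leb]_x (F s x + G s x) = \int[leb]_x F s x + \int[leb]_x G s x.
Proof.
by move=> sab gF gG; rewrite RintegralD//; exact: gaussian_integrable sab.
Qed.

Lemma integral_gaussianZ (F : R -> V -> R) c s : a < s < b -> gaussian a b F ->
  \int[leb]_x (c * F s x) = c * \int[leb]_x F s x.
Proof.
by move=> sab gF; rewrite RintegralZl//; exact: gaussian_integrable sab.
Qed.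

Lemma integral_gaussian_sum (I : Type) (r : seq I) (F : I -> R -> V -> R) s :
  a < s < b -> (forall i, gaussian a b (F i)) ->
  \int[leb]_x (\sum_(i <- r) F i s x) = \sum_(i <- r) \int[leb]_x F i s x.
Proof.
move=> sab gF; elim: r => [|i r IH].
  rewrite big_nil; under eq_Rintegral do rewrite big_nil.
  by rewrite /Rintegral integral0.
rewrite big_cons -IH -(integral_gaussianD sab (gF i) (gaussian_sum _ _ gF)).
by apply: eq_Rintegral => x _; rewrite big_cons.
Qed.

Lemma gaussianZ (F : R -> V -> R) c : gaussian a b F -> gaussian a b (fun s x => c * F s x).
Proof.
move=> gF; apply: gaussian_ext (gaussianM gF (tame_cst n a b c)) => s x /=.
exact: mulrC.
Qed.

Lemma le_integral_gaussian (F G : R -> V -> R) s : a < s < b ->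
  gaussian a b F -> gaussian a b G -> (forall x, F s x <= G s x) ->
  \int[leb]_x F s x <= \int[leb]_x G s x.
Proof.
move=> sab gF gG FG; apply: le_Rintegral => //.
- exact: gaussian_integrable gF sab.
- exact: gaussian_integrable gG sab.
Qed.

End gaussian_integral_algebra.

(** Sum 2 a_i a_j <= a_i^2 + a_j^2 over all pairs. Applied to the diagonal of a Hessian, it brings
    the dimension n into the final inequality. *)
Lemma sqr_sum_le (R : realDomainType) n (a : 'I_n -> R) :
  (\sum_i a i) ^+ 2 <= n%:R * \sum_i a i ^+ 2.
Proof.
suff : 2 * (\sum_i a i) ^+ 2 <= 2 * (n%:R * \sum_i a i ^+ 2).
  by rewrite ler_pM2l.
rewrite expr2 mulr_suml mulr_sumr.
apply: (@le_trans _ _ (\sum_i \sum_j (a i ^+ 2 + a j ^+ 2))).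
  apply: ler_sum => i _; rewrite mulr_sumr mulr_sumr; apply: ler_sum => j _.
  by have := sqr_ge0 (a i - a j); rewrite sqrrB; lra.
under eq_bigr do rewrite big_split/= sumr_const card_ord.
rewrite big_split/= sumr_const card_ord sumrMnl.
by rewrite -(mulr_natl (\sum_i a i ^+ 2) n); lra.
Qed.

Section heat_log.
Context (R : realType) (n : nat) (a b : R).
Local Notation V := 'rV[R]_n.
Local Notation leb := (lebesgue_rV R n).

(* The logarithmic form of the heat equation: [exp phi] solves the equation
   d_s u = (kappa/2) Delta u, i.e. d_s phi = (kappa/2) (Delta phi + |grad phi|^2);
   p1 and p2 are the gradient and the Hessian of phi, and p3 i j = d_i d_i d_j phi. *)
Record heat_log (kappa : R) (phi : R -> V -> R) (p1 : 'I_n -> R -> V -> R)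
    (p2 p3 : 'I_n -> 'I_n -> R -> V -> R) : Prop := HeatLog {
  hl_tame0 : tame a b phi ;
  hl_tame1 : forall i, tame a b (p1 i) ;
  hl_tame2 : forall i j, tame a b (p2 i j) ;
  hl_tame3 : forall i j, tame a b (p3 i j) ;
  hl_partial1 : forall i s, a < s < b -> partial i (phi s) (p1 i s) ;
  hl_partial2 : forall i j s, a < s < b -> partial i (p1 j s) (p2 i j s) ;
  hl_partial3 : forall i j s, a < s < b -> partial i (p2 i j s) (p3 i j s) ;
  hl_time0 : forall s x, a < s < b -> is_derive s 1 (phi ^~ x)
    (kappa / 2 * \sum_i (p2 i i s x + p1 i s x ^+ 2)) ;
  hl_time1 : forall j s x, a < s < b -> is_derive s 1 (p1 j ^~ x)
    (kappa / 2 * \sum_i (p3 i j s x + 2 * p1 i s x * p2 i j s x)) }.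

Context (kappa : R) (phi psi : R -> V -> R) (p1 q1 : 'I_n -> R -> V -> R)
  (p2 p3 q2 q3 : 'I_n -> 'I_n -> R -> V -> R).
Hypothesis hphi : heat_log kappa phi p1 p2 p3.
Hypothesis hpsi : heat_log (- kappa) psi q1 q2 q3.
Let rho s x := expR (phi s x + psi s x).
Hypothesis rho_gaussian : gaussian a b rho.

Let Tp0 := hl_tame0 hphi. Let Tp1 := hl_tame1 hphi.
Let Tp2 := hl_tame2 hphi. Let Tp3 := hl_tame3 hphi.
Let Tq0 := hl_tame0 hpsi. Let Tq1 := hl_tame1 hpsi.
Let Tq2 := hl_tame2 hpsi. Let Tq3 := hl_tame3 hpsi.
(** This is d_s ln rho: the sum of [hl_time0] for phi and for psi, the latter with -kappa. *)
Let r s x := kappa / 2 * \sum_i (p2 i i s x + p1 i s x ^+ 2 - q2 i i s x - q1 i s x ^+ 2).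

Local Ltac tame := repeat first [ exact: Tp0 | exact: Tp1 | exact: Tp2 | exact: Tp3
  | exact: Tq0 | exact: Tq1 | exact: Tq2 | exact: Tq3 | exact: tame_cst
  | apply: tameB | apply: tameD | apply: tameN | apply: tameX | apply: tameM
  | (apply: tame_sum => ?) | assumption ].

Let tame_r : tame a b r.
Proof. by rewrite /r; tame. Qed.

(** Integration by parts against rho: since d_i ln rho = p1 + q1, the integrand is d_i (rho F). *)
Lemma weighted_partial F dF i s : a < s < b -> tame a b F -> tame a b dF ->
  partial i (F s) (dF s) ->
  \int[leb]_x (rho s x * (dF s x + (p1 i s x + q1 i s x) * F s x)) = 0.
Proof.
move=> sab tF tdF pF.
apply: (@integral_partial R n a b (fun s x => rho s x * F s x)
  (fun s x => rho s x * (dF s x + (p1 i s x + q1 i s x) * F s x)) s i) => //.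
- exact: gaussianM.
- by apply: gaussianM => //; tame.
have pr : partial i (rho s) (fun x => rho s x * (p1 i s x + q1 i s x)).
  apply: (partial_comp (df := expR)).
  by apply: partialD; [exact: (hl_partial1 hphi)|exact: (hl_partial1 hpsi)].
by apply: partial_ext (partialM pr pF) => // x; ring.
Qed.

Lemma weighted_time F dF s : a < s < b -> tame a b F -> tame a b dF ->
  (forall s x, a < s < b -> is_derive s 1 (F ^~ x) (dF s x)) ->
  is_derive s 1 (fun s => \int[leb]_x (rho s x * F s x))
    (\int[leb]_x (rho s x * (dF s x + r s x * F s x))).
Proof.
move=> sab tF tdF dFs.
apply: (@derive1_integral R n a b (fun s x => rho s x * F s x)
  (fun s x => rho s x * (dF s x + r s x * F s x)) s) => //.
- exact: gaussianM.
- by apply: gaussianM => //; apply: tameD => //; exact: tameM.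
move=> t x tab.
have dr : is_derive t 1 (rho ^~ x) (rho t x * r t x).
  apply: (@is_deriveR_chain _ expR (fun t => phi t x + psi t x)).
    apply: is_deriveR_eq (is_deriveR_add (hl_time0 hphi x tab) (hl_time0 hpsi x tab)) => //.
    rewrite /r !mulNr -mulrBr -sumrB; congr (_ * _); by apply: eq_bigr => i _; ring.
by apply: is_deriveR_eq (is_deriveR_mul dr (dFs t x tab)) => //; ring.
Qed.

(** Integrands may be changed modulo divergences: [rho * Z i] stands for the i-th term of one. *)
Let weighted_null (s : R) (G : R -> V -> R) (Z : 'I_n -> R -> V -> R) :
  a < s < b -> tame a b G -> (forall i, tame a b (Z i)) ->
  (forall i, \int[leb]_x (rho s x * Z i s x) = 0) ->
  \int[leb]_x (rho s x * (G s x + \sum_i Z i s x)) = \int[leb]_x (rho s x * G s x).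
Proof.
move=> sab tG tZ Z0.
have gG := gaussianM rho_gaussian tG.
have gZ i := gaussianM rho_gaussian (tZ i).
rewrite (_ : \int[leb]_x _ = \int[leb]_x (rho s x * G s x + \sum_i rho s x * Z i s x)).
  rewrite (integral_gaussianD sab gG (gaussian_sum _ _ gZ)).
  by rewrite (integral_gaussian_sum _ sab gZ) [X in _ + X]big1 ?addr0.
by apply: eq_Rintegral => x _; rewrite mulrDr mulr_sumr.
Qed.

(* The integrand of the derivative differs from [- kappa/2 rho sum_j p1_j^2] by
   kappa/2 times the divergence of [rho (phi grad (phi - psi) + grad phi)]; here
   Z1 and Z2 are the divergences of the two terms, divided by rho. *)
Lemma derive_entropy_part s : a < s < b ->
  is_derive s 1 (fun s => \int[leb]_x (rho s x * phi s x))
    (- (kappa / 2) * \sum_j \int[leb]_x (rho s x * p1 j s x ^+ 2)).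
Proof.
move=> sab.
have tF : tame a b (fun s x => kappa / 2 * \sum_i (p2 i i s x + p1 i s x ^+ 2)) by tame.
have := weighted_time sab Tp0 tF (fun s x => @hl_time0 _ _ _ _ _ hphi s x).
apply: is_deriveR_eq => //.
pose G s x := - (kappa / 2) * \sum_j p1 j s x ^+ 2.
have tG : tame a b G by rewrite /G; tame.
pose d i s x := p1 i s x - q1 i s x.
pose Z1 i s x := (p1 i s x * d i s x + phi s x * (p2 i i s x - q2 i i s x))
  + (p1 i s x + q1 i s x) * (phi s x * d i s x).
pose Z2 i s x := p2 i i s x + (p1 i s x + q1 i s x) * p1 i s x.
have Z10 i : \int[leb]_x (rho s x * Z1 i s x) = 0.
  apply: (@weighted_partial (fun s x => phi s x * d i s x)
    (fun s x => p1 i s x * d i s x + phi s x * (p2 i i s x - q2 i i s x))) => //.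
  - by rewrite /d; tame.
  - by rewrite /d; tame.
  - apply: partialM; first exact: (hl_partial1 hphi).
    by apply: partialB; [exact: (hl_partial2 hphi)|exact: (hl_partial2 hpsi)].
have Z20 i : \int[leb]_x (rho s x * Z2 i s x) = 0.
  apply: (@weighted_partial (p1 i) (p2 i i)) => //.
  exact: (hl_partial2 hphi).
have tZ1 i : tame a b (Z1 i) by rewrite /Z1 /d; tame.
have tZ2 i : tame a b (Z2 i) by rewrite /Z2; tame.
have tZ i : tame a b (fun s x => kappa / 2 * (Z1 i s x + Z2 i s x)) by tame.
have Z0 i : \int[leb]_x (rho s x * (kappa / 2 * (Z1 i s x + Z2 i s x))) = 0.
  rewrite (_ : \int[leb]_x _ = \int[leb]_x (kappa / 2 * (rho s x * Z1 i s x + rho s x * Z2 i s x))).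
    have g1 := gaussianM rho_gaussian (tZ1 i). have g2 := gaussianM rho_gaussian (tZ2 i).
    rewrite (integral_gaussianZ _ sab (gaussianD g1 g2)).
    by rewrite (integral_gaussianD sab g1 g2) Z10 Z20 addr0 mulr0.
  by apply: eq_Rintegral => x _; ring.
transitivity (\int[leb]_x (rho s x * (G s x + \sum_i (kappa / 2 * (Z1 i s x + Z2 i s x))))).
  apply: eq_Rintegral => x _; congr (_ * _).
  rewrite /G /r !mulr_sumr mulr_suml -!big_split/=; apply: eq_bigr => i _.
  by rewrite /Z1 /Z2 /d; ring.
rewrite (weighted_null sab tG tZ Z0).
have g1 j : gaussian a b (fun s x => rho s x * p1 j s x ^+ 2).
  by apply: gaussianM => //; tame.
rewrite -(integral_gaussian_sum _ sab g1) -(integral_gaussianZ _ sab (gaussian_sum _ _ g1)).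
by apply: eq_Rintegral => x _; rewrite /G mulrCA mulr_sumr.
Qed.

(* As above, with the vector field [rho (p1_j^2 grad (phi - psi) + 2 p1_j grad p1_j)]. *)
Lemma derive_fisher_part j s : a < s < b ->
  is_derive s 1 (fun s => \int[leb]_x (rho s x * p1 j s x ^+ 2))
    (- kappa * \sum_i \int[leb]_x (rho s x * p2 i j s x ^+ 2)).
Proof.
move=> sab.
have tF : tame a b (fun s x => kappa / 2 * \sum_i (p3 i j s x + 2 * p1 i s x * p2 i j s x)) by tame.
have t1 : tame a b (fun s x => p1 j s x ^+ 2) by tame.
have t2 : tame a b (fun s x => 2 * p1 j s x *
  (kappa / 2 * \sum_i (p3 i j s x + 2 * p1 i s x * p2 i j s x))) by tame.
have dp t x : a < t < b -> is_derive t 1 (fun t => p1 j t x ^+ 2) (2 * p1 j t x *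
  (kappa / 2 * \sum_i (p3 i j t x + 2 * p1 i t x * p2 i j t x))).
  move=> tab; have d1 := hl_time1 hphi j x tab.
  by apply: is_deriveR_eq (is_deriveR_mul d1 d1) => //; ring.
have := weighted_time sab t1 t2 dp.
apply: is_deriveR_eq => //.
pose G s x := - kappa * \sum_i p2 i j s x ^+ 2.
have tG : tame a b G by rewrite /G; tame.
pose d i s x := p1 i s x - q1 i s x.
pose Z1 i s x := ((p2 i j s x * p1 j s x + p1 j s x * p2 i j s x) * d i s x
    + p1 j s x * p1 j s x * (p2 i i s x - q2 i i s x))
  + (p1 i s x + q1 i s x) * (p1 j s x * p1 j s x * d i s x).
pose Z2 i s x := (p2 i j s x * p2 i j s x + p1 j s x * p3 i j s x)
  + (p1 i s x + q1 i s x) * (p1 j s x * p2 i j s x).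
have Z10 i : \int[leb]_x (rho s x * Z1 i s x) = 0.
  apply: (@weighted_partial (fun s x => p1 j s x * p1 j s x * d i s x)
    (fun s x => (p2 i j s x * p1 j s x + p1 j s x * p2 i j s x) * d i s x
      + p1 j s x * p1 j s x * (p2 i i s x - q2 i i s x))) => //.
  - by rewrite /d; tame.
  - by rewrite /d; tame.
  - apply: partialM; first by apply: partialM; exact: (hl_partial2 hphi).
    by apply: partialB; [exact: (hl_partial2 hphi)|exact: (hl_partial2 hpsi)].
have Z20 i : \int[leb]_x (rho s x * Z2 i s x) = 0.
  apply: (@weighted_partial (fun s x => p1 j s x * p2 i j s x)
    (fun s x => p2 i j s x * p2 i j s x + p1 j s x * p3 i j s x)) => //.
  - by tame.
  - by tame.
  - by apply: partialM; [exact: (hl_partial2 hphi)|exact: (hl_partial3 hphi)].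
have tZ1 i : tame a b (Z1 i) by rewrite /Z1 /d; tame.
have tZ2 i : tame a b (Z2 i) by rewrite /Z2; tame.
have tZ i : tame a b (fun s x => kappa / 2 * (Z1 i s x + 2 * Z2 i s x)) by tame.
have Z0 i : \int[leb]_x (rho s x * (kappa / 2 * (Z1 i s x + 2 * Z2 i s x))) = 0.
  rewrite (_ : \int[leb]_x _ = \int[leb]_x (kappa / 2 * (rho s x * Z1 i s x) + kappa * (rho s x * Z2 i s x))).
    have g1 := gaussianM rho_gaussian (tZ1 i). have g2 := gaussianM rho_gaussian (tZ2 i).
    have h1 := gaussianZ (kappa / 2) g1. have h2 := gaussianZ kappa g2.
    rewrite (integral_gaussianD sab h1 h2) (integral_gaussianZ _ sab g1) (integral_gaussianZ _ sab g2).
    by rewrite Z10 Z20 !mulr0 addr0.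
  by apply: eq_Rintegral => x _; field.
transitivity (\int[leb]_x (rho s x * (G s x + \sum_i (kappa / 2 * (Z1 i s x + 2 * Z2 i s x))))).
  apply: eq_Rintegral => x _; congr (_ * _).
  rewrite /G /r !mulr_sumr mulr_suml -!big_split/=; apply: eq_bigr => i _.
  by rewrite /Z1 /Z2 /d; field.
rewrite (weighted_null sab tG tZ Z0).
have g1 i : gaussian a b (fun s x => rho s x * p2 i j s x ^+ 2).
  by apply: gaussianM => //; tame.
rewrite -(integral_gaussian_sum _ sab g1) -(integral_gaussianZ _ sab (gaussian_sum _ _ g1)).
by apply: eq_Rintegral => x _; rewrite /G mulrCA mulr_sumr.
Qed.

(** Subtracting [weighted_partial] for q1 from the one for p1 cancels the cross terms p1 q1 and
    leaves p1^2 - q1^2 + p2 - q2 in each direction. *)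
Lemma integral_laplacian_log s : a < s < b ->
  \sum_i \int[leb]_x (rho s x * p1 i s x ^+ 2) - \sum_i \int[leb]_x (rho s x * q1 i s x ^+ 2) =
  - \int[leb]_x (rho s x * \sum_i (p2 i i s x - q2 i i s x)).
Proof.
move=> sab.
have gp i : gaussian a b (fun s x => rho s x * p1 i s x ^+ 2) by apply: gaussianM => //; tame.
have gq i : gaussian a b (fun s x => rho s x * q1 i s x ^+ 2) by apply: gaussianM => //; tame.
have gL i : gaussian a b (fun s x => rho s x * (p2 i i s x - q2 i i s x)) by apply: gaussianM => //; tame.
under [in RHS]eq_Rintegral do rewrite mulr_sumr.
rewrite (integral_gaussian_sum _ sab gL) -sumrB -sumrN; apply: eq_bigr => i _.
have E1 : \int[leb]_x (rho s x * (p2 i i s x + (p1 i s x + q1 i s x) * p1 i s x)) = 0.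
  by apply: (@weighted_partial (p1 i) (p2 i i)) => //; exact: (hl_partial2 hphi).
have E2 : \int[leb]_x (rho s x * (q2 i i s x + (p1 i s x + q1 i s x) * q1 i s x)) = 0.
  by apply: (@weighted_partial (q1 i) (q2 i i)) => //; exact: (hl_partial2 hpsi).
have gE1 : gaussian a b (fun s x => rho s x * (p2 i i s x + (p1 i s x + q1 i s x) * p1 i s x)).
  by apply: gaussianM => //; tame.
have gE2 : gaussian a b (fun s x => rho s x * (q2 i i s x + (p1 i s x + q1 i s x) * q1 i s x)).
  by apply: gaussianM => //; tame.
apply/eqP; rewrite -subr_eq0 opprK; apply/eqP.
rewrite -[in X in _ - X](mul1r (\int[leb]_x (rho s x * q1 i s x ^+ 2))) -mulNr.
rewrite -(integral_gaussianZ _ sab (gq i)) -(integral_gaussianD sab (gp i) (gaussianZ (-1) (gq i))).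
rewrite -(integral_gaussianD sab (gaussianD (gp i) (gaussianZ (-1) (gq i))) (gL i)).
(* The zero on the right becomes the combination E1 - E2, after which the two integrands agree by
   [ring]. *)
rewrite -[RHS](_ : 0 + (-1) * 0 = 0); last by rewrite mulr0 addr0.
rewrite -[X in X + _]E1 -[X in _ + (-1) * X]E2 -(integral_gaussianZ _ sab gE2).
rewrite -(integral_gaussianD sab gE1 (gaussianZ (-1) gE2)).
by apply: eq_Rintegral => x _; ring.
Qed.

End heat_log.

Section entropy_convexity.
Context (R : realType) (n : nat) (a b : R).
Local Notation V := 'rV[R]_n.
Local Notation leb := (lebesgue_rV R n).
Context (phi psi : R -> V -> R) (p1 q1 : 'I_n -> R -> V -> R)
  (p2 p3 q2 q3 : 'I_n -> 'I_n -> R -> V -> R).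
Hypothesis hphi : heat_log a b 1 phi p1 p2 p3.
Hypothesis hpsi : heat_log a b (- 1) psi q1 q2 q3.
Let rho s x := expR (phi s x + psi s x).
Hypothesis rho_gaussian : gaussian a b rho.
Hypothesis rho1 : forall s, a < s < b -> \int[leb]_x rho s x = 1.

Let H s := \int[leb]_x (rho s x * (phi s x + psi s x)).
Let dH s := 2^-1 * (\sum_j \int[leb]_x (rho s x * q1 j s x ^+ 2)
  - \sum_j \int[leb]_x (rho s x * p1 j s x ^+ 2)).
Let ddH s := 2^-1 * (\sum_j \sum_i \int[leb]_x (rho s x * p2 i j s x ^+ 2)
  + \sum_j \sum_i \int[leb]_x (rho s x * q2 i j s x ^+ 2)).

Let rhoC : rho = fun s x => expR (psi s x + phi s x).
Proof. by apply/funext => s; apply/funext => x; rewrite /rho addrC. Qed.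

(** For the exchanged pair (psi, phi) the first potential has kappa = -1, so the second is expected
    with - - 1. *)
Let hphi' : heat_log a b (- - 1) phi p1 p2 p3. Proof. by rewrite opprK. Qed.
Let rho_gaussian' : gaussian a b (fun s x => expR (psi s x + phi s x)).
Proof. by rewrite -rhoC. Qed.

Local Ltac tame := repeat first [ exact: (hl_tame0 hphi) | exact: (hl_tame1 hphi)
  | exact: (hl_tame2 hphi) | exact: (hl_tame3 hphi)
  | exact: (hl_tame0 hpsi) | exact: (hl_tame1 hpsi)
  | exact: (hl_tame2 hpsi) | exact: (hl_tame3 hpsi) | exact: tame_cst
  | apply: tameB | apply: tameD | apply: tameN | apply: tameX | apply: tameM
  | (apply: tame_sum => ?) | assumption ].

Lemma is_derive_entropy s : a < s < b -> is_derive s 1 H (dH s).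
Proof.
move=> sab.
have d1 : is_derive s 1 (fun s => \int[leb]_x (rho s x * phi s x))
    (- (1 / 2) * \sum_j \int[leb]_x (rho s x * p1 j s x ^+ 2)).
  exact: (derive_entropy_part hphi hpsi rho_gaussian sab).
have d2 : is_derive s 1 (fun s => \int[leb]_x (rho s x * psi s x))
    (- (- 1 / 2) * \sum_j \int[leb]_x (rho s x * q1 j s x ^+ 2)).
  rewrite rhoC; exact: (derive_entropy_part hpsi hphi' rho_gaussian' sab).
have gp : gaussian a b (fun s x => rho s x * phi s x) by apply: gaussianM => //; tame.
have gq : gaussian a b (fun s x => rho s x * psi s x) by apply: gaussianM => //; tame.
have := is_deriveR_add d1 d2.
rewrite (_ : _ + _ = dH s); last by rewrite /dH; field.
apply: near_eq_is_derive; rewrite ?oner_eq0//.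
have /near_in_itvoo : s \in `]a, b[ by rewrite in_itv.
apply: filterS => t; rewrite in_itv/= => tab.
rewrite -(integral_gaussianD tab gp gq); apply: eq_Rintegral => x _.
by rewrite /H mulrDr.
Qed.

Lemma is_derive2_entropy s : a < s < b -> is_derive s 1 dH (ddH s).
Proof.
move=> sab.
have d1 j : is_derive s 1 (fun s => \int[leb]_x (rho s x * p1 j s x ^+ 2))
    (- 1 * \sum_i \int[leb]_x (rho s x * p2 i j s x ^+ 2)).
  exact: (derive_fisher_part hphi hpsi rho_gaussian j sab).
have d2 j : is_derive s 1 (fun s => \int[leb]_x (rho s x * q1 j s x ^+ 2))
    (- - 1 * \sum_i \int[leb]_x (rho s x * q2 i j s x ^+ 2)).
  rewrite rhoC; exact: (derive_fisher_part hpsi hphi' rho_gaussian' j sab).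
have := is_deriveR_mul (is_deriveR_const s 2^-1)
  (is_deriveR_sub (is_deriveR_sumr (index_enum 'I_n) predT d2) (is_deriveR_sumr (index_enum 'I_n) predT d1)).
apply: is_deriveR_eq => //; rewrite mul0r add0r /ddH; congr (_ * _).
rewrite addrC -sumrN; congr (_ + _); apply: eq_bigr => j _; rewrite ?opprK ?mul1r//.
by rewrite mulN1r opprK.
Qed.

Lemma sqr_derive_entropy_le s : a < s < b -> dH s ^+ 2 <= n%:R * ddH s.
Proof.
move=> sab.
pose L s x := \sum_i (p2 i i s x - q2 i i s x).
have gr (F : R -> V -> R) : tame a b F -> gaussian a b (fun s x => rho s x * F s x).
  by move=> tF; exact: gaussianM.
have tL : tame a b L by rewrite /L; tame.
have := integral_laplacian_log hphi hpsi rho_gaussian sab.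
rewrite -[X in X = _]opprB => /oppr_inj HL.
pose m := \int[leb]_x (rho s x * L s x).
have -> : dH s = 2^-1 * m by rewrite /dH HL.
(* The variance of L under the probability density rho is nonnegative. *)
have jensen : m ^+ 2 <= \int[leb]_x (rho s x * L s x ^+ 2).
  rewrite -subr_ge0.
  have tL2 : tame a b (fun s x => L s x ^+ 2) by tame.
  have g1 := gr _ tL2. have g2 := gaussianZ (- 2 * m) (gr _ tL).
  have g3 := gaussianZ (m ^+ 2) rho_gaussian.
  have -> : \int[leb]_x (rho s x * L s x ^+ 2) - m ^+ 2 =
      \int[leb]_x (rho s x * (L s x - m) ^+ 2).
    transitivity (\int[leb]_x (rho s x * L s x ^+ 2 + (- 2 * m) * (rho s x * L s x)
        + m ^+ 2 * rho s x)).
      rewrite (integral_gaussianD sab (gaussianD g1 g2) g3) (integral_gaussianD sab g1 g2).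
      rewrite (integral_gaussianZ _ sab (gr _ tL)) (integral_gaussianZ _ sab rho_gaussian).
      by rewrite rho1// -/m; ring.
    by apply: eq_Rintegral => x _; ring.
  apply: Rintegral_ge0 => x _.
  by rewrite mulr_ge0 ?sqr_ge0// expR_ge0.
pose S (s : R) x := \sum_j \sum_i p2 i j s x ^+ 2 + \sum_j \sum_i q2 i j s x ^+ 2.
have tS : tame a b S by rewrite /S; tame.
(* The square of the trace L costs a factor n, (p - q)^2 <= 2 (p^2 + q^2) a factor 2, and the
   off-diagonal squares are added for free. With dH = m / 2 and ddH = (1/2) \int rho S the constants
   match exactly. *)
have LS : \int[leb]_x (rho s x * L s x ^+ 2) <= \int[leb]_x (rho s x * (2 * n%:R * S s x)).
  apply: (@le_integral_gaussian _ _ a b (fun s x => rho s x * L s x ^+ 2)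
      (fun s x => rho s x * (2 * n%:R * S s x)) s sab).
  - by apply: gr; tame.
  - by apply: gr; tame.
  move=> x; apply: ler_wpM2l; first exact: expR_ge0.
  apply: le_trans (sqr_sum_le _) _; rewrite -mulrA mulrCA; apply: ler_wpM2l; first exact: ler0n.
  rewrite /S -big_split/= mulr_sumr; apply: ler_sum => j _.
  rewrite -big_split/= (bigD1 j)//= mulrDr.
  apply: (@le_trans _ _ (2 * (p2 j j s x ^+ 2 + q2 j j s x ^+ 2))).
    by have := sqr_ge0 (p2 j j s x + q2 j j s x); rewrite sqrrD sqrrB; lra.
  rewrite lerDl mulr_ge0//; apply: sumr_ge0 => i _.
  by rewrite addr_ge0 ?sqr_ge0.
have -> : ddH s = 2^-1 * \int[leb]_x (rho s x * S s x).
  have gp i j : gaussian a b (fun s x => rho s x * p2 i j s x ^+ 2) by apply: gr; tame.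
  have gq i j : gaussian a b (fun s x => rho s x * q2 i j s x ^+ 2) by apply: gr; tame.
  have gps j := gaussian_sum (index_enum 'I_n) predT (fun i => gp i j).
  have gqs j := gaussian_sum (index_enum 'I_n) predT (fun i => gq i j).
  rewrite /ddH; congr (_ * _).
  under eq_bigr do rewrite -(integral_gaussian_sum _ sab (fun i => gp i _)).
  under [X in _ + X]eq_bigr do rewrite -(integral_gaussian_sum _ sab (fun i => gq i _)).
  rewrite -(integral_gaussian_sum _ sab gps) -(integral_gaussian_sum _ sab gqs).
  rewrite -(integral_gaussianD sab (gaussian_sum _ _ gps) (gaussian_sum _ _ gqs)).
  apply: eq_Rintegral => x _; rewrite /S mulrDr !mulr_sumr; congr (_ + _);
    by apply: eq_bigr => j _; rewrite mulr_sumr.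
have E : \int[leb]_x (rho s x * (2 * n%:R * S s x)) = 2 * n%:R * \int[leb]_x (rho s x * S s x).
  rewrite -(integral_gaussianZ _ sab (gr _ tS)); apply: eq_Rintegral => x _; ring.
rewrite E in LS; rewrite exprMn; have := le_trans jensen LS.
set I := \int[leb]_x (rho s x * S s x); set M := m ^+ 2; lra.
Qed.

End entropy_convexity.

(** * Heat flow of a compactly supported source *)

Section exponential_integral.
Context d (T : measurableType d) (R : realType) (mu : {measure set T -> \bar R}).

(** The bound on G is needed only where F does not vanish: for a compactly supported F, polynomial
    and exponential factors become harmless. *)
Lemma integrable_mul_bounded (F G : T -> R) (M : R) :
  mu.-integrable setT (EFin \o F) -> measurable_fun setT G ->
  (forall y, F y != 0 -> `|G y| <= M) ->
  mu.-integrable setT (EFin \o (fun y => F y * G y)).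
Proof.
move=> iF mG GM.
have mF : measurable_fun setT F by apply/measurable_EFinP; apply: measurable_int iF.
have iFM : mu.-integrable setT (EFin \o (fun y => `|M| * F y)).
  rewrite (_ : _ \o _ = fun y => (`|M|%:E * (EFin \o F) y)%E); first exact: integrableZl.
  by apply/funext => y /=; rewrite EFinM.
apply: le_integrable iFM => //.
  by apply/measurable_EFinP; exact: measurable_funM.
move=> y _ /=; rewrite lee_fin !normrM normr_id mulrC.
have [->|Fy] := eqVneq (F y) 0; first by rewrite normr0 !mulr0.
by apply: ler_wpM2r => //; apply: le_trans (GM _ Fy) _; exact: ler_norm.
Qed.

(** Serves both the x-derivatives and the time derivative of a Laplace transform; on the support of
    F the exponent and its derivative are uniformly bounded for t in ]u, v[, which gives the
    dominating function. *)
Lemma is_derive_integral_expR (F : T -> R) (w dw : R -> T -> R) (u v A B t : R) :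
  mu.-integrable setT (EFin \o F) ->
  (forall t, measurable_fun setT (w t)) ->
  (forall (t : R) y, is_derive t (1 : R) (w ^~ y) (dw t y)) ->
  (forall t y, u < t < v -> F y != 0 -> `|w t y| <= A /\ `|dw t y| <= B) ->
  u < t < v ->
  is_derive t 1 (fun t => \int[mu]_y (F y * expR (w t y)))
    (\int[mu]_y (F y * dw t y * expR (w t y))).
Proof.
move=> iF mw dwE wAB tuv.
pose G t y := F y * expR (w t y).
have dG y (s : R) : is_derive s (1 : R) (G ^~ y) (F y * dw s y * expR (w s y)).
  have d1 : is_derive s 1 (fun s => expR (w s y)) (expR (w s y) * dw s y).
    by apply: (@is_deriveR_chain _ expR (w ^~ y)).
  by apply: is_deriveR_eq (is_deriveR_mul (is_deriveR_const s (F y)) d1) => //; ring.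
have d1 y (s : R) : derive1 (G ^~ y) s = F y * dw s y * expR (w s y).
  by rewrite derive1E; apply: derive_val; exact: dG.
pose D y := `|F y| * (`|B| * expR A).
have It : [set` `]u, v[] t by rewrite /= in_itv.
have wle s y : u < s < v -> F y != 0 -> expR (w s y) <= expR A.
  by move=> suv Fy; rewrite ler_expR (le_trans (ler_norm _))//; have [] := wAB s y suv Fy.
have intG s : [set` `]u, v[] s -> mu.-integrable setT (EFin \o G s).
  rewrite /= in_itv/= => suv; apply: (@integrable_mul_bounded _ _ (expR A)) => //.
    by apply: measurableT_comp => //; exact: mw.
  by move=> y Fy; rewrite ger0_norm ?expR_ge0//; exact: wle.
have derG s (y : T) : [set` `]u, v[] s -> setT y -> derivable (G ^~ y) s 1.
  by move=> _ _; have [] := dG y s.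
have D0 y : 0 <= D y by rewrite /D !mulr_ge0 ?expR_ge0.
have iD : mu.-integrable setT (EFin \o D).
  rewrite /D (_ : _ \o _ = fun y => ((`|B| * expR A)%:E * `|(EFin \o F) y|)%E).
    by apply: integrableZl => //; exact: integrable_abse.
  by apply/funext => y /=; rewrite -EFinM mulrC.
have ub s y : [set` `]u, v[] s -> setT y -> `|partial1of2 G s y| <= D y.
  rewrite /= in_itv/= => suv _; rewrite /partial1of2 d1 /D -mulrA normrM.
  have [->|Fy] := eqVneq (F y) 0; first by rewrite normr0 !mul0r.
  apply: ler_wpM2l => //; rewrite normrM; apply: ler_pM => //.
    by have [_ /le_trans] := wAB s y suv Fy; apply; exact: ler_norm.
  by rewrite ger0_norm ?expR_ge0//; exact: wle.
have H := differentiation_under_integral measurableT It intG derG D0 iD ub.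
have DD := derivable_under_integral measurableT It intG derG D0 iD ub.
apply: DeriveDef => //; rewrite -derive1E H.
by apply: eq_Rintegral => x _; rewrite /partial1of2 d1.
Qed.

Lemma integrable_addR (F G : T -> R) : mu.-integrable setT (EFin \o F) ->
  mu.-integrable setT (EFin \o G) ->
  mu.-integrable setT (EFin \o (fun y => F y + G y)).
Proof.
move=> iF iG; rewrite (_ : _ \o _ = fun y => ((EFin \o F) y + (EFin \o G) y)%E).
  exact: integrableD.
by apply/funext => y /=; rewrite EFinD.
Qed.

Lemma integrable_scaleR (c : R) (F : T -> R) : mu.-integrable setT (EFin \o F) ->
  mu.-integrable setT (EFin \o (fun y => c * F y)).
Proof.
move=> iF; rewrite (_ : _ \o _ = fun y => (c%:E * (EFin \o F) y)%E).
  exact: integrableZl.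
by apply/funext => y /=; rewrite EFinM.
Qed.

Lemma integrable_sumR (I : Type) (r : seq I) (F : I -> T -> R) :
  (forall i, mu.-integrable setT (EFin \o F i)) ->
  mu.-integrable setT (EFin \o (fun y => \sum_(i <- r) F i y)).
Proof.
move=> iF; elim: r => [|i r IH].
  rewrite (_ : _ \o _ = cst 0%E); first exact: integrable0.
  by apply/funext => y; rewrite /= big_nil.
rewrite (_ : _ \o _ = EFin \o (fun y => F i y + \sum_(j <- r) F j y)).
  exact: integrable_addR.
by apply/funext => y; rewrite /= big_cons.
Qed.

Lemma Rintegral_sumR (I : Type) (r : seq I) (F : I -> T -> R) :
  (forall i, mu.-integrable setT (EFin \o F i)) ->
  \int[mu]_y (\sum_(i <- r) F i y) = \sum_(i <- r) \int[mu]_y F i y.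
Proof.
move=> iF; elim: r => [|i r IH].
  rewrite big_nil; under eq_Rintegral do rewrite big_nil.
  by rewrite /Rintegral integral0.
rewrite big_cons -IH -RintegralD//; last exact: integrable_sumR.
by apply: eq_Rintegral => y _; rewrite big_cons.
Qed.

End exponential_integral.

(** For b <= a, factor exp a out and use exp(b - a) >= 1 + (b - a). *)
Lemma expR_lipschitz (R : realType) (A a b : R) : a <= A -> b <= A ->
  `|expR a - expR b| <= expR A * `|a - b|.
Proof.
wlog ab : a b / b <= a => [H aA bA|aA bA].
  have [/H|/ltW/H] := leP b a; first exact.
  by rewrite distrC (distrC a); apply.
rewrite !ger0_norm ?subr_ge0 ?ler_expR//.
have -> : expR b = expR a * expR (b - a) by rewrite -expRD subrKC.
apply: (@le_trans _ _ (expR a * (a - b))); last first.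
  by rewrite ler_wpM2r ?subr_ge0// ler_expR.
rewrite -[X in X - _]mulr1 -mulrBr ler_wpM2l ?expR_ge0//.
by have := expR_ge1Dx (b - a); lra.
Qed.

(** * Laplace transform of a compactly supported source *)

Section tilted_moments.
Context (R : realType) (n : nat).
Local Notation V := 'rV[R]_n.
Local Notation leb := (lebesgue_rV R n).

Definition dot (x y : V) : R := \sum_i x ord0 i * y ord0 i.
Definition norm1 (x : V) : R := \sum_i `|x ord0 i|.

(** Continuity is not included: the heat flow of one Schroedinger factor is used before the other
    factor is known to have a continuous version. Positive mass keeps the logarithm of the heat flow
    finite. *)
Record compact_source (K : R) (f : V -> R) : Prop := CompactSource {
  cs_measurable : measurable_fun setT f ;
  cs_ge0 : forall y, 0 <= f y ;
  cs_support : forall y, f y != 0 -> forall i, `|y ord0 i| <= K ;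
  cs_integrable : leb.-integrable setT (EFin \o f) ;
  cs_mass : 0 < \int[leb]_y f y }.

Lemma measurable_dot x : measurable_fun setT (dot x).
Proof.
apply: measurable_sum => i; apply: measurable_funM => //; exact: measurable_coord.
Qed.

Lemma norm1_ge0 x : 0 <= norm1 x. Proof. exact: sumr_ge0. Qed.

Context (K : R) (K0 : 0 <= K) (f : V -> R) (hf : compact_source K f).

Let mon (l : seq 'I_n) (y : V) : R := \prod_(i <- l) y ord0 i.
Let ex (tau : R) (x y : V) := tau * (dot x y - sqr_norm2 y / 2).

(** The list [l] encodes a monomial in y. Differentiating the exponential multiplies by coordinates
    of y, that is, prepends indices, so the family is closed under differentiation in x and in tau.
    The variable tau = 1/s makes the exponent linear in time. *)
Definition moment (l : seq 'I_n) (tau : R) (x : V) : R :=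
  \int[leb]_y (f y * mon l y * expR (tau * (dot x y - sqr_norm2 y / 2))).

Let box (y : V) := forall i, `|y ord0 i| <= K.

Let bound (tau : R) (x : V) : R := `|tau| * (K * norm1 x + n%:R * K ^+ 2).

Let measurable_ex tau x : measurable_fun setT (ex tau x).
Proof.
apply: measurable_funM => //; apply: measurable_funB; first exact: measurable_dot.
by apply: measurable_funM => //; exact: measurable_sqr_norm2.
Qed.

Let dot_le x y : box y -> `|dot x y| <= K * norm1 x.
Proof.
move=> by_; apply: le_trans (ler_norm_sum _ _ _) _.
rewrite mulr_sumr; apply: ler_sum => i _; rewrite normrM mulrC.
exact: ler_wpM2r.
Qed.

Let sqr_norm2_le y : box y -> sqr_norm2 y <= n%:R * K ^+ 2.
Proof.
move=> by_; rewrite -[X in X%:R](card_ord n) -sum1_card natr_sum mulr_suml.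
apply: ler_sum => i _; rewrite mul1r -real_normK ?num_real//.
by rewrite lerXn2r// nnegrE.
Qed.

Let ex_le tau x y : box y -> `|ex tau x y| <= bound tau x.
Proof.
move=> by_; rewrite /ex normrM; apply: ler_wpM2l => //.
apply: le_trans (ler_normB _ _) _; apply: lerD; first exact: dot_le.
rewrite ger0_norm ?divr_ge0 ?sqr_norm2_ge0//.
by have := sqr_norm2_le by_; have := sqr_norm2_ge0 y; lra.
Qed.

Let measurable_mon l : measurable_fun setT (mon l).
Proof. by apply: measurable_prod => i _; exact: measurable_coord. Qed.

Let mon_le l y : box y -> `|mon l y| <= K ^+ size l.
Proof.
move=> by_; elim: l => [|i l IH]; first by rewrite /mon big_nil normr1.
by rewrite /mon big_cons normrM/= exprS; apply: ler_pM.
Qed.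

Let mon_cons i l y : mon (i :: l) y = y ord0 i * mon l y.
Proof. by rewrite /mon big_cons. Qed.

Let support_f l y : f y * mon l y != 0 -> box y.
Proof. by rewrite mulf_eq0 negb_or => /andP[fy _]; exact: (cs_support hf). Qed.

Let integrable_fmon l : leb.-integrable setT (EFin \o (fun y => f y * mon l y)).
Proof.
apply: (integrable_mul_bounded (M := K ^+ size l) (cs_integrable hf) (measurable_mon l)).
by move=> y /(cs_support hf) by_; exact: mon_le.
Qed.

Lemma integrable_moment l tau x :
  leb.-integrable setT (EFin \o (fun y => f y * mon l y * expR (ex tau x y))).
Proof.
apply: (integrable_mul_bounded (M := expR (bound tau x)) (integrable_fmon l)).
  by apply: measurableT_comp => //; exact: measurable_ex.
move=> y /support_f by_; rewrite ger0_norm ?expR_ge0// ler_expR.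
by apply: le_trans (ler_norm _) _; exact: ex_le.
Qed.

Let dotD x x' y : dot (x + x') y = dot x y + dot x' y.
Proof. by rewrite /dot -big_split; apply: eq_bigr => i _; rewrite mxE mulrDl. Qed.

Let dot_delta h i y : dot (h *: delta_mx ord0 i) y = h * y ord0 i.
Proof.
rewrite /dot (bigD1 i)//= big1 => [|j ji]; first by rewrite !mxE !eqxx mulr1 addr0.
by rewrite !mxE (negPf ji) andbF mulr0 mul0r.
Qed.

Lemma partial_moment i l tau :
  partial i (moment l tau) (fun x => tau * moment (i :: l) tau x).
Proof.
move=> x.
pose w (h : R) (y : V) := ex tau (x + h *: delta_mx ord0 i) y.
have dw (h : R) (y : V) : is_derive h (1 : R) (w ^~ y) (tau * y ord0 i).
  apply: is_deriveR_eq (is_deriveR_add (is_deriveR_const h (ex tau x y))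
    (is_deriveR_mul (is_deriveR_id h) (is_deriveR_const h (tau * y ord0 i)))).
    by move=> k; rewrite /w /ex dotD dot_delta; ring.
  by rewrite mulr0 addr0 add0r mul1r.
(* Moving x by h along one axis increases [norm1 x] by at most 1. *)
have wb h y : -1 < h < 1 -> f y * mon l y != 0 ->
    `|w h y| <= `|tau| * (K * (norm1 x + 1) + n%:R * K ^+ 2) /\ `|tau * y ord0 i| <= `|tau| * K.
  move=> /andP[h1 h2] /support_f by_; split; last by rewrite normrM ler_wpM2l.
  apply: le_trans (ex_le _ _ by_) _; apply: ler_wpM2l => //.
  rewrite lerD2r; apply: ler_wpM2l => //; rewrite /norm1.
  apply: (@le_trans _ _ (\sum_j (`|x ord0 j| + (j == i)%:R))).
    apply: ler_sum => j _; rewrite !mxE eqxx/=; apply: le_trans (ler_normD _ _) _.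
    rewrite lerD2l normrM; case: eqP => _; rewrite ?normr0 ?mulr0// normr1 mulr1.
    by rewrite ler_norml (ltW h1) ltW.
  rewrite big_split/= lerD2l (bigD1 i)//= eqxx big1 ?addr0// => j ji.
  by rewrite (negPf ji).
have h01 : -1 < (0 : R) < 1 by apply/andP; split; lra.
have := is_derive_integral_expR (integrable_fmon l) (fun h => measurable_ex _ _) dw wb h01.
apply: is_deriveR_eq => //.
rewrite /moment -RintegralZl//; last exact: integrable_moment.
by apply: eq_Rintegral => y _; rewrite /w scale0r addr0 mon_cons /ex; ring.
Qed.

Lemma derive_moment l (tau : R) x : is_derive tau (1 : R) (fun tau => moment l tau x)
  (\sum_i (x ord0 i * moment (i :: l) tau x - 2^-1 * moment (i :: i :: l) tau x)).
Proof.
have dw (t : R) (y : V) : is_derive t (1 : R) (fun t => ex t x y) (dot x y - sqr_norm2 y / 2).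
  apply: is_deriveR_eq (is_deriveR_mul (is_deriveR_id t) (is_deriveR_const t (dot x y - sqr_norm2 y / 2))) => //.
  by rewrite mulr0 addr0 mul1r.
have wb t y : tau - 1 < t < tau + 1 -> f y * mon l y != 0 ->
    `|ex t x y| <= (`|tau| + 1) * (K * norm1 x + n%:R * K ^+ 2) /\
    `|dot x y - sqr_norm2 y / 2| <= bound 1 x.
  move=> /andP[h1 h2] /support_f by_; split.
    apply: le_trans (ex_le _ _ by_) _; apply: ler_wpM2r.
      by rewrite addr_ge0 ?mulr_ge0 ?norm1_ge0 ?exprn_ge0 ?ler0n.
    rewrite -lerBlDl; apply: le_trans (lerB_dist _ _) _.
    by rewrite ler_norml; apply/andP; split; lra.
  by have := ex_le 1 x by_; rewrite /ex mul1r.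
have ht : tau - 1 < tau < tau + 1 by apply/andP; split; lra.
have := is_derive_integral_expR (integrable_fmon l) (fun t => measurable_ex _ _) dw wb ht.
apply: is_deriveR_eq => //.
transitivity (\int[leb]_y (\sum_i (x ord0 i * (f y * mon (i :: l) y * expR (ex tau x y))
  + - 2^-1 * (f y * mon (i :: i :: l) y * expR (ex tau x y))))).
  apply: eq_Rintegral => y _.
  rewrite /dot /sqr_norm2 mulr_suml -sumrB mulr_sumr mulr_suml; apply: eq_bigr => i _.
  by rewrite !mon_cons /ex /dot /sqr_norm2; ring.
have I1 c l' := integrable_scaleR c (integrable_moment l' tau x).
rewrite Rintegral_sumR; last by move=> i; exact: integrable_addR.
apply: eq_bigr => i _; rewrite RintegralD//.
rewrite !RintegralZl//; [|exact: integrable_moment..].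
by rewrite mulNr.
Qed.

Lemma continuous_moment l tau : continuous (moment l tau).
Proof.
move=> x; apply/(@cvgrPdist_le _ _ _ (nbhs x)) => e e0.
pose A := `|tau| * (K * (norm1 x + n%:R) + n%:R * K ^+ 2).
pose I := \int[leb]_y `|f y * mon l y|.
have I0 : 0 <= I by apply: Rintegral_ge0.
(* A Lipschitz constant around x for the sup norm: A bounds both exponents as long as x' is within
   distance 1 of x, and the exponents differ by at most |tau| n K times that distance. *)
pose C := I * (expR A * (`|tau| * (n%:R * K))).
have C0 : 0 <= C by rewrite /C !mulr_ge0 ?expR_ge0.
(* C + 1 instead of C, which may vanish. *)
pose dl := Num.min 1 (e / (C + 1)).
have dl0 : 0 < dl by rewrite lt_min ltr01 divr_gt0// ltr_wpDl.
near=> x'.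
have xx' : ball x dl x' by near: x'; exact: nbhsx_ballx.
have dxx' i : `|x' ord0 i - x ord0 i| <= dl.
  by rewrite distrC; apply: ltW; exact: (xx'.2 ord0 i).
have n1 : norm1 x' <= norm1 x + n%:R.
  rewrite -[X in _ + X%:R](card_ord n) -sum1_card natr_sum -big_split/=.
  apply: ler_sum => i _; rewrite -lerBlDl; apply: le_trans (lerB_dist _ _) _.
  by apply: le_trans (dxx' i) _; rewrite ge_min lexx.
have exA z y : norm1 z <= norm1 x + n%:R -> box y -> ex tau z y <= A.
  move=> nz by_; apply: le_trans (ler_norm _) _; apply: le_trans (ex_le _ _ by_) _.
  by apply: ler_wpM2l => //; rewrite lerD2r; apply: ler_wpM2l.
rewrite /moment -RintegralB//; [|exact: integrable_moment..].
have iB : leb.-integrable setT (EFin \o (fun y => f y * mon l y * expR (ex tau x y)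
    - f y * mon l y * expR (ex tau x' y))).
  rewrite (_ : _ \o _ = EFin \o (fun y => f y * mon l y * expR (ex tau x y)
    + -1 * (f y * mon l y * expR (ex tau x' y)))).
    by apply: integrable_addR; [|apply: integrable_scaleR]; exact: integrable_moment.
  by apply/funext => y /=; rewrite mulN1r.
apply: le_trans (le_normr_Rintegral _ iB) _ => //.
apply: (@le_trans _ _ (\int[leb]_y ((expR A * (`|tau| * (n%:R * K)) * dl) * `|f y * mon l y|))).
  apply: le_Rintegral => //.
  - exact: integrable_abse iB.
  - apply: integrable_scaleR; exact: integrable_abse (integrable_fmon l).
  move=> y _; rewrite -mulrBr normrM mulrC.
  have [->|Fy] := eqVneq (f y * mon l y) 0; first by rewrite normr0 !mulr0.
  apply: ler_wpM2r => //; have by_ := support_f Fy.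
  apply: le_trans (expR_lipschitz (exA x y _ by_) (exA x' y n1 by_)) _.
    by rewrite lerDl.
  rewrite -mulrA; apply: ler_wpM2l; first exact: expR_ge0.
  rewrite (_ : _ - _ = tau * (dot x y - dot x' y)); last by rewrite /ex; ring.
  rewrite normrM -mulrA; apply: ler_wpM2l => //.
  rewrite -sumrB; apply: le_trans (ler_norm_sum _ _ _) _.
  rewrite -[X in X%:R * _ * _](card_ord n) -sum1_card natr_sum !mulr_suml.
  apply: ler_sum => i _; rewrite mul1r -mulrBl normrM mulrC distrC.
  by apply: ler_pM => //; exact: by_.
rewrite RintegralZl//; last exact: integrable_abse (integrable_fmon l).
rewrite -/I (_ : _ * I = C * dl); last by rewrite /C; ring.
apply: (@le_trans _ _ (C * (e / (C + 1)))).
  by apply: ler_wpM2l => //; rewrite ge_min lexx orbT.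
rewrite mulrCA -[leRHS]mulr1; apply: ler_wpM2l; first exact: ltW.
by rewrite ler_pdivrMr ?mul1r ?lerDl// ltr_wpDl.
Unshelve. all: by end_near. Qed.

Lemma measurable_moment l tau : measurable_fun setT (moment l tau).
Proof. by apply: continuous_rV_measurable; exact: continuous_moment. Qed.

Let mass := \int[leb]_y f y.

Let mon0 y : mon [::] y = 1. Proof. exact: big_nil. Qed.

(** On the support of f the exponent is at most [bound tau x] in absolute value, and this is affine
    in [norm1 x]. Together with [moment0_le] it gives ln (moment [::]) linear growth, hence
    tameness. *)
Lemma moment0_ge tau x : expR (- bound tau x) * mass <= moment [::] tau x.
Proof.
rewrite /mass -RintegralZl//; last exact: (cs_integrable hf).
apply: le_Rintegral => //.
- apply: integrable_scaleR; exact: (cs_integrable hf).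
- exact: (integrable_moment [::]).
move=> y _; rewrite mon0 mulr1 mulrC.
have [->|Fy] := eqVneq (f y) 0; first by rewrite !mul0r.
apply: ler_wpM2l; first exact: (cs_ge0 hf).
have := ex_le tau x (cs_support hf Fy); rewrite ler_norml => /andP[+ _].
by rewrite ler_expR.
Qed.

Lemma moment0_le tau x : moment [::] tau x <= expR (bound tau x) * mass.
Proof.
rewrite /mass -RintegralZl//; last exact: (cs_integrable hf).
apply: le_Rintegral => //.
- exact: (integrable_moment [::]).
- apply: integrable_scaleR; exact: (cs_integrable hf).
move=> y _; rewrite mon0 mulr1 [leRHS]mulrC.
have [->|Fy] := eqVneq (f y) 0; first by rewrite !mul0r.
apply: ler_wpM2l; first exact: (cs_ge0 hf).
by rewrite ler_expR; apply: le_trans (ler_norm _) (ex_le _ _ (cs_support hf Fy)).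
Qed.

Lemma moment0_gt0 tau x : 0 < moment [::] tau x.
Proof.
by apply: lt_le_trans (moment0_ge tau x); rewrite mulr_gt0 ?expR_gt0//; exact: (cs_mass hf).
Qed.

Lemma moment_le l tau x : `|moment l tau x| <= K ^+ size l * moment [::] tau x.
Proof.
apply: le_trans (le_normr_Rintegral _ (integrable_moment l tau x)) _ => //.
rewrite /moment -RintegralZl//; last exact: (integrable_moment [::]).
apply: le_Rintegral => //.
- exact: integrable_abse (integrable_moment l tau x).
- by apply: integrable_scaleR; exact: (integrable_moment [::]).
move=> y _; rewrite mon0 mulr1 !normrM [X in _ * X]ger0_norm ?expR_ge0// mulrA.
apply: ler_wpM2r; first exact: expR_ge0.
rewrite ger0_norm ?(cs_ge0 hf)// mulrC.
have [->|Fy] := eqVneq (f y) 0; first by rewrite !mulr0.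
apply: ler_wpM2r; first exact: (cs_ge0 hf).
by apply: mon_le; exact: (cs_support hf).
Qed.

(* The mean of the monomial y_l under the probability with density proportional to
   f(y) exp(tau (<x, y> - |y|^2/2)); the x-derivatives of ln (moment [::]) are
   cumulants of this probability. *)
Definition tilt l tau x := moment l tau x / moment [::] tau x.

Let moment0_neq0 tau x : moment [::] tau x != 0. Proof. by rewrite gt_eqF ?moment0_gt0. Qed.

Lemma tilt_le l tau x : `|tilt l tau x| <= K ^+ size l.
Proof.
rewrite /tilt normrM normfV (ger0_norm (ltW (moment0_gt0 _ _))).
by rewrite ler_pdivrMr ?moment0_gt0// moment_le.
Qed.

Lemma measurable_tilt l tau : measurable_fun setT (tilt l tau).
Proof.
apply: continuous_rV_measurable => x.
apply: (@cvgM _ _ (nbhs x) (nbhs_filter x) (moment l tau) (fun x => (moment [::] tau x)^-1)).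
  exact: continuous_moment.
apply: (@cvgV _ _ (nbhs x) (nbhs_filter x) (moment [::] tau)) => //.
exact: continuous_moment.
Qed.

(** The derivative of a mean under an exponential tilt is a covariance, here that of the monomial
    and y_i. *)
Lemma partial_tilt i l tau : partial i (tilt l tau)
  (fun x => tau * (tilt (i :: l) tau x - tilt l tau x * tilt [:: i] tau x)).
Proof.
apply: partial_ext (partialM (partial_moment i l tau)
  (partialV (moment0_neq0 tau) (partial_moment i [::] tau))) => // x.
by rewrite /tilt; have := moment0_neq0 tau x; set m := moment [::] tau x => m0; field.
Qed.

(** Again a covariance, now with <x, y> - |y|^2/2, the tau-derivative of the exponent. *)
Lemma derive_tilt l (tau : R) x : is_derive tau (1 : R) (fun tau => tilt l tau x)
  (\sum_i (x ord0 i * (tilt (i :: l) tau x - tilt l tau x * tilt [:: i] tau x)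
    - 2^-1 * (tilt (i :: i :: l) tau x - tilt l tau x * tilt [:: i; i] tau x))).
Proof.
apply: is_deriveR_eq (is_deriveR_mul (derive_moment l tau x)
  (is_deriveR_inv (moment0_neq0 tau x) (derive_moment [::] tau x))) => //.
rewrite mulr_suml mulrA mulrN mulNr mulr_sumr mulr_suml -sumrB; apply: eq_bigr => i _.
by rewrite /tilt; have := moment0_neq0 tau x; set m := moment [::] tau x => m0; field.
Qed.

End tilted_moments.

Section heat_log_reversal.
Context (R : realType) (n : nat) (a b : R).
Local Notation V := 'rV[R]_n.

Let rev_itv s : 1 - b < s < 1 - a -> a < 1 - s < b.
Proof. by move=> /andP[h1 h2]; apply/andP; split; lra. Qed.

Lemma tame_rev (F : R -> V -> R) : tame a b F ->
  tame (1 - b) (1 - a) (fun s => F (1 - s)).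
Proof.
move=> [mF tF]; split=> [s sab|e e0]; first by apply: mF; exact: rev_itv.
by have [C C0 FC] := tF e e0; exists C => // s x sab; exact/FC/rev_itv.
Qed.

Let derive_rev (G : R -> R) (s d : R) : is_derive (1 - s) 1 G d ->
  is_derive s 1 (fun s => G (1 - s)) (- d).
Proof.
move=> dG; apply: is_deriveR_eq (is_deriveR_chain (g := fun s => 1 - s) dG
  (is_deriveR_sub (is_deriveR_const s 1) (is_deriveR_id s))) => //.
by rewrite sub0r mulrN1.
Qed.

(** Turns the forward equation of ln (T_s g) into the backward one of ln (T_(1-s) g). *)
Lemma heat_log_rev kappa phi p1 p2 p3 : heat_log a b kappa phi p1 p2 p3 ->
  @heat_log R n (1 - b) (1 - a) (- kappa) (fun s => phi (1 - s)) (fun i s => p1 i (1 - s))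
    (fun i j s => p2 i j (1 - s)) (fun i j s => p3 i j (1 - s)).
Proof.
case=> t0 t1 t2 t3 d1 d2 d3 e0 e1; split.
- exact: tame_rev.
- by move=> i; exact: tame_rev.
- by move=> i j; exact: tame_rev.
- by move=> i j; exact: tame_rev.
- by move=> i s /rev_itv; exact: d1.
- by move=> i j s /rev_itv; exact: d2.
- by move=> i j s /rev_itv; exact: d3.
- by move=> s x /rev_itv sab; rewrite !mulNr; exact: derive_rev (e0 _ x sab).
- by move=> j s x /rev_itv sab; rewrite !mulNr; exact: derive_rev (e1 j _ x sab).
Qed.

End heat_log_reversal.

(** * The logarithm of the heat flow and its derivatives *)

Section log_potential.
Context (R : realType) (n : nat).
Local Notation V := 'rV[R]_n.
Local Notation leb := (lebesgue_rV R n).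
Context (K : R) (K0 : 0 <= K) (f : V -> R) (hf : compact_source K f).

(* ln (T_s f): expanding |x - y|^2 in the heat kernel, exp(- |x|^2/2s) factors out
   and the zeroth moment at tau = 1/s remains. *)
Definition logpot (s : R) (x : V) : R :=
  - (n%:R / 2) * ln (2 * pi * s) - sqr_norm2 x / (2 * s) + ln (moment f [::] s^-1 x).

Let T l s x := tilt f l s^-1 x.
(** Under the law of y tilted at tau = 1/s, [g1] is (mean - x)/s, [g2] is covariance/s^2 -
    identity/s and [g3 i j] is the joint cumulant of y_i, y_i, y_j divided by s^3. *)
Let g1 i s x : R := s^-1 * (T [:: i] s x - x ord0 i).
Let g2 i j s x : R :=
  s^-1 * (s^-1 * (T [:: i; j] s x - T [:: j] s x * T [:: i] s x) - (i == j)%:R).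
Let g3 i j s x : R := s^-1 * (s^-1 *
  (s^-1 * (T [:: i; i; j] s x - T [:: i; j] s x * T [:: i] s x) -
   (s^-1 * (T [:: i; j] s x - T [:: j] s x * T [:: i] s x) * T [:: i] s x
    + T [:: j] s x * (s^-1 * (T [:: i; i] s x - T [:: i] s x * T [:: i] s x))))).

Lemma heat_logpot (t : R) (x : V) : 0 < t ->
  heat t (EFin \o f) x = (expR (logpot t x))%:E.
Proof.
move=> t0; rewrite /heat gt_eqF//.
have p0 : 0 < 2 * pi * t by rewrite !mulr_gt0 ?pi_gt0.
pose c := expR (- (n%:R / 2) * ln (2 * pi * t) - sqr_norm2 x / (2 * t)).
have I0 := integrable_moment K0 hf [::] t^-1 x.
transitivity (\int[leb]_y (c%:E * (f y * 1 * expR (t^-1 * (dot x y - sqr_norm2 y / 2)))%:E))%E.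
  apply: eq_integral => y _; rewrite /= -!EFinM; congr EFin.
  rewrite /heat_kernel /powR gt_eqF// -expRN.
  rewrite -expRD mulr1 mulrCA /c -expRD; congr (_ * expR _).
  have -> : sqr_norm2 (x - y) = sqr_norm2 x - 2 * dot x y + sqr_norm2 y.
    rewrite /sqr_norm2 /dot mulr_sumr -sumrB -big_split; apply: eq_bigr => i _ /=.
    by rewrite !mxE; ring.
  by field; rewrite gt_eqF.
have I1 : leb.-integrable setT (EFin \o (fun y => f y * 1 * expR (t^-1 * (dot x y - sqr_norm2 y / 2)))).
  rewrite (_ : _ \o _ = EFin \o (fun y => f y * (\prod_(i <- [::]) y ord0 i) * expR (t^-1 * (dot x y - sqr_norm2 y / 2)))) //.
  by apply/funext => y /=; rewrite big_nil.
rewrite integralZl// /logpot expRD lnK; last by rewrite posrE (moment0_gt0 K0 hf).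
rewrite -/c EFinM; congr (_ * _)%E.
rewrite /moment /Rintegral fineK.
  by apply: eq_integral => y _; rewrite big_nil.
exact: integrable_fin_num.
Qed.

(** * Growth of the logarithmic potential at times bounded away from 0 *)

Section tameness.
Context (a b : R) (a0 : 0 < a).

Let s0 s : a < s < b -> 0 < s. Proof. by move=> /andP[/(lt_trans a0)]. Qed.

Let tame_inv : tame a b (fun s (_ : V) => s^-1).
Proof.
apply: (@tame_bounded _ _ _ _ _ a^-1) => // s x sab.
rewrite ger0_norm ?invr_ge0 ?(ltW (s0 sab))// lef_pV2 ?posrE ?(s0 sab)//.
by case/andP: sab => /ltW.
Qed.

Let tame_tilt l : tame a b (T l).
Proof.
apply: (@tame_bounded _ _ _ _ _ (K ^+ size l)) => s *.
  exact: (measurable_tilt K0 hf).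
exact: (tilt_le K0 hf).
Qed.

Let tame_norm (F : R -> V -> R) : tame a b F -> tame a b (fun s x => `|F s x|).
Proof.
move=> [mF tF]; split=> [s sab|e e0].
  by apply: measurableT_comp => //; exact: mF.
by have [C C0 FC] := tF e e0; exists C => // s x; rewrite normr_id; exact: FC.
Qed.

Let tame_norm1 : tame a b (fun _ => @norm1 R n).
Proof. by apply: tame_sum => i; apply: tame_norm; exact: tame_coord. Qed.

Let tame_sqr_norm2 : tame a b (fun _ => @sqr_norm2 R n).
Proof. by apply: tame_sum => i; apply: tameX; exact: tame_coord. Qed.

Let ln_bound s : a < s < b -> `|ln (2 * pi * s)| <= `|ln (2 * pi * a)| + `|ln (2 * pi * b)|.
Proof.
move=> sab; have sp := s0 sab; move: (sab) => /andP[sa sb].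
have pp : 0 < 2 * pi :> R by rewrite mulr_gt0 ?pi_gt0.
have lnle (u v : R) : 0 < u -> u <= v -> ln (2 * pi * u) <= ln (2 * pi * v).
  move=> u0 uv; have v0 := lt_le_trans u0 uv.
  have p1 : 2 * pi * u \is Num.pos by rewrite posrE mulr_gt0.
  have p2 : 2 * pi * v \is Num.pos by rewrite posrE mulr_gt0.
  by rewrite ler_ln// ler_pM2l.
have h1 := lnle _ _ a0 (ltW sa); have h2 := lnle _ _ sp (ltW sb).
have := ler_norm (- ln (2 * pi * a)); have := ler_norm (ln (2 * pi * b)).
have := normr_ge0 (ln (2 * pi * a)); have := normr_ge0 (ln (2 * pi * b)).
by rewrite normrN ler_norml => *; apply/andP; split; lra.
Qed.

Let mass := \int[leb]_y f y.
Let mass0 : 0 < mass := cs_mass hf.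
Let bound (s : R) (x : V) : R := s^-1 * (K * norm1 x + n%:R * K ^+ 2).

Let ln_moment s x : a < s < b -> `|ln (moment f [::] s^-1 x)| <= `|ln mass| + bound s x.
Proof.
move=> sab; have sp := s0 sab.
have B0 : `|s^-1| = s^-1 by rewrite ger0_norm// invr_ge0 ltW.
have h1 := moment0_ge K0 hf s^-1 x; have h2 := moment0_le K0 hf s^-1 x.
rewrite B0 -/(bound s x) -/mass in h1 h2.
have m0 := moment0_gt0 K0 hf s^-1 x.
have l1 : - bound s x + ln mass <= ln (moment f [::] s^-1 x).
  by rewrite -[X in X + _]expRK -lnM ?posrE ?expR_gt0// ler_ln ?posrE// mulr_gt0 ?expR_gt0.
have l2 : ln (moment f [::] s^-1 x) <= bound s x + ln mass.
  by rewrite -[X in X + _]expRK -lnM ?posrE ?expR_gt0// ler_ln ?posrE// mulr_gt0 ?expR_gt0.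
have := ler_norm (ln mass); have := ler_norm (- ln mass); rewrite normrN => h3 h4.
by rewrite ler_norml; apply/andP; split; lra.
Qed.

Let tame_bound : tame a b bound.
Proof.
apply: tameM => //; apply: tameD; last exact: tame_cst.
by apply: tameM => //; exact: tame_cst.
Qed.

Let tame_ln_moment : tame a b (fun s x => ln (moment f [::] s^-1 x)).
Proof.
apply: (@tame_le _ _ _ _ _ (fun s x => `|ln mass| + bound s x)).
- by apply: tameD => //; exact: tame_cst.
- move=> s sab; apply: measurableT_comp => //; exact: (measurable_moment K0 hf).
- by move=> s x; exact: ln_moment.
Qed.

Lemma tame_logpot : tame a b logpot.
Proof.
apply: tameD => //; apply: tameB.
  apply: tameM; first exact: tame_cst.
  by apply: (@tame_bounded _ _ _ _ _ (`|ln (2 * pi * a)| + `|ln (2 * pi * b)|)) => // s x; exact: ln_bound.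
apply: tame_ext (tameM tame_sqr_norm2 (tameM (tame_cst n a b 2^-1) tame_inv)) => s x.
by rewrite invfM.
Qed.

(** Gaussian decay of the heat flow, uniform in time. Half of the exponent |x|^2/2s absorbs the
    linear growth of the log-moment, through K |x_i| <= x_i^2/4 + K^2; the other half is at least
    |x|^2/4b. *)
Lemma logpot_le : a < b -> exists2 c : R, 0 < c & exists C : R, forall s x, a < s < b ->
  logpot s x <= C - c * sqr_norm2 x.
Proof.
move=> ab; have b0 := lt_trans a0 ab.
exists (4 * b)^-1; first by rewrite invr_gt0 mulr_gt0.
exists (n%:R / 2 * (`|ln (2 * pi * a)| + `|ln (2 * pi * b)|) + (`|ln mass|
  + a^-1 * (2 * n%:R * K ^+ 2))) => s x sab.
have sp := s0 sab; move: (sab) => /andP[sa sb].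
have h1 : - (n%:R / 2) * ln (2 * pi * s) <= n%:R / 2 * (`|ln (2 * pi * a)| + `|ln (2 * pi * b)|).
  rewrite mulNr -mulrN; apply: ler_wpM2l; first by rewrite divr_ge0.
  by apply: le_trans (ler_norm _) _; rewrite normrN; exact: ln_bound.
have h2 := le_trans (ler_norm _) (ln_moment x sab).
have h3 : K * norm1 x <= sqr_norm2 x / 4 + n%:R * K ^+ 2.
  rewrite /norm1 /sqr_norm2 mulr_sumr mulr_suml -[X in X%:R * _](card_ord n) -sum1_card natr_sum.
  rewrite mulr_suml -big_split/=; apply: ler_sum => i _.
  rewrite -[x ord0 i ^+ 2]real_normK ?num_real//.
  by have := sqr_ge0 (`|x ord0 i| / 2 - K); nra.
have h4 : bound s x <= s^-1 * (sqr_norm2 x / 4) + a^-1 * (2 * n%:R * K ^+ 2).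
  apply: (@le_trans _ _ (s^-1 * (sqr_norm2 x / 4 + 2 * n%:R * K ^+ 2))).
    rewrite /bound; apply: ler_wpM2l; first by rewrite invr_ge0 ltW.
    by rewrite -mulrA mulr_natl mulr2n; lra.
  rewrite mulrDr lerD2l; apply: ler_wpM2r; first by rewrite !mulr_ge0 ?exprn_ge0.
  by rewrite lef_pV2 ?posrE// ltW.
have h5 : s^-1 * (sqr_norm2 x / 4) - sqr_norm2 x / (2 * s) <= - ((4 * b)^-1 * sqr_norm2 x).
  have -> : s^-1 * (sqr_norm2 x / 4) - sqr_norm2 x / (2 * s) = - ((4 * s)^-1 * sqr_norm2 x).
    by field; rewrite gt_eqF.
  rewrite lerN2; apply: ler_wpM2r; first exact: sqr_norm2_ge0.
  by rewrite lef_pV2 ?posrE ?mulr_gt0// ler_pM2l// ltW.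
by rewrite /logpot; lra.
Qed.

Lemma heat_log_logpot : heat_log a b 1 logpot g1 g2 g3.
Proof.
split.
- exact: tame_logpot.
- by move=> i; apply: tameM => //; apply: tameB; [exact: tame_tilt|exact: tame_coord].
- move=> i j; apply: tameM => //; apply: tameB; last exact: tame_cst.
  apply: tameM => //; apply: tameB; first exact: tame_tilt.
  by apply: tameM; exact: tame_tilt.
- move=> i j; apply: tameM => //; apply: tameM => //; apply: tameB.
    apply: tameM => //; apply: tameB; first exact: tame_tilt.
    by apply: tameM; exact: tame_tilt.
  apply: tameD; apply: tameM; try exact: tame_tilt.
    apply: tameM => //; apply: tameB; first exact: tame_tilt.
    by apply: tameM; exact: tame_tilt.
  apply: tameM => //; apply: tameB; first exact: tame_tilt.
  by apply: tameM; exact: tame_tilt.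
- move=> i s sab; have sn0 : s != 0 by rewrite gt_eqF// (s0 sab).
  have m0 := moment0_gt0 K0 hf s^-1.
  have pq : partial i (@sqr_norm2 R n) (fun x => 2 * x ord0 i).
    apply: partial_ext (partial_sum (index_enum 'I_n) predT (fun j => partialM (partial_coord i j) (partial_coord i j))) => x.
      by apply: eq_bigr => j _; rewrite expr2.
    rewrite (bigD1 i)//= big1 ?eqxx ?addr0; first by rewrite !mulr1n; ring.
    by move=> j ji; rewrite eq_sym (negPf ji) mul0r mulr0 addr0.
  have pl : partial i (fun x => ln (moment f [::] s^-1 x))
      (fun x => (moment f [::] s^-1 x)^-1 * (s^-1 * moment f [:: i] s^-1 x)).
    apply: (partial_comp (df := fun t => t^-1)) (partial_moment K0 hf i [::] s^-1) => x.
    exact: is_derive1_ln.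
  apply: partial_ext (partialD (partialB (partial_cst i (- (n%:R / 2) * ln (2 * pi * s)))
    (partialM pq (partial_cst i (2 * s)^-1))) pl) => // x.
  rewrite /g1 /T /tilt; have := m0 x; set m := moment f [::] s^-1 x => mp.
  by field; rewrite sn0 gt_eqF.
- move=> i j s sab.
  apply: partial_ext (partialM (partial_cst i s^-1) (partialB (partial_tilt K0 hf i [:: j] s^-1)
    (partial_coord i j))) => // x.
  by rewrite /g2 /T; ring.
- move=> i j s sab.
  apply: partial_ext (partialM (partial_cst i s^-1) (partialB (partialM (partial_cst i s^-1)
    (partialB (partial_tilt K0 hf i [:: i; j] s^-1) (partialM (partial_tilt K0 hf i [:: j] s^-1)
      (partial_tilt K0 hf i [:: i] s^-1)))) (partial_cst i ((i == j)%:R)))) => // x.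
  by rewrite /g3 /T; ring.
- move=> s x sab; have sp := s0 sab; have sn0 : s != 0 by rewrite gt_eqF.
  have m0 := moment0_gt0 K0 hf s^-1 x.
  have dV := is_deriveR_inv sn0 (is_deriveR_id s).
  have d1 : is_derive s 1 (fun s => ln (2 * pi * s)) s^-1.
    have pp : 0 < 2 * pi :> R by rewrite mulr_gt0 ?pi_gt0.
    have ps : 0 < 2 * pi * s by rewrite mulr_gt0.
    apply: is_deriveR_eq (is_deriveR_chain (g := fun s => 2 * pi * s) (is_derive1_ln ps)
      (is_deriveR_mul (is_deriveR_const s (2 * pi)) (is_deriveR_id s))) => //.
    by rewrite mul0r add0r mulr1 invfM mulrAC mulVf ?mul1r// gt_eqF.
  have d2 : is_derive s 1 (fun s => sqr_norm2 x / (2 * s)) (- sqr_norm2 x / (2 * s ^+ 2)).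
    have sn2 : 2 * s != 0 by rewrite mulf_neq0.
    apply: is_deriveR_eq (is_deriveR_mul (is_deriveR_const s (sqr_norm2 x))
      (is_deriveR_inv (f := fun s => 2 * s) sn2 (is_deriveR_mul (is_deriveR_const s 2) (is_deriveR_id s)))) => //.
    by field.
  have d3 : is_derive s 1 (fun s => ln (moment f [::] s^-1 x)) (- (s ^+ 2)^-1 *
     \sum_i (x ord0 i * T [:: i] s x - 2^-1 * T [:: i; i] s x)).
    have dm := is_deriveR_chain (f := fun t => moment f [::] t x) (g := fun s => s^-1) (derive_moment K0 hf [::] s^-1 x) dV.
    apply: is_deriveR_eq (is_deriveR_chain (g := fun s => moment f [::] s^-1 x) (is_derive1_ln m0) dm) => //.
    rewrite mulrA !mulr_sumr mulr_suml; apply: eq_bigr => i _; rewrite /T /tilt.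
    by move: m0; set m := moment f [::] s^-1 x => mp; field; rewrite sn0 gt_eqF.
  have := is_deriveR_add (is_deriveR_sub (is_deriveR_mul (is_deriveR_const s (- (n%:R / 2))) d1) d2) d3.
  apply: is_deriveR_eq => //.
  (* The squares of the tilted means cancel between Hessian and squared gradient; what remains is
     linear in the tilted moments, like the time derivative [d3]. *)
  have -> : \sum_i (g2 i i s x + g1 i s x ^+ 2) = (s ^+ 2)^-1 * sqr_norm2 x - n%:R * s^-1 -
     2 * (s ^+ 2)^-1 * \sum_i (x ord0 i * T [:: i] s x - 2^-1 * T [:: i; i] s x).
    rewrite -[X in X%:R * _](card_ord n) -sum1_card natr_sum !mulr_sumr mulr_suml -!sumrB.
    apply: eq_bigr => i _; rewrite /g2 /g1 eqxx mulr1n; by field.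
  by field.
- move=> j s x sab; have sp := s0 sab; have sn0 : s != 0 by rewrite gt_eqF.
  have dV := is_deriveR_inv sn0 (is_deriveR_id s).
  have dT := is_deriveR_chain (f := fun t => tilt f [:: j] t x) (g := fun s => s^-1) (derive_tilt K0 hf [:: j] s^-1 x) dV.
  have := is_deriveR_mul dV (is_deriveR_sub dT (is_deriveR_const s (x ord0 j))).
  apply: is_deriveR_eq => //.
  (* Splits off the Kronecker part of [g2], which contributes only for i = j and matches the
     derivative of the factor 1/s of [g1]; the rest is the covariance of [derive_tilt]. *)
  have -> : \sum_i (g3 i j s x + 2 * g1 i s x * g2 i j s x) =
      - 2 * (s ^+ 2)^-1 * (T [:: j] s x - x ord0 j) +
      \sum_i (g3 i j s x + 2 * g1 i s x * (s^-1 * (s^-1 * (T [:: i; j] s x - T [:: j] s x * T [:: i] s x)))).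
    have -> : T [:: j] s x - x ord0 j = \sum_i (i == j)%:R * (T [:: i] s x - x ord0 i).
      rewrite (bigD1 j)//= eqxx mul1r big1 ?addr0// => i ij.
      by rewrite (negPf ij) mul0r.
    rewrite mulr_sumr -big_split/=; apply: eq_bigr => i _.
    by rewrite /g2 /g1; field.
  rewrite mulrDr -/(T _ _ _).
  have -> : \sum_i (g3 i j s x + 2 * g1 i s x * (s^-1 * (s^-1 * (T [:: i; j] s x - T [:: j] s x * T [:: i] s x)))) =
    - 2 * (s ^+ 3)^-1 * \sum_i (x ord0 i * (T [:: i; j] s x - T [:: j] s x * T [:: i] s x) -
      2^-1 * (T [:: i; i; j] s x - T [:: j] s x * T [:: i; i] s x)).
    rewrite mulr_sumr; apply: eq_bigr => i _; rewrite /g3 /g1; by field.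
  by field.
Qed.

End tameness.
End log_potential.

(** * Relative entropy of a density *)

Section entropy_density.
Context d (T : measurableType d) (R : realType).
Local Open Scope ereal_scope.

Lemma integral_density (m1 m2 : {measure set T -> \bar R}) (k : T -> R) :
  measurable_fun setT k -> (forall x, 0 <= k x)%R ->
  (forall A, measurable A -> m1 A = \int[m2]_(x in A) (k x)%:E) ->
  forall f : T -> R, measurable_fun setT f ->
  \int[m1]_x (f x)%:E = \int[m2]_x (f x * k x)%:E.
Proof.
move=> mk k0 m12 f mf.
have mEf : measurable_fun setT (EFin \o f) by exact/measurable_EFinP.
have mEk : measurable_fun setT (EFin \o k) by exact/measurable_EFinP.
have E := ge0_integral_density mEk k0 m12.
rewrite integralE [RHS]integralE; congr (_ - _).
- rewrite E//; last exact: measurable_funepos.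
  apply: eq_integral => x _; rewrite !funeposE/= -!EFin_max -EFinM.
  by rewrite maxr_pMl// mul0r.
- rewrite E//; last exact: measurable_funeneg.
  apply: eq_integral => x _; rewrite !funenegE/= -!EFin_max -EFinM.
  by rewrite maxr_pMl// mul0r mulNr.
Qed.

Context (m : {measure set T -> \bar R}) (p : probability T R) (rho : T -> R).
Hypothesis mrho : measurable_fun setT rho.
Hypothesis rho0 : forall x, (0 <= rho x)%R.
Hypothesis prho : forall A, measurable A -> p A = \int[m]_(x in A) (rho x)%:E.
Hypothesis irho : m.-integrable setT (EFin \o (fun x => rho x * ln (rho x))%R).

Let mErho : measurable_fun setT (EFin \o rho). Proof. exact/measurable_EFinP. Qed.

Lemma density_ae_gt0 : p [set x | rho x = 0%R] = 0.
Proof.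
have mA : measurable [set x | rho x = 0%R].
  by rewrite -[X in measurable X]setTI; exact: mrho measurableT _ (measurable_set1 0%R).
rewrite prho//; under eq_integral => x; first by rewrite inE/= => ->; over.
exact: integral0.
Qed.

Lemma density_integrable_ln : p.-integrable setT (EFin \o (@ln R) \o rho).
Proof.
have ml : measurable_fun setT (fun x => ln (rho x)) by exact: measurableT_comp.
apply/integrableP; split; first exact/measurable_EFinP.
have E := ge0_integral_density mErho rho0 prho.
rewrite E//; last by apply: measurableT_comp => //; exact/measurable_EFinP.
move/integrableP : irho => [_]; apply: le_lt_trans.
rewrite le_eqVlt; apply/orP; left; apply/eqP; apply: eq_integral => x _ /=.
by rewrite -EFinM normrM ger0_norm// mulrC.
Qed.

(** With z the mass of exp(-W) m, the derivative of p with respect to the normalized reference is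
    rho exp(W) z. Its logarithm is ln rho + W + ln z, and the last two terms cancel the corrections
    of [entropy_weight], so the value does not depend on W. *)
Lemma entropy_weightE (W : {mfun T >-> R}) : admissible_weight p m W ->
  entropy_weight p m W = \int[m]_x (rho x * ln (rho x))%:E.
Proof.
move=> [W0 zoo iW].
pose w x := expR (- W x).
have mW : measurable_fun setT W by [].
have mw : measurable_fun setT w.
  by apply: measurableT_comp => //; exact: measurableT_comp.
have w0 x : (0 < w x)%R by exact: expR_gt0.
pose z := exp_weight m W setT.
(* The weight exp(-W) is positive, so null sets of the weighted measure are m-null. This gives z !=
   0 as well as absolute continuity. *)
have m0p A : measurable A -> exp_weight m W A = 0 -> p A = 0.
  move=> mA; rewrite /exp_weight => A0.
  have : \int[m]_(x in A) `|(w x)%:E| = 0.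
    by rewrite -[RHS]A0; apply: eq_integral => x _; rewrite /= ger0_norm// ltW.
  move/ae_eq_integral_abs => /(_ mA) H.
  have {}H : ae_eq m A (EFin \o w) (cst 0).
    by apply: H; apply/measurable_EFinP; exact: measurable_funTS.
  rewrite prho//.
  have -> : \int[m]_(x in A) (rho x)%:E = \int[m]_(x in A) (cst 0) x.
    apply: ae_eq_integral => //; first exact: measurable_funTS.
    apply: filterS H => x /= /[apply] => /eqP.
    by rewrite eqe gt_eqF.
  exact: integral0.
have z0 : z != 0.
  by apply/eqP => /m0p; rewrite probability_setT => /(_ measurableT)/eqP; rewrite onee_eq0.
have z_fin : z \is a fin_num by rewrite ge0_fin_numE// measure_ge0.
have [c c0 zc] : exists2 c : R, (0 < c)%R & z = c%:E.
  exists (fine z); last by rewrite fineK.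
  by rewrite fine_gt0// lt0e z0 measure_ge0.
pose Q : probability T R := mnormalize (exp_weight m W) p.
have QE A : Q A = exp_weight m W A * (c^-1)%:E.
  rewrite -[LHS]/((if (z == 0) || (z == +oo) then (fun U => p U)
    else (fun U => exp_weight m W U * (fine z)^-1%:E)) A).
  by rewrite zc eqe gt_eqF.
have Qdens A : measurable A -> Q A = \int[m]_(x in A) (w x / c)%:E.
  move=> mA; rewrite QE /exp_weight -ge0_integralZr//.
  - by apply/measurable_EFinP; exact: measurable_funTS.
  - by rewrite lee_fin invr_ge0 ltW.
have pQ : p `<< Q.
  apply/null_content_dominatesP => A mA QA0.
  have /eqP : exp_weight m W A * (c^-1)%:E = 0 by rewrite -QE; exact: QA0.
  rewrite mule_eq0 => /orP[/eqP/m0p|]; first exact.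
  by rewrite eqe invr_eq0 gt_eqF.
have mwc : measurable_fun setT (EFin \o (fun x => w x / c)%R).
  by apply/measurable_EFinP; exact: measurable_funM.
have wc0 x : 0 <= (w x / c)%:E by rewrite lee_fin divr_ge0// ltW.
pose h x := (rho x * expR (W x) * c)%R.
have mh : measurable_fun setT (EFin \o h).
  apply/measurable_EFinP; apply: measurable_funM => //; apply: measurable_funM => //.
  exact: measurableT_comp.
have h0 x : 0 <= (h x)%:E by rewrite lee_fin !mulr_ge0 ?expR_ge0// ltW.
pose D := Radon_Nikodym (charge_of_finite_measure p) Q.
have iD : Q.-integrable setT D by exact: Radon_Nikodym_integrable.
have mD : measurable_fun setT D by exact: measurable_int iD.
have Dh : ae_eq Q setT D (EFin \o h).
  apply: integral_ae_eq => // A _ mA.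
  rewrite -Radon_Nikodym_integral// [LHS]prho//.
  rewrite [RHS]integral_mkcond [LHS]integral_mkcond.
  rewrite (ge0_integral_density mwc wc0 Qdens); last 2 first.
  - by apply/(measurable_restrictT _ mA); exact: measurable_funTS.
  - by move=> x; apply: erestrict_ge0 => y _; exact: h0.
  apply: eq_integral => x _; rewrite !patchE; case: ifP => _; last by rewrite mul0e.
  rewrite /= -EFinM; congr EFin; rewrite /h /w expRN; field.
  by rewrite !gt_eqF ?expR_gt0.
have Dh' := null_dominates_ae_eq measurableT pQ Dh.
rewrite /entropy_weight /entropy_prob; case: pselect => [pQ2|//]; rewrite -/Q -/D.
have ml : measurable_fun setT (fun x => ln (rho x)) by exact: measurableT_comp.
have iWp : p.-integrable setT (EFin \o W).
  apply/integrableP; split; first exact/measurable_EFinP.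
  by under eq_integral do rewrite /= ger0_norm//.
have -> : \int[p]_x lne (D x) = \int[p]_x ((ln (rho x))%:E + (W x)%:E + (ln c)%:E).
  apply: ae_eq_integral => //.
  (* Measurability of [lne] along D: D is finite everywhere, so [lne] is the real logarithm where D
     > 0 and [-oo] elsewhere. *)
  - rewrite (_ : (fun x => _) = (fun x => if 0 < D x then (ln (fine (D x)))%:E else -oo)).
      apply: measurable_fun_ifT.
      + apply: measurable_fun_lte => //.
      + by apply/measurable_EFinP; apply: measurableT_comp => //; apply: measurableT_comp.
      + exact: measurable_cst.
    apply/funext => x; case: ifPn => [D0|]; last by rewrite -leNgt => /le0_lneNy.
    have : D x \is a fin_num by exact: Radon_Nikodym_fin_num.
    by move: D0; case: (D x) => [r| |]// r0 _; rewrite lne_EFin.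
  - apply/measurable_EFinP; apply: measurable_funD => //; exact: measurable_funD.
  (* The product rule for [ln] fails where rho = 0, which is a p-null set. *)
  - have : {ae p, forall x, rho x != 0%R}.
      exists [set x | rho x = 0%R]; split.
      + rewrite -[X in measurable X]setTI; exact: mrho measurableT _ (measurable_set1 0%R).
      + exact: density_ae_gt0.
      + by move=> x /= /negP; rewrite negbK => /eqP.
    apply: filterS2 Dh' => x + rx => /(_ I) /= Dx _; rewrite Dx.
    have r0 : (0 < rho x)%R by rewrite lt_neqAle eq_sym rx rho0.
    rewrite lne_EFin ?mulr_gt0 ?expR_gt0//.
    by rewrite /h !lnM ?posrE ?mulr_gt0 ?expR_gt0// expRK !EFinD.
rewrite integralD//; last 2 first.
- exact: integrableD density_integrable_ln iWp.
- exact: finite_measure_integrable_cst.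
rewrite integralD//; last exact: density_integrable_ln.
rewrite integral_cst//.
have -> : (ln c)%:E * p setT = (ln c)%:E by rewrite -[RHS]mule1; congr (_ * _); exact: probability_setT.
have -> : lne (exp_weight m W setT) = (ln c)%:E by rewrite -lne_EFin// -zc.
rewrite [is_left _]/=.
have IW : \int[p]_x (W x)%:E \is a fin_num by exact: integrable_fin_num.
rewrite addeAC addeK// -addeA -EFinN -EFinD subrr adde0.
rewrite (integral_density mrho rho0 prho ml).
by apply: eq_integral => x _; rewrite mulrC.
Qed.

(** Exhibiting one admissible weight excludes the dummy value of [entropy]; the weight chosen there
    may be another one, which [entropy_weightE] allows. *)
Lemma entropyE (W : T -> R) : measurable_fun setT W -> (forall x, 0 <= W x)%R ->
  \int[m]_x (expR (- W x))%:E < +oo -> \int[m]_x (W x * rho x)%:E < +oo ->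
  entropy p m = \int[m]_x (rho x * ln (rho x))%:E.
Proof.
move=> mW W0 zoo iW.
pose mWmixin := isMeasurableFun.Build _ _ _ _ _ mW.
pose W' : {mfun T >-> R} := HB.pack W mWmixin.
have aW : admissible_weight p m W'.
  split => //=.
  by rewrite (integral_density mrho rho0 prho mW).
rewrite /entropy; case: pselect => [W_ex|]; last by case; exists W'.
exact: entropy_weightE (svalP (cid W_ex)).
Qed.

End entropy_density.

(** * Estimates on t ln t *)

Section xlnx.
Context (R : realType).

(** With w = sqrt t, t ln t = 2 w (w ln w), and ln w < w together with - ln w < 1/w bound w ln w.
    The factor sqrt t gives the limit at 0 and keeps half of a Gaussian exponent. *)
Lemma abs_xlnx_le (t : R) : 0 <= t -> `|t * ln t| <= 2 * Num.sqrt t * (1 + t).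
Proof.
rewrite le_eqVlt => /predU1P[<-|t0]; first by rewrite mul0r normr0 sqrtr0 mulr0 mul0r.
pose w := Num.sqrt t; have w0 : 0 < w by rewrite sqrtr_gt0.
have tE : t = w * w by rewrite -expr2 sqr_sqrtr// ltW.
have lE : ln t = 2 * ln w by rewrite tE lnM ?posrE//; ring.
rewrite -/w lE.
have h1 : ln w < w by exact: ln_sublinear.
have h2 : - ln w < w^-1 by rewrite -lnV ?posrE//; apply: ln_sublinear; rewrite invr_gt0.
have h3 : `|w * ln w| <= 1 + t.
  have h4 : w * ln w <= t by rewrite tE ler_pM2l// ltW.
  have h5 : - (w * ln w) <= 1.
    by rewrite -mulrN -(divff (lt0r_neq0 w0)) ler_pM2l// ltW.
  by rewrite ler_norml; apply/andP; split; lra.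
rewrite {1}tE (_ : w * w * (2 * ln w) = 2 * w * (w * ln w)); last by ring.
rewrite normrM ger0_norm ?mulr_ge0 ?(ltW w0)//.
by apply: ler_wpM2l => //; rewrite mulr_ge0// ltW.
Qed.

Lemma cvg_xlnx (T : Type) (F : set_system T) (FF : Filter F) (f : T -> R) (l : R) :
  (forall x, 0 <= f x) -> f @ F --> l -> f x * ln (f x) @[x --> F] --> l * ln l.
Proof.
move=> f0 fl.
have [l0|l0] := ltP 0 l.
  apply: cvgM => //; apply: (continuous_cvg _ _ fl).
  exact: continuous_ln.
(* Vacuous: f would be eventually negative. Only l = 0, where [ln] is not continuous, needs the
   squeeze. *)
have [lneg|lz] := ltP l 0.
  have : \forall x \near F, f x < 0 by exact: (cvgr_lt l fl).
  move=> fneg; apply/cvgrPdist_le => e e0; apply: filterS fneg => x.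
  by rewrite ltNge f0.
have {l0 lz}l0 : l = 0 by apply/eqP; rewrite eq_le l0.
rewrite l0 mul0r; rewrite l0 in fl.
apply: norm_cvg0.
apply: (@squeeze_cvgr _ _ _ _ (cst 0) (fun x => 2 * Num.sqrt (f x) * (1 + f x))).
- by apply: nearW => x; rewrite normr_ge0 abs_xlnx_le.
- exact: cvg_cst.
- rewrite -[X in _ --> X](_ : 2 * Num.sqrt 0 * (1 + 0) = 0 :> R); last by rewrite sqrtr0 mulr0 mul0r.
  apply: cvgM.
    apply: cvgM; first exact: cvg_cst.
    apply: (continuous_cvg _ _ fl); exact: sqrt_continuous.
  by apply: cvgD; [exact: cvg_cst|].
Qed.

End xlnx.

Section entropy_rV.
Context (R : realType) (n : nat).
Local Notation V := 'rV[R]_n.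
Local Notation leb := (lebesgue_rV R n).

Lemma abs_xlnx_gauss (C c r : R) (x : V) : 0 <= r -> r <= C * expR (- c * sqr_norm2 x) ->
  0 < c -> 0 <= C ->
  `|r * ln r| <= 2 * Num.sqrt C * (1 + C) * expR (- (c / 2) * sqr_norm2 x).
Proof.
move=> r0 rC c0 C0; apply: le_trans (abs_xlnx_le r0) _.
set e := expR (- (c / 2) * sqr_norm2 x).
have eE : expR (- c * sqr_norm2 x) = e ^+ 2.
  by rewrite expr2 -expRD; congr expR; field.
have e0 : 0 <= e by exact: expR_ge0.
have e1 : expR (- c * sqr_norm2 x) <= 1.
  rewrite -expR0 ler_expR mulNr oppr_le0 mulr_ge0 ?sqr_norm2_ge0//; exact: ltW.
have rC1 : r <= C by apply: le_trans rC _; rewrite ler_piMr.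
have sr : Num.sqrt r <= Num.sqrt C * e.
  rewrite -[e]ger0_norm// -sqrtr_sqr -sqrtrM// -eE ler_wsqrtr//.
rewrite -[leRHS]mulrAC -mulrA -[leRHS]mulrA -mulrA ler_pM2l// mulrA.
rewrite -[leRHS]mulrA [X in _ <= X]mulrA.
by apply: ler_pM; rewrite ?sqrtr_ge0 ?addr_ge0// ?lerD2l.
Qed.

Lemma integrable_xlnx (rho : V -> R) (C c : R) : 0 < c -> 0 <= C ->
  measurable_fun setT rho -> (forall x, 0 <= rho x) ->
  (forall x, rho x <= C * expR (- c * sqr_norm2 x)) ->
  leb.-integrable setT (EFin \o (fun x => rho x * ln (rho x))).
Proof.
move=> c0 C0 mrho rho0 rhoC.
have ml : measurable_fun setT (fun x => ln (rho x)).
  exact: measurableT_comp.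
have c20 : 0 < c / 2 by rewrite divr_gt0.
apply: le_integrable (integrable_gauss_bound n (2 * Num.sqrt C * (1 + C)) c20) => //.
  by apply/measurable_EFinP; exact: measurable_funM.
move=> x _ /=; rewrite lee_fin.
exact: le_trans (abs_xlnx_gauss (rho0 x) (rhoC x) c0 C0) (ler_norm _).
Qed.

Lemma entropy_rV (p : probability V R) (rho : V -> R) (C c : R) : 0 < c -> 0 <= C ->
  measurable_fun setT rho -> (forall x, 0 <= rho x) ->
  (forall x, rho x <= C * expR (- c * sqr_norm2 x)) ->
  has_density p (EFin \o rho) ->
  entropy p leb = (\int[leb]_x (rho x * ln (rho x)))%:E.
Proof.
move=> c0 C0 mrho rho0 rhoC prho.
have irho := integrable_xlnx c0 C0 mrho rho0 rhoC.
rewrite (@entropyE _ _ _ leb p rho mrho rho0 prho irho (@sqr_norm2 R n)).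
- by rewrite /Rintegral fineK//; exact: integrable_fin_num irho.
- exact: measurable_sqr_norm2.
- exact: sqr_norm2_ge0.
- have /integrableP[_] := integrable_expR_sqr_norm2 n (ltr01 : 0 < 1 :> R).
  apply: le_lt_trans; rewrite le_eqVlt; apply/orP; left; apply/eqP.
  by apply: eq_integral => x _ /=; rewrite ger0_norm ?expR_ge0// mulN1r.
- have c20 : 0 < c / 2 by rewrite divr_gt0.
  (* The weight is W = |x|^2. Half of the exponent absorbs it, since u <= exp u at u = c |x|^2 / 2
     gives |x|^2 exp(- c |x|^2 / 2) <= 2 / c. *)
  have /integrableP[_] := integrable_gauss_bound n (2 / c * C) c20.
  apply: le_lt_trans; apply: ge0_le_integral => //.
  + by move=> x _; rewrite lee_fin mulr_ge0 ?sqr_norm2_ge0.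
  + by apply/measurable_EFinP; apply: measurable_funM => //; exact: measurable_sqr_norm2.
  + apply: measurableT_comp => //; apply/measurable_EFinP.
    apply: measurable_funM => //; apply: measurableT_comp => //.
    by apply: measurable_funM => //; exact: measurable_sqr_norm2.
  + move=> x _ /=; rewrite lee_fin; apply: le_trans (ler_norm _).
    have q0 := sqr_norm2_ge0 x.
    apply: le_trans (ler_wpM2l q0 (rhoC x)) _.
    have -> : expR (- c * sqr_norm2 x) = expR (- (c / 2) * sqr_norm2 x) * expR (- (c / 2) * sqr_norm2 x).
      by rewrite -expRD; congr expR; field.
    rewrite !mulrA ler_wpM2r ?expR_ge0// mulrAC ler_wpM2r//.
    rewrite mulNr expRN ler_pdivrMr ?expR_gt0//.
    have := expR_ge1Dx (c / 2 * sqr_norm2 x) => h.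
    rewrite -[leLHS](_ : 2 / c * (c / 2 * sqr_norm2 x) = _); last by field; rewrite gt_eqF.
    by rewrite ler_pM2l ?divr_gt0//; apply: le_trans h; rewrite lerDr.
Qed.

End entropy_rV.

(** * Continuity at the endpoints *)

Section endpoint.
Context (R : realType) (n : nat).
Local Notation V := 'rV[R]_n.
Local Notation leb := (lebesgue_rV R n).

(** Half of the exponent is kept as a factor that is small away from the diagonal; the other half is
    a heat kernel at time 2s, still of total mass 1. *)
Lemma heat_kernel_double (s : R) (x y : V) : 0 < s ->
  heat_kernel s x y = expR (- sqr_norm2 (x - y) / (4 * s)) *
    (2 `^ (n%:R / 2) * heat_kernel (2 * s) x y).
Proof.
move=> s0; rewrite /heat_kernel.
have p0 : 0 < 2 * pi * s by rewrite !mulr_gt0 ?pi_gt0.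
rewrite (_ : 2 * pi * (2 * s) = 2 * (2 * pi * s)); last by ring.
rewrite (powRM _ _ (ltW p0))//.
have : 0 < (2 * pi * s) `^ (n%:R / 2) by rewrite powR_gt0.
have : 0 < (2 : R) `^ (n%:R / 2) by rewrite powR_gt0.
set A := _ `^ _; set B := (2 * pi * s) `^ _ => A0 B0.
have -> : expR (- sqr_norm2 (x - y) / (2 * s)) =
    expR (- sqr_norm2 (x - y) / (4 * s)) * expR (- sqr_norm2 (x - y) / (2 * (2 * s))).
  by rewrite -expRD; congr expR; field; rewrite gt_eqF.
by clearbody A B; field; rewrite !gt_eqF.
Qed.

Lemma integrable_heat_kernel (s : R) (x : V) : 0 < s ->
  leb.-integrable setT (EFin \o heat_kernel s x).
Proof.
move=> s0; apply/integrableP; split.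
  by apply/measurable_EFinP; exact: measurable_heat_kernel.
under eq_integral do rewrite /= ger0_norm ?heat_kernel_ge0//.
by rewrite integral_heat_kernel// ltry.
Qed.

Lemma Rintegral_heat_kernel (s : R) (x : V) : 0 < s ->
  \int[leb]_y heat_kernel s x y = 1.
Proof. by move=> s0; rewrite /Rintegral integral_heat_kernel. Qed.

Context (K : R) (K0 : 0 <= K) (F G : V -> R).
Hypothesis hF : compact_source K F.
Hypothesis hG : compact_source K G.
Hypothesis cF : continuous F.
Context (M : R).
Hypothesis FM : forall x, F x <= M.

Let F0 := cs_ge0 hF.
Let M0 : 0 <= M. Proof. exact: le_trans (F0 0) (FM 0). Qed.

Lemma expR_logpot (s : R) (x : V) : 0 < s ->
  expR (logpot F s x) = \int[leb]_y (F y * heat_kernel s x y).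
Proof.
move=> s0; apply: EFin_inj; rewrite -(heat_logpot K0 hF)// /heat gt_eqF//.
rewrite /Rintegral fineK//.
have : heat s (EFin \o F) x \is a fin_num by rewrite (heat_logpot K0 hF).
by rewrite /heat gt_eqF.
Qed.

Let integrable_mul_kernel (s : R) (x : V) (H : V -> R) (C : R) : 0 < s ->
  measurable_fun setT H -> (forall y, `|H y| <= C) ->
  leb.-integrable setT (EFin \o (fun y => H y * heat_kernel s x y)).
Proof.
move=> s0 mH HC.
have := integrable_mul_bounded (integrable_heat_kernel x s0) mH (fun y _ => HC y).
by apply: eq_integrable => // y _ /=; rewrite mulrC.
Qed.

Let absF y : `|F y| <= M.
Proof. by rewrite ger0_norm. Qed.

Lemma heat_le_sup (s : R) (x : V) : 0 < s -> expR (logpot F s x) <= M.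
Proof.
move=> s0; rewrite expR_logpot// -[leRHS]mulr1 -(Rintegral_heat_kernel x s0).
rewrite -RintegralZl//; last exact: integrable_heat_kernel.
apply: le_Rintegral => //.
- exact: integrable_mul_kernel (cs_measurable hF) absF.
- exact/integrable_scaleR/integrable_heat_kernel.
- by move=> y _; rewrite ler_wpM2r ?heat_kernel_ge0.
Qed.

(** Near x continuity of F gives e. Outside a ball of radius d the oscillation is at most M, and
    exp(- d^2/4s) <= 4s/d^2 in [heat_kernel_double] gives a mass of order s. *)
Lemma heat_approx (x : V) (e : R) : 0 < e -> exists2 C : R, 0 <= C &
  forall s, 0 < s -> `|expR (logpot F s x) - F x| <= e + C * s.
Proof.
move=> e0.
have [d /= d0 Fd] : exists2 d : R, 0 < d & forall y, ball x d y -> `|F x - F y| <= e.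
  have := @cF x => /(@cvgrPdist_le _ _ _ (nbhs x)) /(_ _ e0).
  by move=> /nbhs_ballP [d d0 Fd]; exists d.
pose A : R := 2 `^ (n%:R / 2).
have A0 : 0 <= A by exact: powR_ge0.
exists (M * (4 / d ^+ 2 * A)).
  by rewrite !mulr_ge0// invr_ge0 exprn_ge0// ltW.
move=> s s0; have s20 : 0 < 2 * s by rewrite mulr_gt0.
have sge0 := ltW s0; have dge0 := ltW d0.
have iFk := integrable_mul_kernel x s0 (cs_measurable hF) absF.
have ik := integrable_heat_kernel x s0.
have ik2 := integrable_heat_kernel x s20.
have FxyM y : `|F y - F x| <= M.
  by rewrite ler_norml; have := FM x; have := FM y; have := F0 x; have := F0 y;
    move=> *; apply/andP; split; lra.
have mFx : measurable_fun setT (fun y => F y - F x).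
  by apply: measurable_funB => //; exact: (cs_measurable hF).
have iD := integrable_mul_kernel x s0 mFx FxyM.
have -> : expR (logpot F s x) - F x = \int[leb]_y ((F y - F x) * heat_kernel s x y).
  rewrite expR_logpot// -[F x in LHS]mulr1 -(Rintegral_heat_kernel x s0).
  rewrite -RintegralZl// -RintegralB//; last exact: integrable_scaleR.
  by apply: eq_Rintegral => y _; rewrite mulrBl.
apply: le_trans (le_normr_Rintegral _ iD) _ => //.
apply: (@le_trans _ _ (\int[leb]_y (e * heat_kernel s x y +
    M * (4 / d ^+ 2 * A) * s * heat_kernel (2 * s) x y))).
  apply: le_Rintegral => //.
  - exact: integrable_abse iD.
  - by apply: integrable_addR; exact: integrable_scaleR.
  move=> y _; rewrite normrM (ger0_norm (heat_kernel_ge0 _ _ _)).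
  have k0 := heat_kernel_ge0 s x y; have k20 := heat_kernel_ge0 (2 * s) x y.
  have [near|far] := pselect (ball x d y).
    apply: (@le_trans _ _ (e * heat_kernel s x y)).
      by rewrite ler_wpM2r// distrC; exact: Fd.
    by rewrite lerDl !mulr_ge0// ?invr_ge0 ?exprn_ge0 ?powR_ge0.
  apply: (@le_trans _ _ (M * (4 / d ^+ 2 * A) * s * heat_kernel (2 * s) x y)); last first.
    by rewrite lerDr mulr_ge0// ltW.
  (* The ball is a sup-norm ball, and the Euclidean norm dominates the sup norm. *)
  have dr : d ^+ 2 <= sqr_norm2 (x - y).
    rewrite leNgt; apply/negP => rd; apply: far; split => // i j.
    rewrite ord1 /ball/= -ltr_sqr ?nnegrE ?(ltW d0)// real_normK ?num_real//.
    apply: le_lt_trans rd; have := ler_sqr_coord (x - y) j.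
    by rewrite !mxE.
  rewrite -!mulrA; apply: ler_pM => //.
  rewrite heat_kernel_double// -/A.
  have -> : 4 * ((d ^+ 2)^-1 * (A * (s * heat_kernel (2 * s) x y))) =
    (4 * s / d ^+ 2) * (A * heat_kernel (2 * s) x y) by ring.
  apply: ler_wpM2r; first by rewrite mulr_ge0.
  have z0 : 0 < d ^+ 2 / (4 * s) by rewrite divr_gt0 ?exprn_gt0 ?mulr_gt0.
  rewrite -[leRHS]invf_div mulNr expRN lef_pV2 ?posrE ?expR_gt0//.
  apply: (@le_trans _ _ (expR (d ^+ 2 / (4 * s)))).
    by apply: le_trans (expR_ge1Dx _); rewrite lerDr.
  by rewrite ler_expR ler_wpM2r// invr_ge0 ltW// mulr_gt0.
rewrite RintegralD//; [|exact: integrable_scaleR..].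
by rewrite !RintegralZl// !Rintegral_heat_kernel// !mulr1.
Qed.

Let u (s : R) (x : V) := expR (logpot F s x).
Let v (s : R) (x : V) := expR (logpot G s x).

Lemma cvg_heat_source (w : R^nat) (x : V) : (forall k, 0 < w k) -> w @ \oo --> 0 ->
  u (w k) x @[k --> \oo] --> F x.
Proof.
move=> w0 wc; apply/cvgrPdist_le => e e0.
have e20 : 0 < e / 2 by rewrite divr_gt0.
have [C C0 HC] := heat_approx x e20.
have d0 : 0 < e / 2 / (C + 1) by rewrite divr_gt0// ltr_wpDl.
move/cvgrPdist_le : wc => /(_ _ d0); apply: filterS => k.
rewrite sub0r normrN (ger0_norm (ltW (w0 k))) => wk; rewrite distrC.
apply: le_trans (HC _ (w0 k)) _.
have : C * w k <= e / 2.
  apply: le_trans (ler_wpM2l C0 wk) _.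
  rewrite mulrA ler_pdivrMr ?ltr_wpDl// mulrC ler_wpM2l ?lerDl//.
  exact: ltW.
by lra.
Qed.

(** Continuity at time 1 follows from differentiability there: the Hamilton-Jacobi-Bellman equation
    holds on ]1/2, 2[. *)
Lemma cvg_logpot_time (w : R^nat) (x : V) : w @ \oo --> 0 ->
  v (1 - w k) x @[k --> \oo] --> v 1 x.
Proof.
move=> wc.
have h12 : 0 < 2^-1 :> R by rewrite invr_gt0.
have I1 : 2^-1 < (1 : R) < 2 by apply/andP; split; lra.
have d1 := hl_time0 (heat_log_logpot K0 hG 2 h12) x I1.
have d2 := is_deriveR_chain (f := expR) (g := fun s => logpot G s x) (is_derive_expR _) d1.
have c1 : {for 1, continuous (v ^~ x)}.
  by apply: differentiable_continuous; apply/derivable1_diffP; have [] := d2.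
apply: (continuous_cvg _ c1).
rewrite -[X in _ --> X]subr0; apply: cvgB => //; exact: cvg_cst.
Qed.

(** Dominated convergence along sequences. Near time 0 the flow of F is only bounded by M; the
    Gaussian decay comes from the flow of G, whose time 1 - s stays in ]1/4, 2[. *)
Lemma cvg_entropy_endpoint :
  \int[leb]_x (u s x * v (1 - s) x * ln (u s x * v (1 - s) x)) @[s --> 0^'+] -->
  \int[leb]_x (F x * v 1 x * ln (F x * v 1 x)).
Proof.
have h14 : 0 < 4^-1 :> R by rewrite invr_gt0.
have h142 : 4^-1 < 2 :> R by lra.
have [c c0 [C HC]] := logpot_le K0 hG h14 h142.
pose B := M * expR C.
have B0 : 0 <= B by rewrite mulr_ge0// expR_ge0.
have vB t x : 4^-1 < t < 2 -> v t x <= expR C * expR (- c * sqr_norm2 x).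
  by move=> tt; rewrite -expRD ler_expR mulNr; exact: HC.
apply/cvg_at_rightP => w [w0 wc].
have h12 : 0 < 2^-1 :> R by rewrite invr_gt0.
have [N _ HN] : \forall k \near \oo, w k < 2^-1 by exact: (cvgr_lt 0 wc).
(* Dropping the first N terms makes the domination hold for every index. *)
rewrite -(cvg_shiftn N).
pose rho k x := u (w (k + N)%N) x * v (1 - w (k + N)%N) x.
have rho0 k x : 0 <= rho k x by rewrite mulr_ge0 ?expR_ge0.
have wN k : 4^-1 < 1 - w (k + N)%N < 2.
  have := HN (k + N)%N (leq_addl _ _); have := w0 (k + N)%N => /= h1 h2.
  by apply/andP; split; lra.
have rhoB k x : rho k x <= B * expR (- c * sqr_norm2 x).
  rewrite /rho /B -mulrA; apply: ler_pM; rewrite ?expR_ge0//.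
  - by apply: heat_le_sup; exact: w0.
  - exact: vB.
have murho k : measurable_fun setT (rho k).
  apply: measurable_funM; apply: measurableT_comp => //.
  - have [mt _] := tame_logpot K0 hF (w (k + N)%N + 1) (divr_gt0 (w0 (k + N)%N) (ltr0n R 2)).
    by apply: mt; have := w0 (k + N)%N => h; apply/andP; split; lra.
  - have [mt _] := tame_logpot K0 hG 2 h14.
    by apply: mt; exact: wN.
have m1 : measurable_fun setT (fun x => F x * v 1 x).
  apply: measurable_funM; first exact: (cs_measurable hF).
  apply: measurableT_comp => //.
  have [mt _] := tame_logpot K0 hG 2 h14.
  by apply: mt; apply/andP; split; lra.
have ml (h : V -> R) : measurable_fun setT h -> measurable_fun setT (fun x => h x * ln (h x)).
  by move=> mh; apply: measurable_funM => //; exact: measurableT_comp.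
have cw : w (k + N)%N @[k --> \oo] --> 0 by rewrite (cvg_shiftn N).
have rhoc x : rho k x @[k --> \oo] --> F x * v 1 x.
  apply: cvgM.
    by apply: (@cvg_heat_source (fun k => w (k + N)%N)).
  exact: (@cvg_logpot_time (fun k => w (k + N)%N)).
have rhoBl x : F x * v 1 x <= B * expR (- c * sqr_norm2 x).
  rewrite /B -mulrA; apply: ler_pM; rewrite ?expR_ge0//.
  by apply: vB; apply/andP; split; lra.
have l0 x : 0 <= F x * v 1 x by rewrite mulr_ge0 ?expR_ge0.
have I1 := integrable_xlnx c0 B0 m1 l0 rhoBl.
apply: fine_cvg; rewrite /Rintegral fineK; last exact: integrable_fin_num I1.
have c20 : 0 < c / 2 by rewrite divr_gt0.
apply: (@dominated_cvg _ _ _ leb setT measurableT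
  (fun k x => (rho k x * ln (rho k x))%:E) (fun x => (F x * v 1 x * ln (F x * v 1 x))%:E)
  (EFin \o (fun x => 2 * Num.sqrt B * (1 + B) * expR (- (c / 2) * sqr_norm2 x)))) => //.
- by move=> k; apply/measurable_EFinP; exact: (ml _ (murho k)).
- move=> x _; apply: cvg_EFin; first exact: nearW.
  exact: (cvg_xlnx _ (fun k => rho0 k x) (rhoc x)).
- exact: integrable_gauss_bound.
- by move=> k x _; rewrite lee_fin; exact: (abs_xlnx_gauss (rho0 k x) (rhoB k x)).
Qed.

End endpoint.

(** * Marginals of the Schroedinger bridge *)

Section induced_measure.
Context d (T : measurableType d) (R : realType).
Local Open Scope ereal_scope.
Context (m : {measure set T -> \bar R}) (k : T -> \bar R)
  (mk : measurable_fun setT k) (k0 : forall x, 0 <= k x).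

Lemma induced_measure_exists : exists mu : {measure set T -> \bar R},
  forall A, mu A = \int[m]_(x in A) k x.
Proof.
pose mu (A : set T) := \int[m]_(x in A) k x.
have mu0 : mu set0 = 0 by exact: integral_set0.
have mu_ge0 A : 0 <= mu A by apply: integral_ge0 => x _; exact: k0.
have mu_sa : semi_sigma_additive mu.
  by apply: semi_sigma_additive_nng_induced => // x.
pose M := isMeasure.Build _ _ _ mu mu0 mu_ge0 mu_sa.
pose nu : {measure set T -> \bar R} := HB.pack mu M.
by exists nu.
Qed.

End induced_measure.

Section pushforward_density.
Context d d' (T : measurableType d) (T' : measurableType d') (R : realType).
Local Open Scope ereal_scope.

(** The image under phi of the measure k m has density q with respect to nu. Knowing this on sets is
    enough to insert any nonnegative function of phi. *)
Lemma ge0_integral_pushforward_density (m : {measure set T -> \bar R})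
    (nu : {measure set T' -> \bar R}) (phi : T -> T') (k : T -> \bar R) (q : T' -> \bar R) :
  measurable_fun setT phi -> measurable_fun setT k -> (forall x, 0 <= k x) ->
  measurable_fun setT q -> (forall x, 0 <= q x) ->
  (forall A, measurable A -> \int[m]_(x in phi @^-1` A) k x = \int[nu]_(y in A) q y) ->
  forall h : T' -> \bar R, measurable_fun setT h -> (forall y, 0 <= h y) ->
  \int[m]_x (h (phi x) * k x) = \int[nu]_y (h y * q y).
Proof.
move=> mphi mk k0 mq q0 kq h mh h0.
have [mu muE] := induced_measure_exists m mk k0.
pose m1 : {measure set T' -> \bar R} :=
  measure_function_pushforward__canonical__measure_function_Measure mu mphi.
have m1E A : measurable A -> m1 A = \int[nu]_(y in A) q y.
  by move=> mA; rewrite -kq// -muE.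
rewrite -(ge0_integral_density mq q0 m1E mh h0).
rewrite (ge0_integral_pushforward mphi mu measurableT mh (fun y _ => h0 y)) preimage_setT.
rewrite (ge0_integral_density mk k0 (fun A _ => muE A))//.
- exact: measurableT_comp.
- by move=> x; exact: h0.
Qed.

End pushforward_density.

(** * Self-adjointness and positivity of the heat semigroup *)

Section heat_duality.
Context (R : realType) (n : nat).
Local Notation V := 'rV[R]_n.
Local Notation leb := (lebesgue_rV R n).
Local Open Scope ereal_scope.
Implicit Types (h a b : V -> \bar R) (t : R).

Lemma heat_ge0 t h x : (forall y, 0 <= h y) -> 0 <= heat t h x.
Proof.
move=> h0; rewrite /heat; case: ifP => // _; apply: integral_ge0 => y _.
by rewrite mule_ge0// lee_fin heat_kernel_ge0.
Qed.

Let measurable_kernelM t h : measurable_fun setT h ->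
  measurable_fun setT (fun p : V * V => h p.2 * (heat_kernel t p.1 p.2)%:E).
Proof.
move=> mh; apply: emeasurable_funM; first exact: (measurableT_comp mh measurable_snd).
by apply/measurable_EFinP; exact: measurable_heat_kernel2.
Qed.

Lemma measurable_heat t h : measurable_fun setT h -> (forall y, 0 <= h y) ->
  measurable_fun setT (heat t h).
Proof.
move=> mh h0; rewrite /heat; case: eqP => // _.
have := @measurable_fun_fubini_tonelli_F _ _ _ _ _ leb _ (measurable_kernelM t mh).
by apply => p; rewrite mule_ge0// lee_fin heat_kernel_ge0.
Qed.

(** Tonelli and the symmetry of the kernel; it expresses the reversibility of Brownian motion
    started from Lebesgue measure. *)
Lemma heat_duality t a b : (0 < t)%R ->
  measurable_fun setT a -> measurable_fun setT b ->
  (forall x, 0 <= a x) -> (forall x, 0 <= b x) ->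
  \int[leb]_x (a x * heat t b x) = \int[leb]_y (b y * heat t a y).
Proof.
move=> t0 ma mb a0 b0; rewrite /heat (gt_eqF t0).
have k0 (x y : V) : 0 <= (heat_kernel t x y)%:E by rewrite lee_fin heat_kernel_ge0.
have mk (x : V) : measurable_fun setT (fun y => (heat_kernel t x y)%:E).
  by apply/measurable_EFinP; exact: measurable_heat_kernel.
have mk' (x : V) : measurable_fun setT (fun y => (heat_kernel t y x)%:E).
  by under eq_fun do rewrite heat_kernelC; exact: mk.
transitivity (\int[leb]_x \int[leb]_y (a x * (b y * (heat_kernel t x y)%:E))).
  apply: eq_integral => x _; rewrite ge0_integralZl//.
  - exact: (emeasurable_funM mb (mk x)).
  - by move=> y _; rewrite mule_ge0.
rewrite (fubini_tonelli (fun p : V * V => a p.1 * (b p.2 * (heat_kernel t p.1 p.2)%:E))); last 2 first.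
- by apply: emeasurable_funM; [exact: (measurableT_comp ma measurable_fst)|exact: measurable_kernelM].
- by move=> p; rewrite !mule_ge0.
apply: eq_integral => y _.
under [LHS]eq_integral => x _ do rewrite /= muleCA heat_kernelC.
rewrite ge0_integralZl//.
- exact: (emeasurable_funM ma (mk y)).
- by move=> x _; rewrite mule_ge0.
Qed.

(** At t = 0 the semigroup is the identity and would see null sets. *)
Lemma eq_ae_heat t a b x : t != 0%R -> measurable_fun setT a -> measurable_fun setT b ->
  ae_eq leb setT a b -> heat t a x = heat t b x.
Proof.
move=> t0 ma mb ab; rewrite /heat (negPf t0).
have mk : measurable_fun setT (fun y => (heat_kernel t x y)%:E).
  by apply/measurable_EFinP; exact: measurable_heat_kernel.
apply: ae_eq_integral => //; try exact: emeasurable_funM.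
by apply: filterS ab => y /= /[apply] ->.
Qed.

(** The kernel is positive everywhere, so vanishing at a single point suffices. *)
Lemma heat_eq0 t a x : (0 < t)%R -> measurable_fun setT a -> (forall y, 0 <= a y) ->
  heat t a x = 0 -> ae_eq leb setT a (cst 0).
Proof.
move=> t0 ma a0; rewrite /heat gt_eqF// => h.
have mk : measurable_fun setT (fun y => (heat_kernel t x y)%:E).
  by apply/measurable_EFinP; exact: measurable_heat_kernel.
have mak : measurable_fun setT (fun y => a y * (heat_kernel t x y)%:E).
  exact: emeasurable_funM.
have : \int[leb]_y `|a y * (heat_kernel t x y)%:E| = 0.
  rewrite -[RHS]h; apply: eq_integral => y _; rewrite gee0_abs//.
  by rewrite mule_ge0// lee_fin heat_kernel_ge0.
move=> /(ae_eq_integral_abs _ measurableT mak); apply: filterS => y /= /[apply] /eqP.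
rewrite mule_eq0 => /orP[/eqP//|].
by rewrite eqe gt_eqF// heat_kernel_gt0.
Qed.

End heat_duality.

Section marginal_density.
Context (R : realType) (n : nat).
Local Notation V := 'rV[R]_n.
Local Notation leb := (lebesgue_rV R n).
Local Notation ev t := (@canonical_process R n t).
Local Open Scope ereal_scope.

(* The law of (X_0, X_t, X_1) under Rm is only given on boxes; the factors f(X_0) and
   g(X_1) are inserted one after the other through the measures that the restricted
   path measure induces at times 0 and 1, and duality moves the kernels to time t. *)
Lemma fg_transform_marginal (Rm : {measure set (path_space R n) -> \bar R})
    (f g : V -> R) (Phat : probability (path_space R n) R)
    (t : time R) (mu : probability V R) :
  reversible_brownian_motion Rm ->
  measurable_fun setT f -> measurable_fun setT g ->
  (forall x, 0 <= f x)%R -> (forall x, 0 <= g x)%R ->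
  fg_transform Rm f g Phat -> marginal Phat t mu ->
  (0 < val t < 1)%R ->
  has_density mu (fun x => heat (val t) (EFin \o f) x * heat (1 - val t) (EFin \o g) x).
Proof.
move=> bm mf g_meas f0 g0 fgP muP /andP[t0 t1] A mA.
have s0 : (0 < 1 - val t)%R by rewrite subr_gt0.
pose B := ev t @^-1` A.
have mX (r : time R) : measurable_fun setT (ev r) by exact: measurable_canonical_process.
have mB : measurable B by rewrite -[B]setTI; exact: (mX _).
have mEf : measurable_fun setT (EFin \o f) by exact/measurable_EFinP.
have mEg : measurable_fun setT (EFin \o g) by exact/measurable_EFinP.
have Ef0 x : 0 <= (EFin \o f) x by rewrite lee_fin.
have Eg0 x : 0 <= (EFin \o g) x by rewrite lee_fin.
have mI (C : set V) : measurable C -> measurable_fun setT (fun x => (\1_C x)%:E : \bar R).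
  by move=> mC; apply/measurable_EFinP; exact: measurable_indic.
have I0 (C : set V) x : 0 <= (\1_C x)%:E :> \bar R by rewrite lee_fin.
pose hf := heat (val t) (EFin \o f).
have mhf : measurable_fun setT hf by exact: (measurable_heat _ mEf Ef0).
have hf0 x : 0 <= hf x by exact: (heat_ge0 _ _ Ef0).
(* The density at time 1 of the image of 1_B f(X_0) Rm, which [step1] establishes. *)
pose q := heat (1 - val t) (fun y => (\1_A y)%:E * hf y).
have mAhf : measurable_fun setT (fun y => (\1_A y)%:E * hf y).
  exact: (emeasurable_funM (mI A mA) mhf).
have Ahf0 y : 0 <= (\1_A y)%:E * hf y by apply: mule_ge0; [exact: I0|exact: hf0].
pose kB w : \bar R := (\1_B w * f (ev (time0 R) w))%:E.
have mkB : measurable_fun setT kB.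
  apply/measurable_EFinP; apply: measurable_funM; first exact: measurable_indic.
  exact: (measurableT_comp mf (mX _)).
have kB0 w : 0 <= kB w by rewrite lee_fin; exact: mulr_ge0.
have mq : measurable_fun setT q by exact: (measurable_heat _ mAhf Ahf0).
have q0 y : 0 <= q y by exact: (heat_ge0 _ _ Ahf0).
have step1 A1 : measurable A1 ->
    \int[Rm]_(w in ev (time1 R) @^-1` A1) kB w = \int[leb]_(z in A1) q z.
  move=> mA1; set D := B `&` ev (time1 R) @^-1` A1.
  have mD : measurable D.
    apply: measurableI; first exact: mB.
    by rewrite -[X in measurable X]setTI; exact: (mX _).
  (* The trailing factor 1 is the value of [cylinder_prob] on the empty list. *)
  pose h1 := heat (1 - val t) (fun y => (\1_A1 y)%:E * 1).
  have mA11 : measurable_fun setT (fun y : V => (\1_A1 y)%:E * 1 : \bar R).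
    by under eq_fun do rewrite mule1; exact: mI.
  have A110 (y : V) : 0 <= (\1_A1 y)%:E * 1 :> \bar R by rewrite mule1; exact: I0.
  have mh1 : measurable_fun setT h1 by exact: (measurable_heat _ mA11 A110).
  have h10 y : 0 <= h1 y by exact: (heat_ge0 _ _ A110).
  have mAh : measurable_fun setT (fun y => (\1_A y)%:E * h1 y).
    exact: (emeasurable_funM (mI A mA) mh1).
  have Ah0 y : 0 <= (\1_A y)%:E * h1 y by apply: mule_ge0; [exact: I0|exact: h10].
  pose k := heat (val t) (fun y => (\1_A y)%:E * h1 y).
  have mk : measurable_fun setT k by exact: (measurable_heat (val t) mAh Ah0).
  have k0 y : 0 <= k y by exact: (heat_ge0 _ _ Ah0).
  pose kD w : \bar R := (\1_D w)%:E.
  have mkD : measurable_fun setT kD.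
    by apply/measurable_EFinP; exact: measurable_indic.
  have kD0 w : 0 <= kD w by rewrite lee_fin.
  have mp (p : time R * set V) : p \in [:: (t, A); (time1 R, A1)] -> measurable p.2.
    by rewrite !inE => /orP[/eqP->|/eqP->].
  have hs : sorted <=%R [seq val p.1 | p <- [:: (t, A); (time1 R, A1)]].
    by rewrite /= andbT ltW.
  have kDE A0 : measurable A0 ->
      \int[Rm]_(w in ev (time0 R) @^-1` A0) kD w = \int[leb]_(x in A0) k x.
    move=> mA0.
    have mA0' : measurable (ev (time0 R) @^-1` A0).
      by rewrite -[X in measurable X]setTI; exact: (mX _).
    rewrite (integral_indic Rm mA0' mD) setIC.
    have -> : ev (time0 R) @^-1` A0 `&` D =
        ev (time0 R) @^-1` A0 `&` cylinder [:: (t, A); (time1 R, A1)].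
      by rewrite /D /B /= setIT.
    rewrite (bm A0 [:: (t, A); (time1 R, A1)] mA0 mp hs).
    by apply: eq_integral => x _; rewrite /= subr0.
  (* On boxes, 1_D Rm has density k at time 0. The factor f(X_0) is inserted there, then duality
     moves T_t onto f and T_(1-t) onto 1_A T_t f. *)
  transitivity (\int[Rm]_w ((f (ev (time0 R) w))%:E * kD w)).
    rewrite integral_mkcond; apply: eq_integral => w _; rewrite epatch_indic.
    rewrite /kB /kD -!EFinM; congr EFin; rewrite /D indicI /= !indicE.
    have -> : (w \in ev (time1 R) @^-1` A1) = (ev (time1 R) w \in A1).
      by apply/idP/idP; rewrite !inE.
    ring.
  rewrite (ge0_integral_pushforward_density (mX _) mkD kD0 mk k0 kDE mEf Ef0).
  rewrite (heat_duality t0 mEf mAh Ef0 Ah0).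
  transitivity (\int[leb]_y ((\1_A y)%:E * hf y * h1 y)).
    by apply: eq_integral => y _; exact: muleAC.
  rewrite (heat_duality s0 mAhf mA11 Ahf0 A110).
  rewrite [RHS]integral_mkcond; apply: eq_integral => z _.
  by rewrite mule1 epatch_indic muleC.
rewrite -(muP A mA) -[LHS]/(Phat B) (fgP B mB) [LHS]integral_mkcond.
(* The factor g(X_1) is inserted at time 1, and a last duality brings T_(1-t) onto g. *)
transitivity (\int[Rm]_w ((g (ev (time1 R) w))%:E * kB w)).
  by apply: eq_integral => w _; rewrite epatch_indic /kB -!EFinM; congr EFin; ring.
rewrite (ge0_integral_pushforward_density (mX _) mkB kB0 mq q0 step1 mEg Eg0).
rewrite (heat_duality s0 mEg mAhf Eg0 Ahf0) [RHS]integral_mkcond.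
apply: eq_integral => x _; rewrite epatch_indic [RHS]muleC; exact/esym/muleA.
Qed.

End marginal_density.

(** * Regularity of the Schroedinger factors *)

Section compact_support.
Context (R : realType) (n : nat).
Local Notation V := 'rV[R]_n.
Local Notation leb := (lebesgue_rV R n).

Lemma ler_coord_norm (x : V) i : `|x ord0 i| <= `|x|.
Proof.
rewrite [leRHS]mx_normrE.
exact: (le_bigmax _ (fun ij : 'I_1 * 'I_n => `|x ij.1 ij.2|) (ord0, i)).
Qed.

Lemma compactly_supported_box (rho : V -> R) : compactly_supported rho ->
  exists2 K : R, 0 <= K & forall y, rho y != 0 -> forall i, `|y ord0 i| <= K.
Proof.
move=> /compact_bounded[M [Mr HM]].
exists (`|M| + 1); first by rewrite addr_ge0.
move=> y ry i; apply: le_trans (ler_coord_norm y i) _.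
apply: (HM (`|M| + 1)); last exact: subset_closure.
by apply: le_lt_trans (ler_norm _) _; rewrite ltrDl.
Qed.

Lemma compactly_supported_bounded (rho F : V -> R) : compactly_supported rho ->
  continuous F -> (forall y, F y != 0 -> rho y != 0) -> exists M : R, forall y, F y <= M.
Proof.
move=> crho cF Frho.
have cK : compact (F @` closure [set x | rho x != 0]).
  apply: continuous_compact => //; exact: continuous_subspaceT.
have [M [Mr HM]] := compact_bounded cK.
exists (`|M| + 1) => y; have [->|Fy] := eqVneq (F y) 0; first by rewrite addr_ge0.
apply: le_trans (ler_norm _) _; apply: (HM (`|M| + 1)).
  by apply: le_lt_trans (ler_norm _) _; rewrite ltrDl.
by exists y => //; apply: subset_closure; exact: Frho.
Qed.

Lemma density_ae_unique (mu : probability V R) (h : V -> \bar R) (rho : V -> R) :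
  measurable_fun setT h -> (forall x, 0 <= h x)%E -> measurable_fun setT rho ->
  has_density mu h -> has_density mu (EFin \o rho) ->
  {ae leb, forall x, h x = (rho x)%:E}.
Proof.
move=> mh h0 mrho muh murho.
have ih : leb.-integrable setT h.
  apply/integrableP; split => //.
  under eq_integral do rewrite gee0_abs//.
  by rewrite -(muh setT measurableT) [X in (X < _)%E](_ : _ = 1%E) ?ltry//; exact: probability_setT.
have mEr : measurable_fun setT (EFin \o rho) by exact/measurable_EFinP.
have := integral_ae_eq measurableT ih mEr (fun E _ mE => etrans (esym (muh E mE)) (murho E mE)).
by apply: filterS => x; exact.
Qed.

(** Otherwise mu would have mass 0 instead of 1. *)
Lemma density_not_ae0 (mu : probability V R) (f h : V -> \bar R) :
  measurable_fun setT f -> measurable_fun setT h ->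
  has_density mu (fun x => f x * h x)%E -> ~ {ae leb, forall x, f x = 0%E}.
Proof.
move=> mf mh muf f0.
have := muf setT measurableT.
rewrite [LHS](_ : _ = 1%E); last exact: probability_setT.
rewrite (ae_eq_integral (cst 0%E))//; last first.
- by apply: filterS f0 => x + _ => ->; rewrite mul0e.
- exact: emeasurable_funM.
by rewrite integral0 => /eqP; rewrite onee_eq0.
Qed.

Lemma ae_exists (P : V -> Prop) (f : V -> \bar R) :
  {ae leb, forall x, P x} -> ~ {ae leb, forall x, f x = 0%E} -> exists x, P x /\ f x != 0%E.
Proof.
move=> aeP f0; apply: contrapT => H; apply: f0; apply: filterS aeP => x Px.
by apply/eqP/negPn/negP => fx; apply: H; exists x.
Qed.

Lemma heat_gt0 (t : R) (g : V -> \bar R) (x : V) : 0 < t -> measurable_fun setT g ->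
  (forall y, 0 <= g y)%E -> ~ {ae leb, forall x, g x = 0%E} -> (0 < heat t g x)%E.
Proof.
move=> t0 mg g0 gn0; rewrite lt0e heat_ge0// andbT; apply/eqP => h.
by apply: gn0; apply: filterS (heat_eq0 t0 mg g0 h) => y; exact.
Qed.

Let box (K : R) : set V := [set y | forall i, `|y ord0 i| <= K].

Let measurable_box K : measurable (box K).
Proof.
rewrite (_ : box K = \big[setI/setT]_(i < n)
   ((fun v : V => v ord0 i : measurableTypeR R) @^-1` [set a | a \in `[- K, K]])); last first.
  rewrite -bigcap_seq; apply/seteqP; split => [v vb i _|v vb i] /=.
    by rewrite in_itv/= -ler_norml; exact: vb.
  by have := vb i; rewrite /= mem_index_enum in_itv/= -ler_norml; exact.
apply: bigsetI_measurable => i _.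
rewrite -[X in measurable X]setTI; exact: measurable_rV_coord.
Qed.

(** Multiplying by the indicator of the box makes the support condition hold everywhere.
    Integrability comes from finiteness of T_1 g at the single point x, as the kernel is bounded
    below on the box. *)
Lemma truncated_source (K : R) (g : V -> R) (x : V) : 0 <= K ->
  measurable_fun setT g -> (forall y, 0 <= g y) ->
  {ae leb, forall y, g y != 0 -> forall i, `|y ord0 i| <= K} ->
  ~ {ae leb, forall y, (g y)%:E = 0%E} ->
  (heat 1 (EFin \o g) x < +oo)%E ->
  exists2 g' : V -> R, compact_source K g' & {ae leb, forall y, g y = g' y}.
Proof.
move=> K0 mg g0 gbox gn0 hx.
pose g' y := g y * \1_(box K) y.
have gg' : {ae leb, forall y, g y = g' y}.
  apply: filterS gbox => y yb; rewrite /g' indicE.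
  have [->|gy] := eqVneq (g y) 0; first by rewrite mul0r.
  by rewrite mem_set ?mulr1//; exact: yb.
have mg' : measurable_fun setT g' by apply: measurable_funM => //; exact: measurable_indic.
have g'0 y : 0 <= g' y by rewrite mulr_ge0.
exists g' => //.
have ig' : leb.-integrable setT (EFin \o g').
  apply/integrableP; split; first exact/measurable_EFinP.
  (* A lower bound of the kernel at time 1 on the box, from |x - y|^2 <= 2 |x|^2 + 2 |y|^2 and |y|^2
     <= n K^2. *)
  pose c := expR (- (2 * sqr_norm2 x + 2 * (n%:R * K ^+ 2)) / (2 * 1)) / (2 * pi * 1) `^ (n%:R / 2).
  have c0 : 0 < c by rewrite divr_gt0 ?expR_gt0// powR_gt0// !mulr_gt0 ?pi_gt0.
  have kc y : box K y -> c <= heat_kernel 1 x y.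
    move=> yb; rewrite /c /heat_kernel ler_pM2r ?invr_gt0 ?powR_gt0 ?mulr_gt0 ?pi_gt0//.
    rewrite ler_expR mulr1 ler_pM2r ?invr_gt0// lerN2.
    have -> : n%:R * K ^+ 2 = \sum_(i < n) K ^+ 2 by rewrite sumr_const card_ord mulr_natl.
    rewrite !mulr_sumr -big_split/=; apply: ler_sum => i _; rewrite !mxE.
    have : y ord0 i ^+ 2 <= K ^+ 2.
      by rewrite -real_normK ?num_real// lerXn2r ?nnegrE//; exact: yb.
    by have := sqr_ge0 (x ord0 i + y ord0 i); rewrite sqrrD sqrrB; lra.
  have mk : measurable_fun setT (fun y => (g y)%:E * (heat_kernel 1 x y)%:E)%E.
    apply: emeasurable_funM; apply/measurable_EFinP => //; exact: measurable_heat_kernel.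
  have gk0 y : (0 <= (g y)%:E * (heat_kernel 1 x y)%:E)%E.
    by rewrite mule_ge0// lee_fin// heat_kernel_ge0.
  apply: (@le_lt_trans _ _ ((c^-1)%:E * heat 1 (EFin \o g) x)%E).
    rewrite /heat oner_eq0 -ge0_integralZl//; [|by move=> y _; exact: gk0|by rewrite lee_fin invr_ge0 ltW].
    apply: ge0_le_integral => //.
    - by apply: measurableT_comp => //; exact/measurable_EFinP.
    - exact: measurable_funeM.
    move=> y _; rewrite /= ger0_norm// -!EFinM lee_fin /g' indicE.
    case: (boolP (y \in box K)) => [|_]; last first.
      by rewrite mulr0 mulr_ge0 ?invr_ge0 ?(ltW c0)// mulr_ge0 ?heat_kernel_ge0.
    rewrite inE => /kc ky; rewrite mulr1 mulrC -mulrA ler_peMr//.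
    by rewrite ler_pdivlMr// mul1r.
  by rewrite lte_mul_pinfty// lee_fin invr_ge0 ltW.
split => //.
- move=> y; rewrite /g' indicE; have [yb _|] := boolP (y \in box K); last by rewrite mulr0 eqxx.
  by move: yb; rewrite inE.
- rewrite lt_neqAle Rintegral_ge0// andbT; apply/eqP => H.
  apply: gn0; have E : (\int[leb]_y `|(EFin \o g') y| = 0)%E.
    rewrite (eq_integral (EFin \o g')); last by move=> y _ /=; rewrite ger0_norm.
    by rewrite -[LHS]fineK ?integrable_fin_num// -[fine _]/(\int[leb]_y g' y) -H.
  have := (ae_eq_integral_abs leb measurableT (measurable_int _ ig')).1 E.
  move=> H0; apply: filterS2 gg' H0 => y -> /(_ I) /=; exact.
Qed.

End compact_support.

Section regularization.
Context (R : realType) (n : nat).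
Local Notation V := 'rV[R]_n.
Local Notation leb := (lebesgue_rV R n).

Lemma continuous_sqr_norm2 : continuous (@sqr_norm2 R n).
Proof.
move=> x.
suff H (r : seq 'I_n) : (fun y : V => \sum_(i <- r) y ord0 i ^+ 2) y @[y --> x] -->
  \sum_(i <- r) x ord0 i ^+ 2 by exact: H.
elim: r => [|i r IH].
  rewrite big_nil (_ : (fun _ => _) = fun=> 0).
    exact: (@cvg_cst _ _ _ (nbhs x) (nbhs_filter x)).
  by apply/funext => y; rewrite big_nil.
rewrite big_cons (_ : (fun _ => _) = fun y : V => y ord0 i ^+ 2 + \sum_(j <- r) y ord0 j ^+ 2).
  apply: (@cvgD _ _ _ (nbhs x) (nbhs_filter x)) => //.
  by apply: (@cvgM _ _ (nbhs x) (nbhs_filter x)); exact: coord_continuous.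
by apply/funext => y; rewrite big_cons.
Qed.

Lemma continuous_expR_logpot (K : R) (g : V -> R) : 0 <= K -> compact_source K g ->
  continuous (fun x => expR (logpot g 1 x)).
Proof.
move=> K0 hg x.
have cl : ln (moment g [::] 1^-1 y) @[y --> x] --> ln (moment g [::] 1^-1 x).
  have cm := @continuous_moment _ _ _ K0 _ hg [::] 1^-1 x.
  exact: (continuous_cvg _ (continuous_ln (moment0_gt0 K0 hg _ _)) cm).
have cp : logpot g 1 y @[y --> x] --> logpot g 1 x.
  apply: (@cvgD _ _ _ (nbhs x) (nbhs_filter x)) cl.
  apply: (@cvgB _ _ _ (nbhs x) (nbhs_filter x)).
    exact: (@cvg_cst _ _ _ (nbhs x) (nbhs_filter x)).
  apply: (@cvgM _ _ (nbhs x) (nbhs_filter x)); last exact: (@cvg_cst _ _ _ (nbhs x) (nbhs_filter x)).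
  exact: continuous_sqr_norm2.
exact: (continuous_cvg _ (@continuous_expR _ _) cp).
Qed.

(* Replaces the integrable factor f' by a continuous version, read off from
   the equation f T_1 g = rho of the Schroedinger system. *)
Lemma continuous_source (K : R) (f' g' rho : V -> R) : 0 <= K ->
  compact_source K f' -> compact_source K g' ->
  continuous rho -> compactly_supported rho ->
  (forall y, rho y != 0 -> forall i, `|y ord0 i| <= K) ->
  {ae leb, forall x, f' x * expR (logpot g' 1 x) = rho x} ->
  exists F : V -> R, [/\ compact_source K F, continuous F,
    exists M, forall x, F x <= M & {ae leb, forall x, f' x = F x}].
Proof.
move=> K0 hf hg crho srho rhoK E.
(* The positive part of rho: F has to be nonnegative everywhere, while the equation gives rho >= 0
   only almost everywhere. *)
pose F x := (rho x + `|rho x|) / 2 / expR (logpot g' 1 x).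
have cF : continuous F.
  move=> x; apply: (@cvgM _ _ (nbhs x) (nbhs_filter x)).
    apply: (@cvgM _ _ (nbhs x) (nbhs_filter x)).
      apply: (@cvgD _ _ _ (nbhs x) (nbhs_filter x)); first exact: crho.
      apply: (@cvg_norm _ _ _ (nbhs x) (nbhs_filter x)); exact: crho.
    exact: (@cvg_cst _ _ _ (nbhs x) (nbhs_filter x)).
  apply: (@cvgV _ _ (nbhs x) (nbhs_filter x)); first by rewrite gt_eqF ?expR_gt0.
  exact: (continuous_expR_logpot K0 hg).
have fF : {ae leb, forall x, f' x = F x}.
  apply: filterS E => x Ex; rewrite /F -Ex ger0_norm; last by rewrite mulr_ge0 ?expR_ge0 ?(cs_ge0 hf).
  have := expR_gt0 (logpot g' 1 x); set e := expR _; move: e => e e0.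
  by field; rewrite gt_eqF.
have Frho y : F y != 0 -> rho y != 0.
  by apply: contra_neq => r0; rewrite /F r0 normr0 addr0 !mul0r.
have mF : measurable_fun setT F by exact: continuous_rV_measurable.
have mEF : measurable_fun setT (EFin \o F) by exact/measurable_EFinP.
have mEf : measurable_fun setT (EFin \o f') by apply/measurable_EFinP; exact: (cs_measurable hf).
have aeE : ae_eq leb setT (EFin \o f') (EFin \o F) by apply: filterS fF => x + _ /= => ->.
have iF : leb.-integrable setT (EFin \o F).
  have /integrableP[_] := cs_integrable hf; move=> foo.
  apply/integrableP; split => //.
  rewrite (ae_eq_integral (fun x => `|(EFin \o f') x|%E)) => //.
  - exact: measurableT_comp.
  - exact: measurableT_comp.
  - by apply: filterS fF => x fx _ /=; rewrite fx.
exists F; split => //; last exact: compactly_supported_bounded srho cF Frho.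
split => //.
- move=> y; rewrite !divr_ge0 ?expR_ge0//.
  by rewrite addrC -lerBlDr sub0r; apply: le_trans (ler_norm _) _; rewrite normrN.
- by move=> y /Frho; exact: rhoK.
- by rewrite /Rintegral -(ae_eq_integral _ _ _ _ _ aeE)//; exact: (cs_mass hf).
Qed.

(** Since h > 0, almost everywhere f vanishes wherever the density f h = rho does. *)
Lemma density_support (mu : probability V R) (f : V -> R) (h : V -> \bar R) (rho : V -> R)
    (K : R) :
  measurable_fun setT f -> (forall x, 0 <= f x) ->
  measurable_fun setT h -> (forall x, 0 < h x)%E -> measurable_fun setT rho ->
  (forall y, rho y != 0 -> forall i, `|y ord0 i| <= K) ->
  has_density mu (fun x => (f x)%:E * h x)%E -> has_density mu (EFin \o rho) ->
  {ae leb, forall y, f y != 0 -> forall i, `|y ord0 i| <= K}.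
Proof.
move=> mf f0 mh h0 mrho rhoK muf murho.
have mfh : measurable_fun setT (fun x => (f x)%:E * h x)%E.
  by apply: emeasurable_funM => //; exact/measurable_EFinP.
have fh0 x : (0 <= (f x)%:E * h x)%E by rewrite mule_ge0 ?lee_fin// (ltW (h0 x)).
apply: filterS (density_ae_unique mfh fh0 mrho muf murho) => y fy fy0.
apply: rhoK; apply: contra_neq fy0 => r0; move: fy; rewrite r0 => /eqP.
by rewrite mule_eq0 (gt_eqF (h0 y)) orbF eqe => /eqP.
Qed.

(** At a point where f h = rho is finite and f > 0, h is finite. This supplies the point that
    [truncated_source] requires. *)
Lemma density_factor_fin (mu : probability V R) (f : V -> R) (h : V -> \bar R) (rho : V -> R) :
  measurable_fun setT f -> (forall x, 0 <= f x) ->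
  measurable_fun setT h -> (forall x, 0 <= h x)%E -> measurable_fun setT rho ->
  has_density mu (fun x => (f x)%:E * h x)%E -> has_density mu (EFin \o rho) ->
  exists x, (h x < +oo)%E.
Proof.
move=> mf f0 mh h0 mrho muf murho.
have mEf : measurable_fun setT (EFin \o f) by exact/measurable_EFinP.
have mfh : measurable_fun setT (fun x => (f x)%:E * h x)%E by exact: emeasurable_funM.
have fh0 x : (0 <= (f x)%:E * h x)%E by rewrite mule_ge0 ?lee_fin.
have fn0 := @density_not_ae0 _ _ mu (EFin \o f) h mEf mh muf.
have [x [fx fx0]] := ae_exists (density_ae_unique mfh fh0 mrho muf murho) fn0.
exists x; rewrite ltey; apply/eqP => hx; move: fx; rewrite hx.
by rewrite gt0_muley//= lte_fin lt_neqAle f0 andbT eq_sym.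
Qed.

Lemma heat1_ae_eq (K : R) (g g' : V -> R) (x : V) : 0 <= K ->
  measurable_fun setT g -> compact_source K g' -> {ae leb, forall y, g y = g' y} ->
  heat 1 (EFin \o g) x = (expR (logpot g' 1 x))%:E.
Proof.
move=> K0 mg hg gg'; rewrite -(heat_logpot K0 hg)//.
apply: eq_ae_heat; rewrite ?oner_eq0//.
- exact/measurable_EFinP.
- by apply/measurable_EFinP; exact: (cs_measurable hg).
- by apply: filterS gg' => y + _ /= => ->.
Qed.

(** The two factors are bootstrapped in parallel: positivity of each heat flow bounds the support of
    the other factor, and its finiteness at one point makes its own source integrable. Only then are
    the flows continuous and can be divided out. *)
Lemma schroedinger_regularity (mu0 mu1 : probability V R) (f g : V -> R) :
  measurable_fun setT f -> measurable_fun setT g ->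
  (forall x, 0 <= f x) -> (forall x, 0 <= g x) ->
  Ccinfty_density mu0 -> Ccinfty_density mu1 -> schroedinger_system mu0 mu1 f g ->
  exists K M (F G : V -> R),
    [/\ 0 <= K, compact_source K F /\ compact_source K G, continuous F /\ continuous G,
        forall x, F x <= M /\ G x <= M &
        {ae leb, forall x, f x = F x} /\ {ae leb, forall x, g x = G x}].
Proof.
(* Smoothness at the empty list of derivatives is continuity of the density itself. *)
move=> mf mg f0 g0 [rho0 [/(_ [::])[/= c0 _] s0 d0]] [rho1 [/(_ [::])[/= c1 _] s1 d1]] [df dg].
have mEf : measurable_fun setT (EFin \o f) by exact/measurable_EFinP.
have mEg : measurable_fun setT (EFin \o g) by exact/measurable_EFinP.
have Ef0 x : (0 <= (EFin \o f) x)%E by rewrite lee_fin.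
have Eg0 x : (0 <= (EFin \o g) x)%E by rewrite lee_fin.
have mTf := measurable_heat 1 mEf Ef0.
have mTg := measurable_heat 1 mEg Eg0.
have m0 := continuous_rV_measurable c0.
have m1 := continuous_rV_measurable c1.
have fn0 := density_not_ae0 mEf mTg df.
have gn0 := density_not_ae0 mEg mTf dg.
have Tf0 x := heat_gt0 x ltr01 mEf Ef0 fn0.
have Tg0 x := heat_gt0 x ltr01 mEg Eg0 gn0.
have [K0 K0_ge0 b0] := compactly_supported_box s0.
have [K1 K1_ge0 b1] := compactly_supported_box s1.
pose K := Num.max K0 K1.
have K_ge0 : 0 <= K by rewrite le_max K0_ge0.
have {}b0 y : rho0 y != 0 -> forall i, `|y ord0 i| <= K.
  by move=> ry i; rewrite le_max b0.
have {}b1 y : rho1 y != 0 -> forall i, `|y ord0 i| <= K.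
  by move=> ry i; rewrite le_max (b1 y) ?orbT.
have fK := density_support mf f0 mTg Tg0 m0 b0 df d0.
have gK := density_support mg g0 mTf Tf0 m1 b1 dg d1.
have [x Tgx] := density_factor_fin mf f0 mTg (fun x => ltW (Tg0 x)) m0 df d0.
have [y Tfy] := density_factor_fin mg g0 mTf (fun x => ltW (Tf0 x)) m1 dg d1.
have [f' hf ff'] := truncated_source K_ge0 mf f0 fK fn0 Tfy.
have [g' hg gg'] := truncated_source K_ge0 mg g0 gK gn0 Tgx.
have fTg0 z : (0 <= (EFin \o f) z * heat 1 (EFin \o g) z)%E by rewrite mule_ge0// (ltW (Tg0 z)).
have gTf0 z : (0 <= (EFin \o g) z * heat 1 (EFin \o f) z)%E by rewrite mule_ge0// (ltW (Tf0 z)).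
have E0 : {ae leb, forall x, f' x * expR (logpot g' 1 x) = rho0 x}.
  apply: filterS2 ff' (density_ae_unique (emeasurable_funM mEf mTg) fTg0 m0 df d0) => z <-.
  by rewrite /= (heat1_ae_eq z K_ge0 mg hg gg') => -[].
have E1 : {ae leb, forall x, g' x * expR (logpot f' 1 x) = rho1 x}.
  apply: filterS2 gg' (density_ae_unique (emeasurable_funM mEg mTf) gTf0 m1 dg d1) => z <-.
  by rewrite /= (heat1_ae_eq z K_ge0 mf hf ff') => -[].
have [F [hF cF [M FM] fF]] := continuous_source K_ge0 hf hg c0 s0 b0 E0.
have [G [hG cG [N GN] gG]] := continuous_source K_ge0 hg hf c1 s1 b1 E1.
exists K, (Num.max M N), F, G; split => //.
- by move=> z; rewrite !le_max FM GN orbT.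
- split; first by apply: filterS2 ff' fF => z ->.
  by apply: filterS2 gg' gG => z ->.
Qed.

End regularization.

(** * Concavity *)

Section concave_exp.
Context (R : realType).

Lemma near_itvoo (a b s : R) : a < s < b -> \forall t \near s, a < t < b.
Proof.
move=> /andP[sa sb]; have : s \in `]a, b[ by rewrite in_itv/= sa sb.
by move/near_in_itvoo; apply: filterS => t; rewrite in_itv.
Qed.

(** For f = - exp(- H/n), f'' = exp(- H/n) (n H'' - H'^2) / n^2 >= 0. The function dH may depend on
    the point s, because the differential identities are local in time. *)
Lemma concave_expRN (n : nat) (H Psi : R -> R) : (0 < n)%N ->
  (forall s : R, 0 <= s <= 1 -> Psi s = expR (- (H s / n%:R))) ->
  (forall s : R, 0 < s < 1 -> exists (dH : R -> R) (c : R),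
    [/\ \forall t \near s, is_derive (t : R) 1 H (dH t), is_derive s 1 dH c &
        dH s ^+ 2 <= n%:R * c]) ->
  H t @[t --> 0^'+] --> H 0 -> H t @[t --> 1^'-] --> H 1 ->
  concave_function `[0, 1] Psi.
Proof.
move=> n0 PsiE dH H0 H1.
have nR : 0 < n%:R :> R by rewrite ltr0n.
pose f (s : R) : R := - expR (- (H s / n%:R)).
have df (s h : R) : is_derive s 1 H h ->
    is_derive s 1 f (expR (- (H s / n%:R)) * (h / n%:R)).
  move=> Hs.
  have := is_deriveR_opp (@is_deriveR_chain _ expR (fun t => - (H t / n%:R)) _ _ _
    (is_derive_expR (- (H s / n%:R)))
    (is_deriveR_opp (is_deriveR_mul Hs (is_deriveR_const s n%:R^-1)))).
  by apply: is_deriveR_eq => //; rewrite mulr0 addr0; ring.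
have ddf (s : R) : 0 < s < 1 -> exists (F : R -> R) (c : R),
   [/\ \forall t \near s, is_derive (t : R) 1 f (F t), is_derive s 1 F c & 0 <= c].
  move=> /dH[h [c [hs cs hc]]].
  have Hs : is_derive s 1 H (h s) by exact: nbhs_singleton hs.
  have dE := @is_deriveR_chain _ expR (fun t => - (H t / n%:R)) _ _ _
    (is_derive_expR (- (H s / n%:R)))
    (is_deriveR_opp (is_deriveR_mul Hs (is_deriveR_const s n%:R^-1))).
  have := is_deriveR_mul dE (is_deriveR_mul cs (is_deriveR_const s n%:R^-1)).
  set d := (X in is_derive _ _ _ X) => Ds.
  exists (fun t => expR (- (H t / n%:R)) * (h t / n%:R)), d; split => //.
    by apply: filterS hs => t; exact: df.
  rewrite /d !mulr0 !addr0 -mulrA -mulrDr mulr_ge0 ?expR_ge0//.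
  rewrite (_ : _ + _ = (n%:R * c - h s ^+ 2) / n%:R ^+ 2); last by field; rewrite gt_eqF.
  by rewrite divr_ge0 ?exprn_ge0 ?(ltW nR)// subr_ge0.
have derf (s : R) : 0 < s < 1 -> derivable f s 1.
  by move=> /ddf[F [c [/nbhs_singleton]]] /@ex_derive.
have dderf (s : R) : 0 < s < 1 -> exists2 c, 0 <= c & is_derive s 1 ('D_1 f) c.
  move=> /ddf[F [c [Fs cs c0]]]; exists c => //.
  apply: near_eq_is_derive cs.
  by apply: filterS Fs => t /@derive_val ->.
have cf (l : R) (Q : set_system R) : Filter Q -> H t @[t --> Q] --> l ->
    f t @[t --> Q] --> - expR (- (l / n%:R)).
  move=> FQ Hl; apply: cvgN.
  apply: (continuous_cvg _ (@continuous_expR _ _)).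
  by apply: cvgN; apply: cvgMl.
have cont (s : R) : 0 < s < 1 -> f t @[t --> s] --> f s.
  by move=> /derf /derivable1_diffP /differentiable_continuous.
have fr (s : R) : 0 <= s < 1 -> f t @[t --> s^'+] --> f s.
  move=> /andP[]; rewrite le_eqVlt => /orP[/eqP <- _|s0 s1]; first exact: cf.
  by apply: cvg_at_right_filter; apply: cont; rewrite s0.
have fl (s : R) : 0 < s <= 1 -> f t @[t --> s^'-] --> f s.
  move=> /andP[s0]; rewrite le_eqVlt => /orP[/eqP ->|s1]; first exact: cf.
  by apply: cvg_at_left_filter; apply: cont; rewrite s0.
have convf (t : {i01 R}) (x y : R^o) : 0 <= x -> y <= 1 -> x <= y ->
    (f (conv t x y) <= conv t (f x : R^o) (f y : R^o))%R.
  move=> x0 y1; rewrite le_eqVlt => /orP[/eqP<-|xy].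
    by rewrite !convmm.
  have oo (s : R) : x < s < y -> 0 < s < 1.
    by move=> /andP[xs sy]; rewrite (le_lt_trans x0 xs) (lt_le_trans sy y1).
  apply: second_derivative_convex; last exact: ltW.
  - by move=> s /oo /dderf[c c0] /@derive_val ->.
  - by apply: fl; rewrite (le_lt_trans x0 xy).
  - by apply: fr; rewrite x0 (lt_le_trans xy y1).
  - by move=> s; rewrite in_itv/= => /oo /derf.
  - by move=> s; rewrite in_itv/= => /oo /dderf[c _] /@ex_derive.
(* The order of x and y is removed by the symmetry of convex combinations. *)
have {}convf (t : {i01 R}) (x y : R^o) : 0 <= x <= 1 -> 0 <= y <= 1 ->
    (f (conv t x y) <= conv t (f x : R^o) (f y : R^o))%R.
  move=> /andP[x0 x1] /andP[y0 y1]; have [xy|/ltW yx] := leP x y; first exact: convf.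
  by rewrite convC (convC _ (f x : R^o)); exact: convf.
have fE (s : R) : 0 <= s <= 1 -> - Psi s = f s by move=> /PsiE ->.
move=> t x y; rewrite !inE /= !in_itv /= => xI yI.
rewrite !fE//; first exact: convf.
have cI (p : {i01 R}) (u v : R^o) : 0 <= u -> v <= 1 -> u <= v -> 0 <= conv p u v <= 1.
  move=> u0 v1 /convR_itv - /(_ p); rewrite in_itv/= => /andP[lu lv].
  by rewrite (le_trans u0 lu) (le_trans lv v1).
case/andP: xI => x0 x1; case/andP: yI => y0 y1.
have [xy|/ltW yx] := leP (x : R) y; first exact: cI.
by rewrite convC; exact: cI.
Qed.

End concave_exp.

(** * Entropy of the interpolation between two continuous sources *)

Section interpolation_entropy.
Context (R : realType) (n : nat).
Local Notation V := 'rV[R]_n.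
Local Notation leb := (lebesgue_rV R n).
Context (K M : R) (K0 : 0 <= K) (F G : V -> R).
Hypothesis hF : compact_source K F.
Hypothesis hG : compact_source K G.
Hypothesis cF : continuous F.
Hypothesis cG : continuous G.
Hypothesis FM : forall x, F x <= M.
Hypothesis GM : forall x, G x <= M.

(* [logpot] is meaningless at time 0, where the semigroup is the identity. *)
Definition interpolation_density (s : R) (x : V) : R :=
  (if s == 0 then F x else expR (logpot F s x)) *
  (if s == 1 then G x else expR (logpot G (1 - s) x)).

Definition interpolation_entropy (s : R) : R :=
  \int[leb]_x (interpolation_density s x * ln (interpolation_density s x)).

Let rho := interpolation_density.
Let H := interpolation_entropy.

Let rhoE (s : R) x : 0 < s < 1 -> rho s x = expR (logpot F s x + logpot G (1 - s) x).
Proof.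
by move=> /andP[s0 s1]; rewrite /rho /interpolation_density (gt_eqF s0) (lt_eqF s1) expRD.
Qed.

Let factor_measurable (f : V -> R) (s : R) : compact_source K f -> 0 <= s ->
  measurable_fun setT (fun x => if s == 0 then f x else expR (logpot f s x)).
Proof.
move=> hf; rewrite le_eqVlt eq_sym => /orP[/eqP ->|s0]; first by rewrite eqxx; exact: (cs_measurable hf).
rewrite (gt_eqF s0); apply: measurableT_comp => //.
have [mt _] := tame_logpot K0 hf (s + 1) (divr_gt0 s0 (ltr0n R 2)).
by apply: mt; apply/andP; split; lra.
Qed.

Let factor_le (f : V -> R) (s : R) x : compact_source K f -> (forall x, f x <= M) -> 0 <= s ->
  0 <= (if s == 0 then f x else expR (logpot f s x)) <= M.
Proof.
move=> hf fM; rewrite le_eqVlt eq_sym => /orP[/eqP ->|s0].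
  by rewrite eqxx (cs_ge0 hf) fM.
by rewrite (gt_eqF s0) expR_ge0/=; exact: (heat_le_sup K0 hf fM).
Qed.

Let factor_gauss (f : V -> R) (s : R) : compact_source K f -> 0 < s ->
  exists2 c : R, 0 < c & exists2 C : R, 0 <= C &
    forall x, expR (logpot f s x) <= C * expR (- c * sqr_norm2 x).
Proof.
move=> hf s0; have s2 : 0 < s / 2 by lra.
have s3 : s / 2 < s + 1 by lra.
have [c c0 [C HC]] := logpot_le K0 hf s2 s3.
exists c => //; exists (expR C); first exact: expR_ge0.
move=> x; rewrite -expRD ler_expR mulNr; apply: HC.
by apply/andP; split; lra.
Qed.

Let M_ge0 : 0 <= M. Proof. exact: le_trans (cs_ge0 hF 0) (FM 0). Qed.

Let oneB_eq0 (s : R) : (1 - s == 0) = (s == 1). Proof. by rewrite subr_eq0 eq_sym. Qed.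

(** At every time one factor is a heat flow at positive time, hence Gaussian: that of F for s = 1,
    that of G otherwise. The other factor is at most M. *)
Lemma interpolation_density_bound (s : R) : 0 <= s <= 1 ->
  [/\ measurable_fun setT (rho s), forall x, 0 <= rho s x &
    exists2 c : R, 0 < c & exists2 C : R, 0 <= C &
    forall x, rho s x <= C * expR (- c * sqr_norm2 x)].
Proof.
move=> /andP[s0 s1]; have t0 : 0 <= 1 - s by rewrite subr_ge0.
have mG := factor_measurable hG t0; rewrite oneB_eq0 in mG.
have GB x := factor_le x hG GM t0; rewrite oneB_eq0 in GB.
have FB x := factor_le x hF FM s0.
split.
- exact: (measurable_funM (factor_measurable hF s0) mG).
- by move=> x; apply: mulr_ge0; [have /andP[] := FB x|have /andP[] := GB x].
have [s10|s10] := eqVneq s 1.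
  have sp : 0 < s by rewrite s10.
  have [c c0 [C C0 HC]] := factor_gauss hF sp.
  exists c => //; exists (C * M); first exact: mulr_ge0.
  move=> x; have /andP[g0 gM] := GB x.
  rewrite /rho /interpolation_density (gt_eqF sp) mulrAC.
  by apply: ler_pM; rewrite ?expR_ge0.
have tp : 0 < 1 - s by rewrite subr_gt0 lt_neqAle s10.
have [c c0 [C C0 HC]] := factor_gauss hG tp.
exists c => //; exists (M * C); first exact: mulr_ge0.
move=> x; have /andP[f0 fM] := FB x.
rewrite /rho /interpolation_density (negPf s10) -mulrA.
by apply: ler_pM; rewrite ?expR_ge0.
Qed.

Hypothesis rho1 : forall s : R, 0 < s < 1 -> \int[leb]_x rho s x = 1.

Lemma interpolation_entropy_derive2 (s : R) : 0 < s < 1 ->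
  exists (dH : R -> R) (c : R),
    [/\ \forall t \near s, is_derive (t : R) 1 H (dH t), is_derive s 1 dH c &
        dH s ^+ 2 <= n%:R * c].
Proof.
move=> /andP[s0 s1].
(* For times in ]a, b[ both flows run for times bounded away from 0: more than a for F, more than 1
   - b for G. *)
pose a := s / 2; pose b := (1 + s) / 2.
have a0 : 0 < a by rewrite /a; lra.
have b1 : 0 < 1 - b by rewrite /b; lra.
have ba : 1 - b < 1 - a by rewrite /a /b; lra.
have sab : a < s < b by apply/andP; rewrite /a /b; split; lra.
have ab01 (t : R) : a < t < b -> 0 < t < 1 by move=> /andP[ta tb]; apply/andP; split; lra.
have hphi := heat_log_logpot K0 hF b a0.
have := heat_log_rev (heat_log_logpot K0 hG (1 - a) b1); rewrite !subKr => hpsi.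
have [c c0 [C HC]] := logpot_le K0 hG b1 ba.
have gau : gaussian a b (fun (t : R) (x : V) => expR (logpot F t x + logpot G (1 - t) x)).
  split.
    move=> t /ab01 t01; have t01' : 0 <= t <= 1 by case/andP: t01 => /ltW -> /ltW ->.
    have [mt _ _] := interpolation_density_bound t01'.
    by apply: eq_measurable_fun mt => x _; exact: rhoE.
  exists c => //; exists (M * expR C); first by rewrite mulr_ge0// expR_ge0.
  move=> t x tab; have /andP[t0 t1] := ab01 t tab.
  rewrite ger0_norm ?expR_ge0// expRD -mulrA; apply: ler_pM; rewrite ?expR_ge0//.
    exact: (heat_le_sup K0 hF FM).
  rewrite -expRD ler_expR mulNr; apply: HC.
  by case/andP: tab => ta tb; apply/andP; split; lra.
have rho1' (t : R) : a < t < b -> \int[leb]_x expR (logpot F t x + logpot G (1 - t) x) = 1.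
  move=> /ab01 t01; rewrite -[RHS](rho1 t01).
  by apply: eq_Rintegral => x _; exact: (esym (rhoE x t01)).
have sqr := sqr_derive_entropy_le hphi hpsi gau rho1' sab.
have d2 := is_derive2_entropy hphi hpsi gau sab.
have HE (t : R) : a < t < b -> H t = \int[leb]_x
    (expR (logpot F t x + logpot G (1 - t) x) * (logpot F t x + logpot G (1 - t) x)).
  move=> /ab01 t01; apply: eq_Rintegral => x _.
  by rewrite -/(rho t x) (rhoE x t01) expRK.
eexists; eexists; split; [|exact: d2|exact: sqr].
near=> t.
have tab : a < t < b by near: t; exact: near_itvoo.
apply: near_eq_is_derive (is_derive_entropy hphi hpsi gau tab).
by near=> r; rewrite HE//; near: r; exact: near_itvoo.
Unshelve. all: by end_near.
Qed.

Lemma interpolation_entropy_cvg0 : H t @[t --> 0^'+] --> H 0.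
Proof.
have -> : H 0 = \int[leb]_x (F x * expR (logpot G 1 x) * ln (F x * expR (logpot G 1 x))).
  apply: eq_Rintegral => x _.
  by rewrite /interpolation_density eqxx eq_sym (negPf (oner_neq0 R)) subr0.
apply: cvg_trans (cvg_entropy_endpoint K0 hF hG cF FM).
apply: near_eq_cvg; near=> s.
have s01 : 0 < s < 1 by apply/andP; split; near: s; [exact: nbhs_right_gt|exact: nbhs_right_lt].
by apply: eq_Rintegral => x _; rewrite -/(rho s x) (rhoE x s01) expRD.
Unshelve. all: by end_near.
Qed.

(** Time reversal exchanges F and G, so this is the limit at 0 along the sequences 1 - u. *)
Lemma interpolation_entropy_cvg1 : H t @[t --> 1^'-] --> H 1.
Proof.
have -> : H 1 = \int[leb]_x (G x * expR (logpot F 1 x) * ln (G x * expR (logpot F 1 x))).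
  apply: eq_Rintegral => x _.
  by rewrite /interpolation_density eqxx (negPf (oner_neq0 R)) [_ * G x]mulrC.
have /cvg_at_rightP cvgH := cvg_entropy_endpoint K0 hG hF cG GM.
apply/cvg_at_leftP => u [u1 uc].
have w0 k : 0 < 1 - u k by rewrite subr_gt0.
have wc : 1 - u k @[k --> \oo] --> (0 : R).
  by rewrite -(subrr (1 : R)); apply: cvgB => //; exact: cvg_cst.
apply: cvg_trans (cvgH (fun k => 1 - u k) (conj w0 wc)).
apply: near_eq_cvg; near=> k.
have u01 : 0 < u k < 1 by apply/andP; split => //; near: k; exact: (cvgr_gt 1 uc).
apply: eq_Rintegral => x _; rewrite -/(rho _ x) (rhoE x u01) expRD subKr.
exact: (f_equal (fun z => z * ln z) (mulrC (expR (logpot G (1 - u k) x)) (expR (logpot F (u k) x)))).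
Unshelve. all: by end_near.
Qed.

End interpolation_entropy.

Theorem theorem6 (R : realType) (n : nat) (n_gt0 : (0 < n)%N)
    (Rm : {measure set (path_space R n) -> \bar R})
    (Rm_bm : reversible_brownian_motion Rm)
    (mu0 mu1 : probability 'rV[R]_n R)
    (mu0_smooth : Ccinfty_density mu0) (mu1_smooth : Ccinfty_density mu1)
    (mu : R -> probability 'rV[R]_n R)
    (mu_interp : entropic_interpolation Rm mu0 mu1 mu) :
  concave_function `[0, 1]
    (fun s => fine (expeR (- (entropy (mu s) (lebesgue_rV R n) / n%:R%:E)))).
Proof.
have [Phat [f [g [[[P0 P1] _] [mf mg f0 g0] sys fgP marg]]]] := mu_interp.
have [K [M [F [G [K0 [hF hG] [cF cG] FGM [fF gG]]]]]] :=
  schroedinger_regularity mf mg f0 g0 mu0_smooth mu1_smooth sys.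
have [sys0 sys1] := sys.
have FM x : F x <= M by case: (FGM x).
have GM x : G x <= M by case: (FGM x).
pose leb := lebesgue_rV R n.
have mEf : measurable_fun setT (EFin \o f) by exact/measurable_EFinP.
have mEg : measurable_fun setT (EFin \o g) by exact/measurable_EFinP.
have mEF : measurable_fun setT (EFin \o F) by apply/measurable_EFinP; exact: (cs_measurable hF).
have mEG : measurable_fun setT (EFin \o G) by apply/measurable_EFinP; exact: (cs_measurable hG).
have aeF : ae_eq leb setT (EFin \o f) (EFin \o F) by apply: filterS fF => x + _ /= => ->.
have aeG : ae_eq leb setT (EFin \o g) (EFin \o G) by apply: filterS gG => x + _ /= => ->.
have heatF (t : R) x : 0 < t -> heat t (EFin \o f) x = (expR (logpot F t x))%:E.
  by move=> t0; rewrite -(heat_logpot K0 hF)//; apply: eq_ae_heat => //; rewrite gt_eqF.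
have heatG (t : R) x : 0 < t -> heat t (EFin \o g) x = (expR (logpot G t x))%:E.
  by move=> t0; rewrite -(heat_logpot K0 hG)//; apply: eq_ae_heat => //; rewrite gt_eqF.
have marg0 A : measurable A -> mu 0 A = mu0 A.
  by move=> mA; rewrite -(marg (time0 R) A mA) (P0 A mA).
have marg1 A : measurable A -> mu 1 A = mu1 A.
  by move=> mA; rewrite -(marg (time1 R) A mA) (P1 A mA).
have dens (s : R) : 0 <= s <= 1 ->
    has_density (mu s) (EFin \o interpolation_density F G s).
  move=> /andP[s0 s1] A mA.
  have mrho : measurable_fun A (EFin \o interpolation_density F G s).
    have s01 : 0 <= s <= 1 by rewrite s0.
    have [mr _ _] := interpolation_density_bound K0 hF hG FM GM s01.
    by apply: measurable_funTS; exact/measurable_EFinP.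
  have mheat (t : R) (h : 'rV[R]_n -> R) : measurable_fun setT (EFin \o h) -> (forall x, 0 <= h x) ->
      measurable_fun setT (heat t (EFin \o h)).
    by move=> mh h0; apply: measurable_heat => // x; rewrite lee_fin.
  (* At the endpoints the density is read off from the Schroedinger system, since the marginal of
     Phat is mu0 or mu1; the formula for the marginals covers only interior times. *)
  have [s00|s00] := eqVneq s 0.
    move: mrho; rewrite s00 => mrho; apply: (etrans (marg0 A mA)).
    apply: (etrans (sys0 A mA)); apply: ae_eq_integral => //.
      by apply: measurable_funTS; apply: emeasurable_funM => //; exact: mheat.
    apply: filterS fF => x fx _; rewrite (heatG 1 x ltr01) fx -EFinM /= /interpolation_density.
    by rewrite eqxx eq_sym (negPf (oner_neq0 R)) subr0.
  have [s10|s10] := eqVneq s 1.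
    move: mrho; rewrite s10 => mrho; apply: (etrans (marg1 A mA)).
    apply: (etrans (sys1 A mA)); apply: ae_eq_integral => //.
      by apply: measurable_funTS; apply: emeasurable_funM => //; exact: mheat.
    apply: filterS gG => x gx _; rewrite (heatF 1 x ltr01) gx -EFinM /= /interpolation_density.
    by rewrite eqxx (negPf (oner_neq0 R)) mulrC.
  have sp : 0 < s by rewrite lt_neqAle eq_sym s00.
  have s1p : s < 1 by rewrite lt_neqAle s10.
  have sI : s \in `[0%R, 1%R]%classic by rewrite inE /= in_itv/= s0.
  have s01 : 0 < val (exist _ s sI : time R) < 1 by rewrite /= sp.
  apply: (etrans (fg_transform_marginal Rm_bm mf mg f0 g0 fgP (marg (exist _ s sI : time R)) s01 mA)).
  apply: eq_integral => x _; rewrite /= heatF// heatG ?subr_gt0// -EFinM.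
  by rewrite /interpolation_density (negPf s00) (negPf s10).
have rho1 (s : R) : 0 < s < 1 -> \int[leb]_x interpolation_density F G s x = 1.
  move=> /andP[s0 s1]; have s01 : 0 <= s <= 1 by rewrite !ltW.
  rewrite /Rintegral -(dens s s01 setT measurableT).
  by rewrite [X in fine X](_ : _ = 1%E)//; exact: probability_setT.
apply: (@concave_expRN _ n (interpolation_entropy F G)) => //.
- move=> s s01.
  have [mr r0 [c c0 [C C0 rC]]] := interpolation_density_bound K0 hF hG FM GM s01.
  (* The entropy is a real number and n > 0, so the extended-real expression reduces to exp(-
     H/n). *)
  rewrite (entropy_rV c0 C0 mr r0 rC (dens s s01)) inver gt_eqF ?ltr0n//.
- move=> s; exact: (interpolation_entropy_derive2 K0 hF hG FM GM rho1 (s := s)).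
- exact: (interpolation_entropy_cvg0 K0 hF hG cF FM).
- exact: (interpolation_entropy_cvg1 K0 hF hG cG GM).
Qed.
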